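(* For any $n\in\mathbb N$, $a,b\ge1$, $p\in[1,\infty]$, $r\in\mathbb N$, any partition $\mathcal P_M=\{B_1,\dots,B_M\}$ of $N_n$ and any $r$-coloring $\mathcal C_r[\mathcal P_M]$ of this partition, $$\Big\|\sup_{f\in\mathcal F}\mathbb G_n(f)\Big\|_{L^1(\mathbb P)}\lesssim\sqrt{K_r}\,\max_{m\in[M]}\Gamma_p(B_m)\;\gamma_{2,a}\Big(\mathcal F,\max_{i\in N_n}\|\cdot\|_{L^{2p}(P_{Z_i})}\Big)+\Big(\frac{K_r\max_{m\in[M]}|B_m|}{\sqrt n}+\sqrt n\,\bar\tau_{\operatorname{cone}\mathcal F}\big(\mathcal P_M,\mathcal C_r[\mathcal P_M]\big)\Big)\gamma_{1,b}(\mathcal F,\|\cdot\|_\infty),$$ where $\lesssim$ means inequality up to a universal multiplicative constant.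
   Context: Setup. $\mathfrak G_n=(N_n,V_n)$ is a finite graph with $|N_n|=n$; $d_n(i,j)$ is the shortest-path distance ($+\infty$ if no path exists, $d_n(i,i)=0$), and $d_n(A,B)=\inf_{i\in A,j\in B}d_n(i,j)$. $(Z_i)_{i\in N_n}$ are random elements with values in a Polish space $(\mathsf Z,\mathcal Z)$ (probability $\mathbb P$, expectation $\mathbb E$; $P_{Z_i}$ is the law of $Z_i$). For disjoint $A,B\subseteq N_n$ with $d_n(A,B)=+\infty$, $\sigma(Z_i:i\in A)$ and $\sigma(Z_j:j\in B)$ are independent. $\mathcal F\ni0$ is a class of real-valued measurable functions on $\mathsf Z$, and $\mathbb G_n(f)=n^{-1/2}\sum_{i\in N_n}\{f(Z_i)-\mathbb E[f(Z_i)]\}$. $[M]=\{1,\dots,M\}$; $Z_B=(Z_i)_{i\in B}$; $\mathcal F-\mathcal F=\{f-g:f,g\in\mathcal F\}$; $\operatorname{cone}\mathcal F=\{\lambda f:\ f\in\mathcal F,\ \lambda>0,\ \|\lambda f\|_\infty\le1\}$. Colorings. For a partition $\mathcal P_M=\{B_1,\dots,B_M\}$ of $N_n$, a proper $r$-coloring is a map $c:[M]\to\mathbb N$ such that $c(m)=c(m')$, $m\ne m'$ imply $d_n(B_m,B_{m'})>r$. $K_r=K_r(\mathcal P_M)$ is the smallest possible number of distinct colors over all proper $r$-colorings; the coloring is taken with colors labelled by $[K_r]$, and $\mathcal C_r[\mathcal P_M]$ denotes the collection of its color classes $C_k=c^{-1}(k)$, $k\in[K_r]$. $\tau$-coefficient.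 For a Polish space $\mathsf X$ with pseudometric $d_{\mathsf X}$, an $\mathsf X$-valued $X$ with $\mathbb E[d_{\mathsf X}(X,x_0)]<\infty$ for some $x_0$, and a sub-$\sigma$-field $\mathcal M$, $\tau_{d_{\mathsf X}}(\mathcal M,X):=\big\|\sup_g|\mathbb E[g(X)\mid\mathcal M]-\mathbb E[g(X)]|\big\|_{L^1(\mathbb P)}$, supremum over measurable $g:\mathsf X\to\mathbb R$ that are $1$-Lipschitz for $d_{\mathsf X}$. For $\mathcal B\subseteq\operatorname{span}\mathcal F$ and $z,z'\in\mathsf Z^m$ let $d_{\mathcal B,m}(z,z')=\sum_{s=1}^m\sup_{f\in\mathcal B}|f(z_s)-f(z_s')|$, and $$\bar\tau_{\mathcal B}(\mathcal P_M,\mathcal C_r[\mathcal P_M]):=\frac1n\sum_{k=1}^{K_r}\sum_{m\in C_k}\tau_{d_{\mathcal B,|B_m|}}\Big(\sigma\big(Z_j:j\in\textstyle\bigcup_{m'\in C_k,m'<m}B_{m'}\big),Z_{B_m}\Big),$$ with the trivial $\sigma$-field when the union is empty. Within-block dependence factor. For real random variables, $\alpha(X,Y)=2\sup_{s,t\in\mathbb R}|\mathbb P(X\ge t,Y\ge s)-\mathbb P(X\ge t)\mathbb P(Y\ge s)|$. For $B\subseteq N_n$, $\alpha_{\mathcal F,B}(\rho)=\sup_{f\in\mathcal F-\mathcal F}\ \sup_{i,j\in B:\,d_n(i,j)\ge\rho}\alpha(f(Z_i),f(Z_j))$, with $\alpha_{\mathcal F,B}(0):=1$ and $\alpha_{\mathcal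 F,B}(\infty):=0$. Let $S_B(\rho)=\{(i,j)\in B\times B:d_n(i,j)=\rho\}$ and $R(B)=\{\rho\in\{0,\dots,n-1\}\cup\{\infty\}:S_B(\rho)\neq\varnothing\}$. For $p\in(1,\infty]$, $$\Gamma_p^{\mathrm{sum}}(B)=\sqrt{\sum_{\rho\in R(B)}\tfrac{|S_B(\rho)|}{|B|}\,\alpha_{\mathcal F,B}(\rho)^{1-1/p}},\qquad \Gamma_p^\sharp(B)=\sqrt{\Big(\int_0^1\Big[\sum_{\rho\in R(B)}\tfrac{|S_B(\rho)|}{|B|}1\{\alpha_{\mathcal F,B}(\rho)\ge u\}\Big]^{\frac p{p-1}}du\Big)^{1-\frac1p}}$$ (with $p/(p-1)=1$, $1/p=0$ if $p=\infty$), and $\Gamma_1^{\mathrm{sum}}(B)=\Gamma_1^\sharp(B)=\sqrt{\sum_{\rho\in R(B)}|S_B(\rho)|/|B|}$. Finally $\Gamma_p(B)=\min\{\Gamma_p^{\mathrm{sum}}(B),\Gamma_p^\sharp(B)|B|^{1/(2p)}\}$. Talagrand complexity. For $s>0$, an admissible partition sequence of order $s$ for $\mathcal F$ is a sequence $T^\infty=(T_l)_{l\ge0}$ of partitions of $\mathcal F$ that is increasing (each $T_{l+1}$ refines $T_l$) with $\operatorname{card}(T_0)=1$ and $\operatorname{card}(T_l)\le2^{2^{l/s}}$ for $l\ge1$. $T(f,T_l)$ is the element of $T_l$ containing $f$ and $D(f,T_l)(z)=\sup_{f_1,f_2\in T(f,T_l)}|f_1(z)-f_2(z)|$. For a seminorm-type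 functional $d$, $\gamma_{q,s}(\mathcal F,d)=\inf_{T^\infty}\sup_{f\in\mathcal F}\sum_{l=0}^\infty2^{l/q}d(D(f,T_l))$, the infimum being over admissible partition sequences of order $s$. *)

(* Defs.v *)
From HB Require Import structures.
From mathcomp Require Import all_boot all_order all_algebra.
From mathcomp Require Import all_classical all_reals all_analysis.
From mathcomp Require Import measurable_realfun ess_sup_inf.

Set Implicit Arguments.
Unset Strict Implicit.
Unset Printing Implicit Defensive.

Import Order.TTheory GRing.Theory Num.Theory.
Import numFieldNormedType.Exports.

Local Open Scope classical_set_scope.
Local Open Scope ring_scope.

Section Graph.
Context (R : realType) (N : finType) (e : rel N).
Implicit Types (i j : N) (A B : {set N}) (r : nat).

(* Least length of a walk from i to j; the infimum of the empty set is +oo. *)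
Definition gdist i j : \bar R :=
  ereal_inf [set (size w)%:R%:E | w in [set w : seq N | path e i w /\ last i w = j]].

Definition set_gdist A B : \bar R :=
  ereal_inf [set gdist i j | i in [set` A] & j in [set` B]].

Definition proper_coloring (M : nat) (B : 'I_M -> {set N}) r
    (I : eqType) (c : 'I_M -> I) : Prop :=
  forall m m', c m = c m' -> m != m' -> (r%:R%:E < set_gdist (B m) (B m'))%E.

Definition colorable (M : nat) (B : 'I_M -> {set N}) r (k : nat) : bool :=
  `[< exists2 c : 'I_M -> nat,
        proper_coloring B r c & size (undup (codom c)) = k >].

Lemma colorable_ex (M : nat) (B : 'I_M -> {set N}) r :
  exists k, colorable B r k.
Proof.
exists (size (undup (codom (@nat_of_ord M)))); apply/asboolP.
by exists (@nat_of_ord M) => // m m' /val_inj ->; rewrite eqxx.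
Qed.

Definition min_colors (M : nat) (B : 'I_M -> {set N}) r : nat :=
  ex_minn (colorable_ex B r).

Definition pairs_at B (rho : \bar R) : {set N * N} :=
  [set ij | [&& ij.1 \in B, ij.2 \in B & gdist ij.1 ij.2 == rho]]%SET.

(* {0, ..., |N| - 1} together with +oo *)
Definition distances : seq (\bar R) :=
  rcons [seq k%:R%:E | k <- iota 0 #|N|] +oo%E.

Definition radii B : seq (\bar R) :=
  [seq rho <- distances | pairs_at B rho != finset.set0].

Definition pair_freq B rho : R := #|pairs_at B rho|%:R / #|B|%:R.

End Graph.

(* A topological space is Polish iff its topology is that of some structure of
   complete pseudometric space that is Hausdorff and second countable; only the
   Borel sigma-algebra of X is used, never the chosen pseudometric. *)
Definition polish_space (R : realType) (X : completePseudoMetricType R) : Prop :=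
  hausdorff_space X /\ @second_countable X.

Section FunctionClasses.
Context (R : realType) (X : Type).
Implicit Types (F : set (X -> R)) (h : X -> \bar R).

Definition sup_norm h : \bar R := ereal_sup [set `|h z|%E | z in setT].

Definition class_sub F : set (X -> R) := [set f \- g | f in F & g in F].

Definition cone F : set (X -> R) :=
  [set h | exists f lambda, [/\ F f, 0 < lambda,
     h = (fun z => lambda * f z) & (sup_norm (EFin \o h) <= 1)%E]].

Definition admissible (s : R) F (T : nat -> set (set (X -> R))) : Prop :=
  [/\ forall l, partition (T l) id F,
      forall l A, T l.+1 A -> exists2 A', T l A' & A `<=` A',
      (T 0%N #= `I_1)%card
    & forall l, (1 <= l)%N -> exists2 k : nat, (T l #= `I_k)%card &
        k%:R <= 2%R `^ (2%R `^ (l%:R / s)) ].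

(* For T a partition and f in the partitioned set, the cell containing f. *)
Definition cell (T : set (set (X -> R))) (f : X -> R) : set (X -> R) :=
  \bigcup_(A in [set A | T A /\ A f]) A.

Definition cell_diam (T : set (set (X -> R))) (f : X -> R) (z : X) : \bar R :=
  ereal_sup [set `|f1 z - f2 z|%:E | f1 in cell T f & f2 in cell T f].

Definition gamma (q s : R) F (d : (X -> \bar R) -> \bar R) : \bar R :=
  ereal_inf [set
    ereal_sup [set (\sum_(0 <= l <oo)
                     (2%R `^ (l%:R / q))%:E * d (cell_diam (T l) f))%E | f in F]
    | T in admissible s F].

Definition dclass (B : set (X -> R)) (m : nat) (z z' : m.-tuple X) : \bar R :=
  (\sum_(s < m) ereal_sup [set `|f (tnth z s) - f (tnth z' s)|%:E | f in B])%E.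

End FunctionClasses.

Section Dependence.
Context (R : realType) d (T : measurableType d) (P : probability T R).

Definition independent_sigma (M1 M2 : set (set T)) : Prop :=
  forall A B, M1 A -> M2 B -> (P (A `&` B) = P A * P B)%E.

Definition alpha (X Y : T -> R) : R :=
  2 * sup [set `|fine (P ([set w | st.2 <= X w] `&` [set w | st.1 <= Y w]))
                 - fine (P [set w | st.2 <= X w]) * fine (P [set w | st.1 <= Y w])|
          | st in [set: R * R]].

(* Y is a version of E[X | M], for X integrable. *)
Definition is_cond_exp (M : set (set T)) (X Y : T -> R) : Prop :=
  [/\ P.-integrable setT (EFin \o Y),
      forall U : set R, measurable U -> M (Y @^-1` U)
    & forall A, M A ->
        (\int[P]_(w in A) (Y w)%:E = \int[P]_(w in A) (X w)%:E)%E].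

Definition is_ess_supremum (H : set (T -> \bar R)) (W : T -> \bar R) : Prop :=
  [/\ measurable_fun [set: T] W,
      forall h, H h -> {ae P, forall w, (h w <= W w)%E}
    & forall W', measurable_fun [set: T] W' ->
        (forall h, H h -> {ae P, forall w, (h w <= W' w)%E}) ->
        {ae P, forall w, (W w <= W' w)%E}].

(* Every family of measurable functions has an essential supremum, unique up to
   a.e. equality, so the default value [cst 0] is never used for such families. *)
Definition ess_supremum (H : set (T -> \bar R)) : T -> \bar R :=
  xget (cst 0%E) (is_ess_supremum H).

Context d' (X : measurableType d').

Definition deviations (dX : X -> X -> \bar R) (M : set (set T)) (xi : T -> X) :
    set (T -> \bar R) :=
  [set h | exists (g : X -> R) (Y : T -> R),
    [/\ measurable_fun setT g,
        forall x y, (`|g x - g y|%:E <= dX x y)%E,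
        is_cond_exp M (g \o xi) Y
      & h = fun w => `|Y w - fine 'E_P[g \o xi]|%:E]].

(* Conditional expectations being defined almost surely, the supremum of an
   uncountable family of them is the essential supremum. *)
Definition tau (dX : X -> X -> \bar R) (M : set (set T)) (xi : T -> X) : \bar R :=
  'N[P]_1[ess_supremum (deviations dX M xi)]%E.

End Dependence.

Section Network.
Context (R : realType) d (T : measurableType d) (P : probability T R).
Context d' (X : measurableType d') (N : finType) (e : rel N)
  (Z : N -> {RV P >-> X}).

Definition sigma_of (A : {set N}) : set (set T) :=
  <<s \bigcup_(i in [set` A]) preimage_set_system setT (Z i) measurable >>.

Definition network_dependent : Prop :=
  forall A B : {set N}, (A :&: B)%SET = finset.set0 -> set_gdist R e A B = +oo%E ->
    independent_sigma P (sigma_of A) (sigma_of B).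

Definition restriction (B : {set N}) (w : T) : #|B|.-tuple X :=
  [tuple Z (enum_val s) w | s < #|B|].

(* The junk value of [fine] on infinite expectations is immaterial: if
   gamma 1 b F sup_norm is finite and 0 is in F, then F is uniformly bounded. *)
Definition emp_process (f : X -> R) (w : T) : R :=
  (Num.sqrt #|N|%:R)^-1 * \sum_(i : N) (f (Z i w) - fine 'E_P[f \o Z i]).

Definition tau_bar (C : set (X -> R)) (M : nat) (B : 'I_M -> {set N})
    (K : nat) (c : 'I_M -> 'I_K) : \bar R :=
  ((#|N|%:R^-1)%:E * \sum_(k < K) \sum_(m < M | c m == k)
     tau P (@dclass R X C #|B m|)
         (sigma_of (\bigcup_(m' < M | (c m' == k) && (m' < m)%N) B m')%SET)
         (restriction (B m)))%E.

(* On a non-measurable h, [Lnorm] is built from the lower integral.  This is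
   harmless for h = cell_diam: if gamma 1 b F sup_norm is finite, F is totally
   bounded, hence separable, for the sup norm, so that cell diameters and
   suprema over F are measurable. *)
Definition max_Lnorm (q : \bar R) (h : X -> \bar R) : \bar R :=
  (\big[maxe/0%E]_(i : N) 'N[distribution P (Z i)]_q[h])%E.

Context (F : set (X -> R)).

Definition alpha_class (B : {set N}) (rho : \bar R) : R :=
  if rho == 0%E then 1 else if rho == +oo%E then 0 else
  sup [set x | exists f i j, [/\ class_sub F f, i \in B, j \in B,
        (rho <= gdist R e i j)%E & x = alpha P (f \o Z i) (f \o Z j)]].

(* [fine (p^-1)%E] is 1/p, with 1/+oo = 0. *)
Definition Gamma_sum (p : \bar R) (B : {set N}) : R :=
  if p == 1%E then Num.sqrt (\sum_(rho <- radii R e B) pair_freq e B rho)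
  else Num.sqrt (\sum_(rho <- radii R e B)
         pair_freq e B rho * alpha_class B rho `^ (1 - fine (p^-1)%E)).

(* [hoelder_conjugate p] is p / (p - 1), and 1 when p = +oo. *)
Definition Gamma_sharp (p : \bar R) (B : {set N}) : R :=
  if p == 1%E then Num.sqrt (\sum_(rho <- radii R e B) pair_freq e B rho)
  else Num.sqrt
    ((\int[lebesgue_measure]_(u in `[0%R, 1%R])
        (\sum_(rho <- radii R e B)
           pair_freq e B rho * ((u : R) <= alpha_class B rho)%R%:R)
          `^ fine (hoelder_conjugate p))
      `^ (1 - fine (p^-1)%E)).

Definition Gamma (p : \bar R) (B : {set N}) : R :=
  Num.min (Gamma_sum p B)
          (Gamma_sharp p B * #|B|%:R `^ (fine (p^-1)%E / 2)).

End Network.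

(* Main.v *)
Require Import Defs.
From HB Require Import structures.
From mathcomp Require Import all_boot all_order all_algebra.
From mathcomp Require Import all_classical all_reals all_analysis.
From mathcomp Require Import measurable_realfun ess_sup_inf.
From mathcomp Require Import ring lra.

Set Implicit Arguments.
Unset Strict Implicit.
Unset Printing Implicit Defensive.

Import Order.TTheory GRing.Theory Num.Theory.
Import numFieldNormedType.Exports.

Local Open Scope classical_set_scope.
Local Open Scope ring_scope.

(* The blocks of one colour class are decoupled without any coupling.  For a
   functional Psi that is Lipschitz for the sup norm over F, the block sums are
   replaced one by one, from the last to the first, by independent copies.  One
   replacement costs at most gamma_1 times a tau-coefficient: once the past is
   rounded to a finite grid, the functions y |-> Psi (past + y) form a finite
   family of Lipschitz functions, indexed by events of the past, and tau controls
   the difference of their conditional and unconditional means.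

   Taking for Psi the maximum over the last level of a chain, the decoupled mean
   is bounded by generic chaining: Psi is at most a weighted sum of exponentials
   of the links, exponentials are eigenfunctions of averaging over an independent
   block, and the eigenvalues are moment generating functions bounded as in
   Bernstein's inequality.  The two complexities gamma_2 and gamma_1 are handled
   by one chain, for the common refinement of two admissible sequences.

   Variances of block sums are sums of covariances.  Each covariance is bounded
   by truncating both variables at a level depending on the pair: the truncated
   part is controlled by alpha, the remainder by the 2p-th moments.  Finally the
   colours are summed by the Cauchy-Schwarz inequality. *)

(** * Expectations of bounded random variables *)

(** The probability space is given and may carry no extra randomness, so independent copies need not
    exist on it; iterated integrals play their role. The functionals see only finitely many
    coordinates of a process, which avoids both a sigma-field on processes and the measurability of
    a supremum over [F].

    For this the chain stops at a level L with 2|N| <= 2^L: what remains of f moves the sum by at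
    most 2|N| [D1 L f], a further term of the gamma_1 sum. Orders a, b >= 1 leave at most 2^(2^l)
    cells at level l, hence at most 4^(2^l) pairs of cells, and the final constant depends on
    neither a nor b.

    The constants fit together as follows. 14 = 2 + 6 * 2 comes from the truncation of covariances,
    6 from 6^2 >= 2 * 14 in the exponents of the links, 9 = 6 * 3/2 from passing between consecutive
    levels, and 45 = 9 * (1 + 4), where 1 bounds the mean of the exponential sum and 4 is the
    exponent paid for the union bound. *)

Section BoundedMeasurable.
Context d (T : measurableType d) (R : realType).
Implicit Types (h g : T -> R) (A : set T).

(** Boundedness is no restriction: once gamma_1 is finite, [F] is uniformly bounded because it
    contains 0 ([class_bounded]). Integrals over sets of finite measure are then finite, so the
    real-valued [Rintegral] is linear and monotone on these functions. *)
Definition bounded_measurable h :=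
  measurable_fun setT h /\ exists K, forall w, `|h w| <= K.

Lemma bm_cst (k : R) : bounded_measurable (fun=> k).
Proof. by split; [exact: measurable_cst|exists `|k|]. Qed.

Lemma bmD h g : bounded_measurable h -> bounded_measurable g ->
  bounded_measurable (fun w => h w + g w).
Proof.
move=> [mh [K hK]] [mg [L gL]]; split; first exact: measurable_funD.
by exists (K + L) => w; rewrite (le_trans (ler_normD _ _)) ?lerD.
Qed.

Lemma bmM h g : bounded_measurable h -> bounded_measurable g ->
  bounded_measurable (fun w => h w * g w).
Proof.
move=> [mh [K hK]] [mg [L gL]]; split; first exact: measurable_funM.
by exists (K * L) => w; rewrite normrM ler_pM.
Qed.

Lemma bmZ k h : bounded_measurable h -> bounded_measurable (fun w => k * h w).
Proof. by move=> bh; apply: bmM => //; exact: bm_cst. Qed.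

Lemma bmN h : bounded_measurable h -> bounded_measurable (fun w => - h w).
Proof.
move=> bh; rewrite (_ : (fun w => _) = (fun w => -1 * h w)); first exact: bmZ.
by apply/funext => w; rewrite mulN1r.
Qed.

Lemma bmB h g : bounded_measurable h -> bounded_measurable g ->
  bounded_measurable (fun w => h w - g w).
Proof. by move=> bh bg; apply: bmD => //; exact: bmN. Qed.

Lemma bm_sum (I : Type) (s : seq I) (Q : pred I) (h : I -> T -> R) :
  (forall i, Q i -> bounded_measurable (h i)) ->
  bounded_measurable (fun w => \sum_(i <- s | Q i) h i w).
Proof.
move=> bh; elim: s => [|i s IH].
  rewrite (_ : (fun w => _) = cst 0); first exact: bm_cst.
  by apply/funext => w; rewrite big_nil.
have [Qi|nQi] := boolP (Q i).
  rewrite (_ : (fun w => _) = (fun w => h i w + \sum_(j <- s | Q j) h j w)).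
    by apply: bmD => //; exact: bh.
  by apply/funext => w; rewrite big_cons Qi.
rewrite (_ : (fun w => _) = (fun w => \sum_(j <- s | Q j) h j w)) //.
by apply/funext => w; rewrite big_cons (negbTE nQi).
Qed.

Lemma bm_norm h : bounded_measurable h -> bounded_measurable (fun w => `|h w|).
Proof.
move=> [mh [K hK]]; split; first exact: measurableT_comp.
by exists K => w; rewrite normr_id.
Qed.

Lemma bm_indic A : measurable A -> bounded_measurable (\1_A : T -> R).
Proof.
move=> mA; split; first exact: measurable_indic.
by exists 1 => w; rewrite indicE ger0_norm // lern1 leq_b1.
Qed.

Lemma bm_max h g : bounded_measurable h -> bounded_measurable g ->
  bounded_measurable (fun w => Num.max (h w) (g w)).
Proof.
move=> [mh [K hK]] [mg [L gL]]; split; first exact: measurable_maxr.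
exists (K + L) => w; have := hK w; have := gL w.
have := normr_ge0 (h w); have := normr_ge0 (g w).
by case: (ltP (h w) (g w)) => _; lra.
Qed.

Lemma bm_bigmax (I : Type) (s : seq I) (Q : pred I) (h : I -> T -> R) :
  (forall i, Q i -> bounded_measurable (h i)) ->
  bounded_measurable (fun w => \big[Num.max/0]_(i <- s | Q i) h i w).
Proof.
move=> bh; elim: s => [|i s IH].
  rewrite (_ : (fun w => _) = cst 0); first exact: bm_cst.
  by apply/funext => w; rewrite big_nil.
have [Qi|nQi] := boolP (Q i).
  rewrite (_ : (fun w => _) =
      (fun w => Num.max (h i w) (\big[Num.max/0]_(j <- s | Q j) h j w))).
    by apply: bm_max => //; exact: bh.
  by apply/funext => w; rewrite big_cons Qi.
rewrite (_ : (fun w => _) = (fun w => \big[Num.max/0]_(j <- s | Q j) h j w)) //.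
by apply/funext => w; rewrite big_cons (negbTE nQi).
Qed.

Lemma bm_expR h : bounded_measurable h -> bounded_measurable (fun w => expR (h w)).
Proof.
move=> [mh [K hK]]; split; first exact: (measurableT_comp (@measurable_expR R)).
exists (expR K) => w; rewrite ger0_norm ?expR_ge0 // ler_expR.
exact: le_trans (ler_norm _) (hK w).
Qed.

Lemma bm_powR h p : 0 <= p -> (forall w, 0 <= h w) -> bounded_measurable h ->
  bounded_measurable (fun w => h w `^ p).
Proof.
move=> p0 h0 [mh [K hK]]; split; first exact: (measurableT_comp (measurable_powR p)).
exists (K `^ p) => w; rewrite ger0_norm ?powR_ge0 //.
apply: ge0_ler_powR => //; rewrite ?nnegrE //.
  by apply: le_trans (hK w).
by rewrite (le_trans (ler_norm _)).
Qed.

End BoundedMeasurable.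

Section FiniteMeasureIntegral.
Context d (T : measurableType d) (R : realType) (mu : {measure set T -> \bar R}).
Context (D : set T) (mD : measurable D) (fD : (mu D < +oo)%E).
Implicit Types h : T -> R.

(** A domain of finite measure covers both uses: the whole space under P, and [0, 1] under Lebesgue
    measure. *)
Lemma bm_integrable_on h : bounded_measurable h -> mu.-integrable D (EFin \o h).
Proof.
move=> [mh [K hK]]; apply: measurable_bounded_integrable => //.
  exact: measurable_funS mh.
by exists K; split => [|y Ky w _ /=]; [exact: num_real|rewrite (le_trans (hK w)) // ltW].
Qed.

Lemma Rintegral_sum_on (I : Type) (s : seq I) (Q : pred I) (h : I -> T -> R) :
  (forall i, Q i -> bounded_measurable (h i)) ->
  \int[mu]_(w in D) (\sum_(i <- s | Q i) h i w) =
  \sum_(i <- s | Q i) \int[mu]_(w in D) h i w.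
Proof.
move=> bh; elim: s => [|i s IH].
  rewrite big_nil; under eq_Rintegral do rewrite big_nil.
  by rewrite Rintegral_cst // mul0r.
rewrite big_cons -IH; case: ifPn => Qi.
  rewrite -RintegralD //; last 2 first.
  - by apply: bm_integrable_on; exact: bh.
  - by apply: bm_integrable_on; exact: bm_sum.
  by apply: eq_Rintegral => w _; rewrite big_cons Qi.
by apply: eq_Rintegral => w _; rewrite big_cons (negbTE Qi).
Qed.

End FiniteMeasureIntegral.

Section Expectation.
Context d (T : measurableType d) (R : realType) (P : probability T R).
Implicit Types (h g : T -> R) (A : set T).

Lemma bm_integrable h : bounded_measurable h -> P.-integrable setT (EFin \o h).
Proof. by apply: bm_integrable_on => //; rewrite /= probability_setT ltry. Qed.

Local Notation E h := (Rintegral P setT h).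

Lemma Ex_fin h : bounded_measurable h -> (\int[P]_w (h w)%:E)%E = (E h)%:E.
Proof.
move=> bh; rewrite /Rintegral fineK //; apply: integrable_fin_num => //.
exact: bm_integrable.
Qed.

Lemma Ex_le h g : bounded_measurable h -> bounded_measurable g ->
  (forall w, h w <= g w) -> E h <= E g.
Proof. by move=> bh bg hg; apply: le_Rintegral => //; exact: bm_integrable. Qed.

Lemma Ex_cst (k : R) : E (fun=> k) = k.
Proof. by rewrite Rintegral_cst //= probability_setT mulr1. Qed.

Lemma ExD h g : bounded_measurable h -> bounded_measurable g ->
  E (fun w => h w + g w) = E h + E g.
Proof. by move=> bh bg; apply: RintegralD => //; exact: bm_integrable. Qed.

Lemma ExB h g : bounded_measurable h -> bounded_measurable g ->
  E (fun w => h w - g w) = E h - E g.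
Proof. by move=> bh bg; apply: RintegralB => //; exact: bm_integrable. Qed.

Lemma ExZ k h : bounded_measurable h -> E (fun w => k * h w) = k * E h.
Proof. by move=> bh; apply: RintegralZl => //; exact: bm_integrable. Qed.

Lemma Ex_sum (I : Type) (s : seq I) (Q : pred I) (h : I -> T -> R) :
  (forall i, Q i -> bounded_measurable (h i)) ->
  E (fun w => \sum_(i <- s | Q i) h i w) = \sum_(i <- s | Q i) E (h i).
Proof. by apply: Rintegral_sum_on => //; rewrite /= probability_setT ltry. Qed.

Lemma Ex_ge0 h : (forall w, 0 <= h w) -> 0 <= E h.
Proof. by move=> h0; apply: Rintegral_ge0. Qed.

Lemma Ex_norm h : bounded_measurable h -> `|E h| <= E (fun w => `|h w|).
Proof. by move=> bh; apply: le_normr_Rintegral => //; exact: bm_integrable. Qed.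

Lemma Ex_norm_le h K : bounded_measurable h -> (forall w, `|h w| <= K) -> `|E h| <= K.
Proof.
move=> bh hK; apply: le_trans (Ex_norm bh) _; rewrite -[leRHS]Ex_cst.
by apply: Ex_le => //; [exact: bm_norm|exact: bm_cst].
Qed.

Lemma Ex_indic A : measurable A -> E (\1_A) = fine (P A).
Proof. by move=> mA; rewrite /Rintegral integral_indic ?setIT. Qed.

End Expectation.

(** * Covariance inequalities *)

Section Covariance.
Context d (T : measurableType d) (R : realType) (P : probability T R).
Implicit Types (X Y M : T -> R) (A B : set T).

Local Notation E h := (Rintegral P setT h).
Local Notation bm := bounded_measurable.

Definition covar X Y : R := E (fun w => X w * Y w) - E X * E Y.

Lemma covarDl X X' Y : bm X -> bm X' -> bm Y ->
  covar (fun w => X w + X' w) Y = covar X Y + covar X' Y.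
Proof.
move=> bX bX' bY; rewrite /covar ExD //.
under eq_Rintegral do rewrite mulrDl.
by rewrite ExD; [ring|exact: bmM|exact: bmM].
Qed.

Lemma covarC X Y : covar X Y = covar Y X.
Proof.
by rewrite /covar mulrC; congr (_ - _); apply: eq_Rintegral => w _; rewrite mulrC.
Qed.

Lemma covarDr X Y Y' : bm X -> bm Y -> bm Y' ->
  covar X (fun w => Y w + Y' w) = covar X Y + covar X Y'.
Proof. by move=> bX bY bY'; rewrite covarC covarDl // ![covar _ X]covarC. Qed.

Lemma covarZl k X Y : bm X -> bm Y -> covar (fun w => k * X w) Y = k * covar X Y.
Proof.
move=> bX bY; rewrite /covar ExZ //.
under eq_Rintegral do rewrite -mulrA.
by rewrite ExZ; [ring|exact: bmM].
Qed.

Lemma covarZr k X Y : bm X -> bm Y -> covar X (fun w => k * Y w) = k * covar X Y.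
Proof. by move=> bX bY; rewrite covarC covarZl // covarC. Qed.

Lemma covar_cstl k Y : bm Y -> covar (fun=> k) Y = 0.
Proof. by move=> bY; rewrite /covar ExZ // Ex_cst subrr. Qed.

Lemma covar_suml (I : Type) (s : seq I) (X : I -> T -> R) Y :
  (forall i, bm (X i)) -> bm Y ->
  covar (fun w => \sum_(i <- s) X i w) Y = \sum_(i <- s) covar (X i) Y.
Proof.
move=> bX bY; elim: s => [|i s IH].
  rewrite big_nil -[RHS](covar_cstl 0 bY).
  by congr covar; apply/funext => w; rewrite big_nil.
rewrite big_cons -IH -covarDl //; last exact: bm_sum.
by congr covar; apply/funext => w; rewrite big_cons.
Qed.

Lemma covar_sumr (I : Type) (s : seq I) X (Y : I -> T -> R) :
  bm X -> (forall i, bm (Y i)) ->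
  covar X (fun w => \sum_(i <- s) Y i w) = \sum_(i <- s) covar X (Y i).
Proof.
move=> bX bY; rewrite covarC covar_suml //; apply: eq_bigr => i _; exact: covarC.
Qed.

Lemma covar_norm X Y : bm X -> bm Y ->
  `|covar X Y| <= E (fun w => `|X w| * `|Y w|) + E (fun w => `|X w|) * E (fun w => `|Y w|).
Proof.
move=> bX bY; rewrite /covar (le_trans (ler_normB _ _)) // lerD //.
  rewrite (le_trans (Ex_norm _ (bmM bX bY))) //.
  by under eq_Rintegral do rewrite normrM.
by rewrite normrM ler_pM // Ex_norm.
Qed.

Lemma sqr_Ex_le X : bm X -> (E X) ^+ 2 <= E (fun w => X w ^+ 2).
Proof.
move=> bX; have : 0 <= E (fun w => X w ^+ 2 - (2 * E X * X w - (E X) ^+ 2)).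
  apply: Ex_ge0 => w.
  by rewrite (_ : _ - _ = (X w - E X) ^+ 2) ?sqr_ge0 //; ring.
have b2 : bm (fun w => X w ^+ 2) by exact: bmM.
have bZ : bm (fun w => 2 * E X * X w) by exact: bmZ.
rewrite ExB //; last by apply: bmB => //; exact: bm_cst.
rewrite ExB //; last exact: bm_cst.
by rewrite ExZ // Ex_cst; lra.
Qed.

Lemma fineP_itv A : measurable A -> 0 <= fine (P A) <= 1.
Proof.
move=> mA; rewrite fine_ge0 //= -lee_fin fineK ?probability_le1 //.
exact: fin_num_measure.
Qed.

Lemma covar_indic A B : measurable A -> measurable B ->
  covar (\1_A) (\1_B) = fine (P (A `&` B)) - fine (P A) * fine (P B).
Proof.
move=> mA mB; rewrite /covar !Ex_indic //; congr (_ - _).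
rewrite -Ex_indic; last exact: measurableI.
by apply: eq_Rintegral => w _; rewrite !indicE in_setI; do 2 case: (_ \in _); rewrite /= ?mulr1 ?mulr0.
Qed.

Lemma covar_indic_le A B : measurable A -> measurable B ->
  `|fine (P (A `&` B)) - fine (P A) * fine (P B)| <= 1 / 2.
Proof.
move=> mA mB; have mAB := measurableI _ _ mA mB.
have /andP[a0 a1] := fineP_itv mA; have /andP[b0 b1] := fineP_itv mB.
have /andP[p0 p1] := fineP_itv mAB.
have pa : fine (P (A `&` B)) <= fine (P A).
  by rewrite fine_le ?fin_num_measure // le_measure ?inE //; exact: subIsetl.
have pb : fine (P (A `&` B)) <= fine (P B).
  by rewrite fine_le ?fin_num_measure // le_measure ?inE //; exact: subIsetr.
(* With [pa] and [pb] this confines the probability of the intersection between P(A) + P(B) - 1 and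
   min(P(A), P(B)), whence the bound 1/2. *)
have pab : fine (P A) + fine (P B) - fine (P (A `&` B)) <= 1.
  have : 0 <= E (fun w => (1 - \1_A w) * (1 - \1_B w)).
    apply: Ex_ge0 => w; rewrite !indicE.
    by case: (w \in A); case: (w \in B); rewrite /= ?subr0 ?subrr ?mul0r ?mulr0 ?mulr1.
  have -> : (fun w => (1 - \1_A w) * (1 - \1_B w)) =
      (fun w => (1 - (\1_A w + \1_B w)) + \1_(A `&` B) w :> R).
    apply/funext => w; rewrite !indicE in_setI; case: (_ \in _) => /=; case: (_ \in _) => /=; ring.
  have bA := bm_indic R mA; have bB := bm_indic R mB; have bAB := bm_indic R mAB.
  rewrite ExD //; last by apply: bmB; [exact: bm_cst|exact: bmD].
  rewrite ExB; [|exact: bm_cst|exact: bmD].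
  by rewrite ExD // Ex_cst !Ex_indic //; lra.
rewrite ler_norml; apply/andP; split; nra.
Qed.

Local Notation up X s := [set w | s <= X w].

Lemma measurable_up X s : bm X -> measurable (up X s).
Proof.
move=> [mX _]; rewrite (_ : up X s = setT `&` X @^-1` `[s, +oo[%classic).
  exact: mX.
by rewrite setTI; apply/seteqP; split => w /=; rewrite in_itv /= andbT.
Qed.

Let gaps X Y : set R := [set `|fine (P (up X st.2 `&` up Y st.1))
  - fine (P (up X st.2)) * fine (P (up Y st.1))| | st in [set: R * R]].

Lemma gaps_ub X Y : bm X -> bm Y -> ubound (gaps X Y) (1 / 2).
Proof.
move=> bX bY _ [st _ <-]; apply: covar_indic_le; exact: measurable_up.
Qed.

Lemma gap_le_alpha X Y s t : bm X -> bm Y ->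
  `|fine (P (up X s `&` up Y t)) - fine (P (up X s)) * fine (P (up Y t))|
    <= alpha P X Y / 2.
Proof.
move=> bX bY; rewrite /alpha mulrAC mulfV // mul1r.
by apply: (ub_le_sup (ex_intro _ _ (gaps_ub bX bY))); exists (t, s).
Qed.

Lemma alpha_le1 X Y : bm X -> bm Y -> alpha P X Y <= 1.
Proof.
move=> bX bY; have : sup (gaps X Y) <= 1 / 2.
  by apply: (ge_sup _ (gaps_ub bX bY)); eexists; exists (0, 0).
by rewrite /alpha /gaps; lra.
Qed.

Lemma alpha_ge0 X Y : bm X -> bm Y -> 0 <= alpha P X Y.
Proof.
move=> bX bY; have := le_trans (normr_ge0 _) (gap_le_alpha 0 0 bX bY); lra.
Qed.

(** A case view of clamping x to [a, b]: in each branch the clamped value is a plain term, and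
    linear arithmetic can finish. *)
Variant band_spec (a b x : R) : R -> Prop :=
  | BandLow of x <= a : band_spec a b x a
  | BandMid of a <= x & x <= b : band_spec a b x x
  | BandHigh of b <= x : band_spec a b x b.

Lemma bandP a b x : a <= b -> band_spec a b x (Num.max a (Num.min b x)).
Proof.
move=> ab; case: (leP b x) => bx.
  by rewrite (max_idPr ab); constructor.
case: (leP a x) => ax; constructor => //; exact: ltW.
Qed.

Definition clip t (x : R) : R := Num.max (- t) (Num.min t x).

Lemma clipP t x : 0 <= t ->
  [/\ `|clip t x| <= t, `|clip t x| <= `|x|
    & `|x - clip t x| <= `|x| * (t < `|x|)%R%:R].
Proof.
move=> t0; rewrite /clip; have tt : - t <= t by lra.
case: (bandP x tt) => [xt|tx xt|tx].
- rewrite normrN (ger0_norm t0) ler0_norm; last by lra.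
  rewrite ler0_norm; last by lra.
  split; [by []|lra|]; case: ltP => /= ?; lra.
- by rewrite subrr normr0 mulr_ge0 // ler_norml tx xt.
- rewrite (ger0_norm t0) ger0_norm; last by lra.
  rewrite ger0_norm; last by lra.
  split; [by []|lra|]; case: ltP => /= ?; lra.
Qed.

Lemma bm_clip t X : bm X -> bm (fun w => clip t (X w)).
Proof.
move=> bX; apply: bm_max; first exact: bm_cst.
rewrite (_ : (fun w => _) = (fun w => - Num.max (- t) (- X w))).
  by apply: bmN; apply: bm_max; [exact: bm_cst|exact: bmN].
by apply/funext => w; rewrite -oppr_min opprK.
Qed.

(** The staircase s stays within [delta] of x clamped to [0, K * delta]. The third claim carries the
    induction: a level is passed only if all earlier ones are. *)
Lemma staircase (delta x : R) (K : nat) : 0 < delta ->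
  let s := delta * \sum_(k < K) (k.+1%:R * delta <= x)%R%:R in
  [/\ s <= Num.max 0 (Num.min (K%:R * delta) x),
      Num.max 0 (Num.min (K%:R * delta) x) <= s + delta
    & (K%:R * delta <= x -> s = K%:R * delta)].
Proof.
move=> d0 /=; elim: K => [|K [IH1 IH2 IH3]].
  rewrite big_ord0 mulr0 mul0r add0r.
  by case: (bandP x (lexx 0)) => [h|h1 h2|h]; split => //; lra.
have K0 : 0 <= K%:R * delta by rewrite mulr_ge0 // ltW.
rewrite big_ord_recr /= mulrDr.
have -> : K.+1%:R * delta = K%:R * delta + delta by rewrite -natr1 mulrDl mul1r.
have K1 : 0 <= K%:R * delta + delta by lra.
case: (boolP (K%:R * delta + delta <= x)) => Kx /=.
  have -> : delta * \sum_(i < K) (i.+1%:R * delta <= x)%R%:R = K%:R * delta.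
    by apply: IH3; lra.
  rewrite mulr1; clear IH1 IH2 IH3.
  by case: (bandP x K1) => [?|? ?|?]; split => //; lra.
rewrite -ltNge in Kx.
rewrite mulr0 addr0; move: IH1 IH2 IH3; set s := delta * _; move: s => s.
case: (bandP x K0) => [x0|x0 xK|xK] h1 h2 h3.
- by case: (bandP x K1) => [?|? ?|?]; split => //; lra.
- by case: (bandP x K1) => [?|? ?|?]; split => //; lra.
- by rewrite h3 //; case: (bandP x K1) => [?|? ?|?]; split => //; lra.
Qed.

Lemma clip_approx (t delta s z : R) : 0 < t -> 0 <= s ->
  s <= Num.max 0 (Num.min (2 * t) (z + t)) -> Num.max 0 (Num.min (2 * t) (z + t)) <= s + delta ->
  `|s - t| <= t /\ `|clip t z - (s - t)| <= delta.
Proof.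
move=> t0 s0; rewrite /clip; have t2 : 0 <= 2 * t by lra.
have tt : - t <= t by lra.
case: (bandP _ t2) => [h|h1 h2|h]; case: (bandP z tt) => [g|g1 g2|g];
  move=> u1 u2; split; rewrite ler_norml; apply/andP; split; lra.
Qed.

(* Up to delta, clip t x is -t plus delta times the number of levels
   delta * k - t, 1 <= k <= 2 t / delta, that are at most x; alpha bounds the
   covariance of the indicators of two level sets. *)
Lemma covar_clip X Y t : 0 <= t -> bm X -> bm Y ->
  `|covar (fun w => clip t (X w)) (fun w => clip t (Y w))| <= 2 * t ^+ 2 * alpha P X Y.
Proof.
rewrite le_eqVlt => /orP[/eqP <-|t0] bX bY.
  rewrite (_ : (fun w => clip 0 (X w)) = fun=> 0).
    by rewrite covar_cstl ?normr0 ?expr0n ?mulr0 ?mul0r //; exact: bm_clip.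
  by apply/funext => w; have [+ _ _] := clipP (X w) (lexx 0); rewrite normr_le0 => /eqP.
(* With n + 1 levels the mesh is [2 * t / n.+1]; each of the two rounding errors costs
   [2 * delta * t], together [8 * t ^+ 2 / n.+1], which vanishes as n grows. *)
have approx n : `|covar (fun w => clip t (X w)) (fun w => clip t (Y w))| <=
    2 * t ^+ 2 * alpha P X Y + 8 * t ^+ 2 / n.+1%:R.
  pose delta : R := 2 * t / n.+1%:R.
  have deltaE : delta = 2 * t / n.+1%:R by [].
  have d0 : 0 < delta by rewrite divr_gt0 // mulr_gt0.
  clearbody delta.
  pose st (Z : T -> R) w := delta * \sum_(k < n.+1) \1_(up Z (k.+1%:R * delta - t)) w.
  have stE Z w : st Z w = delta * \sum_(k < n.+1) (k.+1%:R * delta <= Z w + t)%R%:R.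
    congr (_ * _); apply: eq_bigr => k _; rewrite indicE.
    by congr (_%:R); congr nat_of_bool; apply/idP/idP; rewrite inE /= lerBlDr.
  have nd : n.+1%:R * delta = 2 * t by rewrite deltaE mulrC divfK.
  have st_itv Z w : `|st Z w - t| <= t /\ `|clip t (Z w) - (st Z w - t)| <= delta.
    have := staircase (Z w + t) n.+1 d0.
    have : 0 <= st Z w.
      by rewrite /st mulr_ge0 ?(ltW d0) // sumr_ge0 // => k _; rewrite indicE.
    by rewrite /= -stE nd => s0 [h1 h2 _]; exact: clip_approx.
  have bst1 (Z : T -> R) : bm Z -> bm (st Z).
    move=> bZ; apply: bmZ; apply: bm_sum => k _; apply: bm_indic; exact: measurable_up.
  have bst (Z : T -> R) : bm Z -> bm (fun w => st Z w - t).
    by move=> bZ; apply: bmB; [exact: bst1|exact: bm_cst].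
  have bcl (Z : T -> R) : bm Z -> bm (fun w => clip t (Z w)) by exact: bm_clip.
  have bdf (Z : T -> R) : bm Z -> bm (fun w => clip t (Z w) - (st Z w - t)).
    by move=> bZ; apply: bmB; [exact: bcl|exact: bst].
  have small (U V : T -> R) : bm U -> bm V -> (forall w, `|U w| <= delta) ->
      (forall w, `|V w| <= t) -> `|covar U V| <= 2 * delta * t.
    move=> bU bV U1 V1; rewrite (le_trans (covar_norm bU bV)) //.
    have -> : 2 * delta * t = delta * t + delta * t by ring.
    apply: lerD.
      rewrite (le_trans (ler_norm _)) // Ex_norm_le //.
        by apply: bmM; exact: bm_norm.
      by move=> w; rewrite normrM !normr_id ler_pM.
    apply: ler_pM; rewrite ?Ex_ge0 //.
      rewrite (le_trans (ler_norm _)) // Ex_norm_le //; first exact: bm_norm.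
      by move=> w; rewrite normr_id.
    rewrite (le_trans (ler_norm _)) // Ex_norm_le //; first exact: bm_norm.
    by move=> w; rewrite normr_id.
  have -> : covar (fun w => clip t (X w)) (fun w => clip t (Y w)) =
     covar (fun w => clip t (X w) - (st X w - t)) (fun w => clip t (Y w)) +
     covar (fun w => clip t (Y w) - (st Y w - t)) (fun w => st X w - t) +
     covar (fun w => st X w - t) (fun w => st Y w - t).
    rewrite [covar _ (fun w => st X w - t)]covarC.
    rewrite -addrA -covarDr; [|exact: bst|exact: bdf|exact: bst].
    have e (Z : T -> R) : (fun w => clip t (Z w)) =
       (fun w => clip t (Z w) - (st Z w - t) + (st Z w - t)).
      by apply/funext => w; rewrite subrK.
    by rewrite -e -covarDl -?e //; [exact: bdf|exact: bst|exact: bcl].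
  have stcov : `|covar (fun w => st X w - t) (fun w => st Y w - t)|
      <= 2 * t ^+ 2 * alpha P X Y.
    rewrite covarDl; [|exact: bst1|exact: bm_cst|exact: bst].
    rewrite covar_cstl ?addr0; last exact: bst.
    rewrite covarDr; [|exact: bst1|exact: bst1|exact: bm_cst].
    rewrite [covar _ (fun=> - t)]covarC covar_cstl ?addr0; last exact: bst1.
    have bi (Z : T -> R) s : bm Z -> bm (\1_(up Z s) : T -> R).
      by move=> bZ; apply: bm_indic; exact: measurable_up.
    rewrite /st covarZl; [|by apply: bm_sum => *; exact: bi|exact: bst1].
    rewrite covarZr; [|by apply: bm_sum => *; exact: bi|by apply: bm_sum => *; exact: bi].
    rewrite covar_suml; [|by move=> *; exact: bi|by apply: bm_sum => *; exact: bi].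
    rewrite !normrM (ger0_norm (ltW d0)).
    have le1 : `|\sum_(k < n.+1) covar (\1_(up X (k.+1%:R * delta - t)))
        (fun w => \sum_(l < n.+1) \1_(up Y (l.+1%:R * delta - t)) w)| <=
        \sum_(k < n.+1) \sum_(l < n.+1) (alpha P X Y / 2).
      rewrite (le_trans (ler_norm_sum _ _ _)) // ler_sum // => k _.
      rewrite covar_sumr; [|exact: bi|by move=> *; exact: bi].
      rewrite (le_trans (ler_norm_sum _ _ _)) // ler_sum // => l _.
      rewrite covar_indic; [|exact: measurable_up|exact: measurable_up].
      exact: gap_le_alpha.
    (* There are (n + 1)^2 pairs of levels, each contributing at most alpha / 2, and (n + 1) * delta
       = 2 t. *)
    have -> : 2 * t ^+ 2 * alpha P X Y =
        delta * (delta * \sum_(k < n.+1) \sum_(l < n.+1) (alpha P X Y / 2)).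
      have -> : 2 * t ^+ 2 * alpha P X Y = (2 * t) * (2 * t) * (alpha P X Y / 2) by field.
      have -> : \sum_(k < n.+1) \sum_(l < n.+1) (alpha P X Y / 2) =
          n.+1%:R * (n.+1%:R * (alpha P X Y / 2)).
        by rewrite !sumr_const card_ord -[LHS]mulr_natl -[X in _ * X]mulr_natl.
      by rewrite -nd; ring.
    by rewrite !ler_pM2l.
  rewrite (le_trans (ler_normD _ _)) // addrC lerD //.
  rewrite (le_trans (ler_normD _ _)) //.
  have -> : 8 * t ^+ 2 / n.+1%:R = 2 * delta * t + 2 * delta * t.
    by rewrite deltaE; move: (n.+1%:R^-1) => m; ring.
  apply: lerD; apply: small; rewrite ?(bdf, bst, bcl) //; try (by move=> w; case: (st_itv X w)
    => [? ?]) ; try (by move=> w; case: (st_itv Y w) => [? ?]).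
  - exact: bdf.
  - exact: bcl.
  - by move=> w; have [] := clipP (Y w) (ltW t0).
  - exact: bdf.
  - exact: bst.
apply/ler_addgt0Pl => e e0.
pose n := Num.truncn (e^-1 * (8 * t ^+ 2)).
apply: le_trans (approx n) _; rewrite addrC lerD2r.
by rewrite ler_pdivrMr // -ler_pdivrMl // ltW // truncnS_gt.
Qed.

(** Each variable is its clipping plus a remainder that is at most M where M > t and 0 elsewhere.
    With Q the truncated second moment of M, a covariance with one remainder costs 3 Q: the mean of
    the product gives Q, the product of the means 2 Q, since E M <= t + E[M; M > t]. A common
    majorant M is allowed so that it can be the maximum over a whole block. *)
Lemma covar_trunc X Y M t : 0 <= t -> bm X -> bm Y -> bm M ->
  (forall w, `|X w| <= M w) -> (forall w, `|Y w| <= M w) ->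
  `|covar X Y| <= 2 * t ^+ 2 * alpha P X Y
     + 6 * E (fun w => M w ^+ 2 * (t < M w)%R%:R).
Proof.
move=> t0 bX bY bM XM YM.
have M0 w : 0 <= M w := le_trans (normr_ge0 _) (XM w).
pose q w : R := (t < M w)%R%:R.
have bq : bm q.
  rewrite (_ : q = \1_(~` up (fun w => - M w) (- t))).
    by apply: bm_indic; apply: measurableC; apply: measurable_up; exact: bmN.
  apply/funext => w; rewrite indicE /q; congr ((nat_of_bool _)%:R).
  by apply/idP/idP; rewrite inE /= lerN2 ltNge => /negP.
set Q := E _.
have bMq : bm (fun w => M w * q w) by exact: bmM.
have bM2q : bm (fun w => M w ^+ 2 * q w) by apply: bmM => //; exact: bmM.
have hE : E (fun w => M w * q w) * E M <= 2 * Q.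
  have le1 : E M <= t + E (fun w => M w * q w).
    rewrite -[X in X + _](Ex_cst P t) -ExD //; last exact: bm_cst.
    apply: Ex_le => //; first by apply: bmD => //; exact: bm_cst.
    by move=> w; rewrite /q; case: ltP => /= h; rewrite ?mulr1 ?mulr0; lra.
  have h0 : 0 <= E (fun w => M w * q w) by apply: Ex_ge0 => w; rewrite mulr_ge0.
  apply: le_trans (ler_wpM2l h0 le1) _; rewrite mulrDr.
  have -> : 2 * Q = Q + Q by ring.
  apply: lerD.
    rewrite mulrC -ExZ //; apply: Ex_le => //; first exact: bmZ.
    move=> w; rewrite /q; case: ltP => /= h; rewrite ?mulr1 ?mulr0 //.
    by rewrite expr2 ler_wpM2r // ltW.
  rewrite -expr2 (le_trans (sqr_Ex_le bMq)) //.
  apply: Ex_le => //; first exact: bmM.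
  by move=> w; rewrite /q; case: ltP => /= h; rewrite ?mulr1 ?mulr0 // expr0n.
have small (U V : T -> R) : bm U -> bm V -> (forall w, `|U w| <= M w * q w) ->
    (forall w, `|V w| <= M w) -> `|covar U V| <= 3 * Q.
  move=> bU bV hU hV; rewrite (le_trans (covar_norm bU bV)) //.
  have -> : 3 * Q = Q + 2 * Q by ring.
  apply: lerD.
    apply: Ex_le => //; first by apply: bmM; exact: bm_norm.
    by move=> w; rewrite expr2 mulrAC ler_pM.
  apply: le_trans hE; apply: ler_pM; rewrite ?Ex_ge0 //.
    by apply: Ex_le => //; exact: bm_norm.
  by apply: Ex_le => //; exact: bm_norm.
have -> : covar X Y = covar (fun w => X w - clip t (X w)) Y +
     covar (fun w => Y w - clip t (Y w)) (fun w => clip t (X w)) +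
     covar (fun w => clip t (X w)) (fun w => clip t (Y w)).
  have bc (Z : T -> R) : bm Z -> bm (fun w => clip t (Z w)) by exact: bm_clip.
  have bd (Z : T -> R) : bm Z -> bm (fun w => Z w - clip t (Z w)).
    by move=> bZ; apply: bmB => //; exact: bc.
  rewrite [covar _ (fun w => clip t (X w))]covarC.
  rewrite -addrA -covarDr; [|exact: bc|exact: bd|exact: bc].
  have e (Z : T -> R) : Z = (fun w => Z w - clip t (Z w) + clip t (Z w)) :> (T -> R).
    by apply/funext => w; rewrite subrK.
  by rewrite -e -covarDl -?e //; [exact: bd|exact: bc].
have bd (Z : T -> R) : bm Z -> bm (fun w => Z w - clip t (Z w)).
  by move=> bZ; apply: bmB => //; exact: bm_clip.
have dq (Z : T -> R) : (forall w, `|Z w| <= M w) -> forall w, `|Z w - clip t (Z w)| <= M w * q w.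
  move=> ZM w; have [_ _ /le_trans] := clipP (Z w) t0; apply.
  apply: ler_pM => //; rewrite /q; case: ltP => //= h.
  by rewrite (lt_le_trans h).
rewrite (le_trans (ler_normD _ _)) // addrC lerD //; first exact: covar_clip.
rewrite (le_trans (ler_normD _ _)) //.
have -> : 6 * Q = 3 * Q + 3 * Q by ring.
apply: lerD; apply: small => //; rewrite ?bd //; try exact: dq; try exact: bd.
  exact: bm_clip.
by move=> w; have [_ + _] := clipP (X w) t0 => /le_trans; exact.
Qed.

End Covariance.

(** * Covariances under bounds on the 2p-th moments *)

Section TruncatedMoments.
Context d (T : measurableType d) (R : realType) (P : probability T R).
Implicit Types (X Y M : T -> R) (p v a t : R).

Local Notation E h := (Rintegral P setT h).
Local Notation bm := bounded_measurable.

Lemma bm_gt t M : bm M -> bm (fun w => (t < M w)%R%:R : R).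
Proof.
move=> bM; rewrite (_ : (fun w => _) = \1_(~` [set w | - t <= - M w])).
  by apply: bm_indic; apply: measurableC; apply: measurable_up; exact: bmN.
apply/funext => w; rewrite indicE; congr ((nat_of_bool _)%:R).
by apply/idP/idP; rewrite inE /= lerN2 ltNge => /negP.
Qed.

Lemma sqr_gt_le_powR (q t x : R) : 2 <= q -> 0 < t -> 0 <= x ->
  x ^+ 2 * (t < x)%R%:R <= t `^ (2 - q) * x `^ q.
Proof.
move=> q2 t0 x0; case: ltP => [tx|_]; last by rewrite mulr0 mulr_ge0 ?powR_ge0.
have x1 : 0 < x by exact: lt_trans tx.
have -> : x ^+ 2 * true%:R = x `^ (2 - q) * x `^ q.
  by rewrite mulr1 -powRD ?(gt_eqF x1) ?implybT // subrK powR_mulrn.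
rewrite ler_pM2r ?powR_gt0 // (_ : 2 - q = - (q - 2)); last by ring.
rewrite !powRN lef_pV2 ?posrE ?powR_gt0 //.
by apply: ge0_ler_powR; rewrite ?nnegrE ?(ltW t0) ?(ltW x1) ?(ltW tx) ?subr_ge0.
Qed.

Lemma tail_moment (q t : R) M : 2 <= q -> 0 < t -> bm M -> (forall w, 0 <= M w) ->
  E (fun w => M w ^+ 2 * (t < M w)%R%:R) <= t `^ (2 - q) * E (fun w => M w `^ q).
Proof.
move=> q2 t0 bM M0.
have bMq : bm (fun w => M w `^ q) by apply: bm_powR => //; exact: le_trans q2.
rewrite -ExZ //; apply: Ex_le.
- by apply: bmM; [exact: bmM|exact: bm_gt].
- exact: bmZ.
- by move=> w; apply: sqr_gt_le_powR.
Qed.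

Lemma covar_moment X Y p v a : 1 <= p -> 0 < v -> 0 <= a -> bm X -> bm Y ->
  E (fun w => `|X w| `^ (2 * p)) <= v `^ (2 * p) ->
  E (fun w => `|Y w| `^ (2 * p)) <= v `^ (2 * p) ->
  alpha P X Y <= a -> `|covar P X Y| <= 14 * v ^+ 2 * a `^ (1 - p^-1).
Proof.
move=> p1 v0 a0 bX bY EX EY aXY.
have p0 : 0 < p by exact: lt_le_trans p1.
pose M w := Num.max `|X w| `|Y w|.
have bM : bm M by apply: bm_max; exact: bm_norm.
have XM w : `|X w| <= M w by rewrite le_max lexx.
have YM w : `|Y w| <= M w by rewrite le_max lexx orbT.
have M0 w : 0 <= M w := le_trans (normr_ge0 _) (XM w).
have q2 : 2 <= 2 * p by clear -p1; lra.
have q0 : 0 <= 2 * p by exact: le_trans q2.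
have bp Z : bm Z -> bm (fun w => `|Z w| `^ (2 * p)).
  by move=> bZ; apply: bm_powR => //; exact: bm_norm.
have EM : E (fun w => M w `^ (2 * p)) <= 2 * v `^ (2 * p).
  apply: le_trans (_ : _ <= E (fun w => `|X w| `^ (2 * p) + `|Y w| `^ (2 * p))) _.
    apply: Ex_le; [exact: bm_powR|by apply: bmD; exact: bp|].
    move=> w; rewrite /M; case: (leP `|X w| `|Y w|) => _.
      by rewrite lerDr powR_ge0.
    by rewrite lerDl powR_ge0.
  have -> : 2 * v `^ (2 * p) = v `^ (2 * p) + v `^ (2 * p) by ring.
  by rewrite ExD; [apply: lerD|exact: bp|exact: bp].
have main b : 0 < b -> alpha P X Y <= b ->
    `|covar P X Y| <= 14 * v ^+ 2 * b `^ (1 - p^-1).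
  (* At this level both terms scale alike: t^2 b and t^(2 - 2p) v^(2p) both equal v^2 b^(1 -
     1/p). *)
  move=> b0 ab; pose t := v * b `^ (- (2 * p)^-1).
  have t0 : 0 < t by rewrite mulr_gt0 ?powR_gt0.
  apply: le_trans (covar_trunc P (ltW t0) bX bY bM XM YM) _.
  have bn0 : b != 0 by rewrite gt_eqF.
  have -> : 14 * v ^+ 2 * b `^ (1 - p^-1) =
     2 * (v ^+ 2 * b `^ (1 - p^-1)) + 6 * (2 * (v ^+ 2 * b `^ (1 - p^-1))) by ring.
  apply: lerD.
    rewrite -mulrA ler_pM2l //.
    have -> : b `^ (1 - p^-1) = b `^ (- (2 * p)^-1) ^+ 2 * b.
      rewrite -powR_mulrn ?powR_ge0 // -powRrM -[X in _ * X]powRr1 ?(ltW b0) //.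
      rewrite -powRD ?bn0 ?implybT //; congr (_ `^ _).
      by field; rewrite gt_eqF.
    rewrite mulrA -exprMn -/t; apply: ler_wpM2l => //; exact: sqr_ge0.
  rewrite ler_pM2l //; apply: le_trans (tail_moment q2 t0 bM M0) _.
  apply: le_trans (ler_wpM2l (powR_ge0 _ _) EM) _.
  rewrite /t powRM ?powR_ge0 ?(ltW v0) // -powRrM.
  rewrite mulrCA ler_pM2l // mulrAC -powRD ?(gt_eqF v0) ?implybT //.
  have -> : 2 - 2 * p + 2 * p = 2%:R by ring.
  rewrite powR_mulrn ?(ltW v0) // le_eqVlt; apply/orP; left; apply/eqP.
  congr (_ * (_ `^ _)); field; rewrite gt_eqF //; lra.
(* If p = 1, the power of a is 1 even at a = 0, and b = 1 serves since alpha <= 1. If p > 1 and a =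
   0, then alpha <= 0, and truncating at a uniform bound K of M leaves no remainder. *)
have [p1'|p1'] := eqVneq p 1.
  rewrite p1' invr1 subrr powRr0.
  by have := main 1 ltr01 (alpha_le1 P bX bY); rewrite powR1.
move: a0; rewrite le_eqVlt => /orP[/eqP ae|]; last by move=> a0; exact: main.
rewrite -ae powR0; last first.
  by rewrite subr_eq0 eq_sym invr_eq1.
rewrite mulr0; have [K MK] := bM.2.
have K0 : 0 <= K by apply: le_trans (MK point).
apply: le_trans (covar_trunc P K0 bX bY bM XM YM) _.
rewrite (_ : (fun w => M w ^+ 2 * _) = (fun=> 0)); last first.
  apply/funext => w; case: ltP => // h; rewrite ?mulr0 //.
  by have := lt_le_trans h (ler_norm _); rewrite ltNge MK.
by rewrite Ex_cst mulr0 addr0 mulr_ge0_le0 ?mulr_ge0 ?sqr_ge0 // ae.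
Qed.

(** The case p = +oo: truncating at v alters the variables on a null set only. *)
Lemma covar_bounded X Y v a : 0 <= v -> bm X -> bm Y ->
  {ae P, forall w, `|X w| <= v} -> {ae P, forall w, `|Y w| <= v} ->
  alpha P X Y <= a -> `|covar P X Y| <= 2 * v ^+ 2 * a.
Proof.
move=> v0 bX bY Xv Yv aXY.
pose M w := Num.max `|X w| `|Y w|.
have bM : bm M by apply: bm_max; exact: bm_norm.
have XM w : `|X w| <= M w by rewrite le_max lexx.
have YM w : `|Y w| <= M w by rewrite le_max lexx orbT.
apply: le_trans (covar_trunc P v0 bX bY bM XM YM) _.
rewrite [X in _ + 6 * X](_ : _ = 0) ?mulr0 ?addr0.
  by apply: ler_wpM2l => //; rewrite mulr_ge0 ?sqr_ge0.
have bMq : bm (fun w => M w ^+ 2 * (v < M w)%R%:R).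
  by apply: bmM; [exact: bmM|exact: bm_gt].
rewrite /Rintegral (ae_eq_integral (cst 0%E)) ?integral_cst ?mul0e //.
- by apply/measurable_EFinP; exact: bMq.1.
- apply: filterS2 Xv Yv => w hX hY _ /=; congr EFin.
  by case: ltP; rewrite ?mulr0 // lt_max !ltNge hX hY.
Qed.

End TruncatedMoments.

(** * The distribution function of finitely many mixing coefficients *)

Section StepFunctions.
Context (R : realType) (J : finType) (Q : pred J) (a : J -> R) (beta : R).
Hypotheses (beta0 : 0 < beta) (a01 : forall j, Q j -> 0 <= a j <= 1).

Local Notation mu := (@lebesgue_measure R).
Local Notation I01 := (`[0, 1]%classic : set R).

(** For [J] the pairs of a block, [beta] its size and [a] their mixing coefficients, this is the
    bracket under the integral of [Gamma_sharp], written as a count of pairs. *)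
Definition level_freq (u : R) : R := (\sum_(j | Q j) (u <= a j)%R%:R) / beta.

Lemma level_freq_ge0 u : 0 <= level_freq u.
Proof. by rewrite divr_ge0 ?(ltW beta0) // sumr_ge0. Qed.

Lemma level_freq_anti u u' : u <= u' -> level_freq u' <= level_freq u.
Proof.
move=> uu'; rewrite /level_freq ler_pM2r ?invr_gt0 //; apply: ler_sum => j _.
rewrite ler_nat; case: (leP u' (a j)) => //= h.
by rewrite (le_trans uu' h).
Qed.

Lemma bm_step (c : R) : bounded_measurable (fun u : R => (u <= c)%R%:R : R).
Proof.
rewrite (_ : (fun u => _) = \1_(`]-oo, c]%classic)); first exact: bm_indic.
apply/funext => u; rewrite indicE; congr ((nat_of_bool _)%:R).
by apply/idP/idP; rewrite inE /= in_itv.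
Qed.

Lemma bm_level_freq : bounded_measurable level_freq.
Proof.
by apply: bmM; [apply: bm_sum => j _; exact: bm_step|exact: bm_cst].
Qed.

Lemma lebesgue_I01 : mu I01 = 1%E.
Proof. by rewrite lebesgue_measure_itv /= lte01 oppr0 adde0. Qed.

Lemma lebesgue_I01_fin : (mu I01 < +oo)%E.
Proof. by rewrite lebesgue_I01 ltry. Qed.

Lemma Rintegral_step (c : R) : 0 <= c <= 1 ->
  \int[mu]_(u in I01) ((u <= c)%R%:R : R) = c.
Proof.
move=> /andP[c0 c1]; rewrite /Rintegral.
have -> : (\int[mu]_(u in I01) ((u <= c)%R%:R)%:E =
    \int[mu]_(u in I01) (\1_(`[0%R, c]%classic) u)%:E)%E.
  apply: eq_integral => u; rewrite inE /= in_itv /= => /andP[u0 u1]; rewrite indicE.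
  by congr ((nat_of_bool _)%:R%:E); apply/idP/idP; rewrite inE /= in_itv /= u0.
rewrite integral_indic //= setIidl; last first.
  move=> u /=; rewrite !in_itv /= => /andP[-> uc] /=; exact: le_trans c1.
rewrite lebesgue_measure_itv /= lte_fin; case: ltP => h /=; first by rewrite subr0.
by apply/eqP; rewrite eq_le c0 h.
Qed.

Context (theta : R).
Hypothesis theta0 : 0 < theta.
Let I := \int[mu]_(u in I01) (level_freq u `^ (1 + theta)).

Lemma bm_level_freq_powR : bounded_measurable (fun u => level_freq u `^ (1 + theta)).
Proof.
apply: bm_powR; [by rewrite addr_ge0 // ltW|exact: level_freq_ge0|exact: bm_level_freq].
Qed.

Let mI01 : measurable I01 := measurable_itv _.

Lemma integrable_I01 (h : R -> R) :
  bounded_measurable h -> mu.-integrable I01 (EFin \o h).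
Proof. exact: (@bm_integrable_on _ _ _ mu _ mI01 lebesgue_I01_fin). Qed.

(** Write [a j] as the integral of the indicator of u <= a j. On that set [level_freq (a j)] is at
    most [level_freq u], and summing the indicators over j produces the missing factor
    [beta * level_freq u]. *)
Lemma sum_level_freq : \sum_(j | Q j) a j * level_freq (a j) `^ theta <= beta * I.
Proof.
pose c j := level_freq (a j) `^ theta.
have bs j : bounded_measurable (fun u : R => c j * (u <= a j)%R%:R).
  by apply: bmZ; exact: bm_step.
have -> : \sum_(j | Q j) a j * c j =
    \int[mu]_(u in I01) (\sum_(j | Q j) c j * (u <= a j)%R%:R).
  rewrite (@Rintegral_sum_on _ _ _ mu _ mI01 lebesgue_I01_fin); last by move=> j _; exact: bs.
  apply: eq_bigr => j Qj; rewrite RintegralZl //; last by apply: integrable_I01; exact: bm_step.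
  by rewrite Rintegral_step ?a01 // mulrC.
have -> : beta * I = \int[mu]_(u in I01) (beta * level_freq u `^ (1 + theta)).
  by rewrite RintegralZl //; exact: (integrable_I01 bm_level_freq_powR).
apply: le_Rintegral => //.
- by apply: integrable_I01; apply: bm_sum.
- by apply: integrable_I01; apply: bmZ; exact: bm_level_freq_powR.
- move=> u _; have n0 := level_freq_ge0 u.
  have -> : beta * level_freq u `^ (1 + theta) =
      \sum_(j | Q j) level_freq u `^ theta * (u <= a j)%R%:R.
    have [nz|nz] := eqVneq (level_freq u) 0.
      have t1 : 1 + theta != 0 by rewrite gt_eqF // addr_gt0.
      have t2 : theta != 0 by rewrite gt_eqF.
      rewrite nz !powR0 // mulr0.
      by rewrite big1 // => j _; rewrite mul0r.
    rewrite powRD ?nz ?implybT // powRr1 // -mulr_sumr mulrA mulrC; congr (_ * _).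
    by rewrite mulrC divfK // gt_eqF.
  apply: ler_sum => j Qj; case: (leP u (a j)) => h; rewrite ?mulr0 // !mulr1.
  apply: ge0_ler_powR; rewrite ?nnegrE ?level_freq_ge0 ?(ltW theta0) //.
  exact: level_freq_anti.
Qed.

(** Among the indices counted, let j have the smallest [a j]. All of them are then counted by
    [beta * level_freq (a j)], which is at most [beta * x]. *)
Lemma card_level_freq (x : R) : 0 <= x ->
  \sum_(j | Q j) (level_freq (a j) <= x)%R%:R <= beta * x.
Proof.
move=> x0; have [/existsP[j0 Qj0]|] := boolP [exists j, Q j && (level_freq (a j) <= x)].
  have [j /andP[Qj jx] jmin] := @arg_minP _ _ _ j0
    (fun j => Q j && (level_freq (a j) <= x)) a Qj0.
  apply: le_trans (_ : _ <= beta * level_freq (a j)) _; last by rewrite ler_pM2l.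
  rewrite mulrC divfK ?gt_eqF //; apply: ler_sum => i Qi; rewrite ler_nat.
  by case: (leP (level_freq (a i)) x) => // ix; rewrite jmin // Qi.
rewrite negb_exists => /forallP h; rewrite big1 ?mulr_ge0 ?(ltW beta0) // => j Qj.
by have := h j; rewrite Qj /= => /negbTE ->.
Qed.

Lemma level_freq_integral_gt0 j0 : Q j0 -> a j0 = 1 -> 0 < I.
Proof.
move=> Qj0 aj0; apply: lt_le_trans (_ : beta^-1 `^ (1 + theta) <= I).
  by rewrite powR_gt0 // invr_gt0.
have -> : beta^-1 `^ (1 + theta) = \int[mu]_(u in I01) (beta^-1 `^ (1 + theta)).
  by rewrite Rintegral_cst //= lebesgue_I01 mulr1.
rewrite /I; apply: le_Rintegral => //.
- by apply: integrable_I01; exact: bm_cst.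
- by apply: integrable_I01; exact: bm_level_freq_powR.
- move=> u /=; rewrite in_itv /= => /andP[_ u1].
  apply: ge0_ler_powR; rewrite ?nnegrE ?level_freq_ge0 ?invr_ge0 ?(ltW beta0) //.
    by rewrite addr_ge0 // ltW.
  rewrite /level_freq -[leLHS]mul1r ler_pM2r ?invr_gt0 // (bigD1 j0) //= aj0 u1.
  by rewrite lerDl sumr_ge0.
Qed.

End StepFunctions.

Section SharpBound.
Context d (T : measurableType d) (R : realType) (P : probability T R).
Context (J : finType) (Q : pred J) (X Y : J -> T -> R) (M : T -> R) (a : J -> R).
Context (beta V p : R).

Local Notation E h := (Rintegral P setT h).
Local Notation bm := bounded_measurable.

(** The truncation level of a pair rises with its rank [n j], that is, as its mixing coefficient
    falls. Because one M dominates all variables, the remainders can be summed pointwise before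
    integrating, so that only the number of truncated pairs matters. *)
Lemma covar_sharp j0 : 1 < p -> 0 < beta -> 0 < V ->
  (forall j, bm (X j)) -> (forall j, bm (Y j)) -> bm M ->
  (forall j w, Q j -> `|X j w| <= M w) -> (forall j w, Q j -> `|Y j w| <= M w) ->
  (forall j, Q j -> alpha P (X j) (Y j) <= a j) ->
  (forall j, Q j -> 0 <= a j <= 1) -> Q j0 -> a j0 = 1 ->
  E (fun w => M w `^ (2 * p)) <= V `^ (2 * p) ->
  \sum_(j | Q j) `|covar P (X j) (Y j)| <=
   8 * beta * V ^+ 2 * (\int[lebesgue_measure]_(u in `[0%R, 1%R])
       level_freq Q a beta u `^ (p / (p - 1))) `^ (1 - p^-1).
Proof.
move=> p1 beta0 V0 bX bY bM XM YM aXY a01 Qj0 aj0 EM.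
have p0 : 0 < p by exact: lt_trans p1.
have pB0 : 0 < p - 1 by rewrite subr_gt0.
pose theta := (p - 1)^-1.
have theta0 : 0 < theta by rewrite invr_gt0.
have thetaE : theta = (p - 1)^-1 by [].
have pE : p / (p - 1) = 1 + theta.
  by rewrite /theta; field; rewrite gt_eqF.
clearbody theta.
rewrite pE; set I := Rintegral _ _ _.
have I0 : 0 < I := level_freq_integral_gt0 beta0 theta0 Qj0 aj0.
pose nrm := I `^ (1 - p^-1).
have n0 : 0 < nrm by rewrite powR_gt0.
have nrmE : nrm = I `^ (1 - p^-1) by [].
rewrite -nrmE; clearbody nrm.
pose n j := level_freq Q a beta (a j).
have n_ge0 j : 0 <= n j := level_freq_ge0 Q a beta0 (a j).
have n_gt0 j : Q j -> 0 < n j.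
  move=> Qj; rewrite divr_gt0 // (bigD1 j) //= lexx.
  by rewrite ltr_pwDl // sumr_ge0.
(* Pairwise truncation levels, chosen so that the truncated covariances add up to
   an integral of level_freq and, by card_level_freq, at most beta * x pairs are
   truncated below M w. *)
pose t j := V * (n j / nrm) `^ (theta / 2).
have t0 j : Q j -> 0 < t j by move=> Qj; rewrite mulr_gt0 // powR_gt0 // divr_gt0 // n_gt0.
have M0 w : 0 <= M w := le_trans (normr_ge0 _) (XM _ w Qj0).
have bMp : bm (fun w => M w `^ (2 * p)).
  by apply: bm_powR => //; rewrite mulr_ge0 // ltW.
have btail j : bm (fun w => M w ^+ 2 * (t j < M w)%R%:R).
  by apply: bmM; [exact: bmM|exact: bm_gt].
have s1 : \sum_(j | Q j) 2 * t j ^+ 2 * alpha P (X j) (Y j) <= 2 * (beta * V ^+ 2 * nrm).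
  apply: le_trans (_ : _ <= \sum_(j | Q j) 2 * V ^+ 2 * nrm `^ (- theta) *
       (a j * n j `^ theta)) _.
    apply: ler_sum => j Qj.
    have -> : t j ^+ 2 = V ^+ 2 * nrm `^ (- theta) * n j `^ theta.
      rewrite exprMn -mulrA; congr (_ * _).
      rewrite -powR_mulrn ?powR_ge0 // -powRrM divfK // powRM ?invr_ge0 ?(ltW n0) //.
      rewrite mulrC; congr (_ * _).
      by rewrite -(powR_inv1 (ltW n0)) -powRrM mulN1r.
    set x := 2 * V ^+ 2 * _; set y := n j `^ theta.
    have -> : 2 * (V ^+ 2 * nrm `^ (- theta) * y) * alpha P (X j) (Y j) =
        x * y * alpha P (X j) (Y j) by rewrite /x !mulrA.
    rewrite [a j * y]mulrC [leRHS]mulrA; apply: ler_wpM2l; last exact: aXY.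
    by rewrite /x /y !mulr_ge0 ?powR_ge0 ?(ltW V0).
  rewrite -mulr_sumr.
  apply: le_trans (ler_wpM2l _ (sum_level_freq beta0 a01 theta0)) _.
    by rewrite !mulr_ge0 ?powR_ge0 ?(ltW V0).
  rewrite -/I le_eqVlt; apply/orP; left; apply/eqP.
  (* This identity is why [nrm] is the power 1 - 1/p of I: clipped parts and remainders both become
     multiples of [beta * V ^+ 2 * nrm]. *)
  have nI : nrm `^ (- theta) * I = nrm.
    rewrite nrmE -powRrM -{2}(powRr1 (ltW I0)) -powRD ?(gt_eqF I0) ?implybT //.
    by congr (_ `^ _); rewrite thetaE; field; rewrite !gt_eqF.
  by rewrite -[in RHS]nI; ring.
have s2 : \sum_(j | Q j) E (fun w => M w ^+ 2 * (t j < M w)%R%:R) <= beta * V ^+ 2 * nrm.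
  rewrite -Ex_sum //.
  apply: le_trans (_ : _ <= E (fun w => beta * nrm * V `^ (2 - 2 * p) * M w `^ (2 * p))) _.
    apply: Ex_le; [exact: bm_sum|exact: bmZ|] => w.
    rewrite -mulr_sumr.
    have [->|Mz] := eqVneq (M w) 0.
      by rewrite expr0n mul0r !mulr_ge0 ?powR_ge0 ?(ltW beta0) ?(ltW n0).
    have Mw0 : 0 < M w by rewrite lt_neqAle eq_sym Mz M0.
    (* x inverts the choice of the levels: [t j < M w] forces [n j <= x]. *)
    pose x := nrm * (M w / V) `^ (2 / theta).
    apply: le_trans (_ : _ <= M w ^+ 2 * (beta * x)) _.
      apply: ler_wpM2l; first exact: sqr_ge0.
      apply: le_trans (card_level_freq Q a beta0 (x := x) _).
        apply: ler_sum => j Qj; rewrite ler_nat; case: ltP => //= tM.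
        rewrite lt0b /x mulrC -ler_pdivrMr // -/(n j).
        have -> : n j / nrm = ((n j / nrm) `^ (theta / 2)) `^ (2 / theta).
          rewrite -powRrM (_ : theta / 2 * (2 / theta) = 1) ?powRr1 //.
            by rewrite divr_ge0 // ltW.
          by field; rewrite gt_eqF.
        apply: ge0_ler_powR; rewrite ?nnegrE ?powR_ge0 ?divr_ge0 ?(ltW theta0) ?(ltW V0) //.
        by rewrite ler_pdivlMr // mulrC ltW.
      by rewrite mulr_ge0 ?powR_ge0 // ltW.
    rewrite /x le_eqVlt; apply/orP; left; apply/eqP.
    have -> : 2 / theta = 2 * p - 2 by rewrite thetaE invrK; ring.
    have -> : (M w / V) `^ (2 * p - 2) = M w `^ (2 * p - 2) * V `^ (2 - 2 * p).
      rewrite powRM ?invr_ge0 ?(ltW V0) //; congr (_ * _).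
      by rewrite -powR_inv1 ?(ltW V0) // -powRrM; congr (_ `^ _); ring.
    have -> : M w `^ (2 * p) = M w ^+ 2 * M w `^ (2 * p - 2).
      rewrite -powR_mulrn ?M0 // -powRD ?Mz ?implybT //.
      by congr (_ `^ _); ring.
    by ring.
  rewrite ExZ //.
  apply: le_trans (ler_wpM2l _ EM) _.
    by rewrite !mulr_ge0 ?powR_ge0 ?(ltW beta0) ?(ltW n0).
  have e : V `^ (2 - 2 * p) * V `^ (2 * p) = V ^+ 2.
    by rewrite -powRD ?(gt_eqF V0) ?implybT // subrK powR_mulrn ?(ltW V0).
  by rewrite -(mulrA (beta * nrm)) e mulrAC.
apply: le_trans (_ : _ <= \sum_(j | Q j) (2 * t j ^+ 2 * alpha P (X j) (Y j) +
    6 * E (fun w => M w ^+ 2 * (t j < M w)%R%:R))) _.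
  apply: ler_sum => j Qj.
  by apply: (covar_trunc P (ltW (t0 j Qj))) => // w; [exact: XM|exact: YM].
rewrite big_split /= -mulr_sumr.
have -> : 8 * beta * V ^+ 2 * nrm = 2 * (beta * V ^+ 2 * nrm) + 6 * (beta * V ^+ 2 * nrm).
  by ring.
by apply: lerD => //; rewrite ler_pM2l.
Qed.

End SharpBound.

(** * Variance of a block sum *)

Section Distances.
Context (R : realType) (N : finType) (e : rel N).
Implicit Types (i j : N) (B : {set N}).

Lemma gdist_refl i : gdist R e i i = 0%E.
Proof.
apply/eqP; rewrite eq_le; apply/andP; split.
  by apply: ereal_inf_lbound; exists [::].
by apply: le_ereal_inf_tmp => _ [w _ <-]; rewrite lee_fin.
Qed.

(** A shortest walk repeats no vertex, so its length is below |N|; no distance is missed by the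
    finite list that [radii] filters. *)
Lemma gdist_distances i j : gdist R e i j \in distances R N.
Proof.
rewrite /distances mem_rcons inE.
case: (pselect (exists w, path e i w /\ last i w = j)) => [ex|nw]; last first.
  rewrite /gdist (_ : [set _ | _ in _] = set0) ?ereal_inf0 ?eqxx //.
  by apply/seteqP; split => x // [w ew _]; apply: nw; exists w.
pose Q k := `[< exists2 w, path e i w /\ last i w = j & size w = k >].
have exQ : exists k, Q k by have [w ew] := ex; exists (size w); apply/asboolP; exists w.
case: (ex_minnP exQ) => m /asboolP[w [ew lw] sw] mmin.
have -> : gdist R e i j = m%:R%:E.
  apply/eqP; rewrite eq_le; apply/andP; split.
    by apply: ereal_inf_lbound; exists w => //=; rewrite sw.
  apply: le_ereal_inf_tmp => _ [w' ew' <-]; rewrite lee_fin ler_nat.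
  by apply: mmin; apply/asboolP; exists w'.
apply/orP; right; apply/mapP; exists m => //.
rewrite mem_iota /= add0n; move: lw; case/shortenP: ew => w' ew' uw' _ lw.
have mw : (m <= size w')%N by apply: mmin; apply/asboolP; exists w'.
apply: leq_ltn_trans mw _.
by have /card_uniqP := uw'; rewrite /= => <-; exact: max_card.
Qed.

Lemma distances_uniq : uniq (distances R N).
Proof.
rewrite /distances rcons_uniq map_inj_uniq ?iota_uniq ?andbT.
  by apply/negP => /mapP[].
by move=> k l [] /eqP; rewrite eqr_nat => /eqP.
Qed.

(** [Gamma] sums over radii and a variance over pairs; grouping pairs by distance relates the
    two. *)
Lemma sum_radii B (phi : \bar R -> R) :
  \sum_(rho <- radii R e B) #|pairs_at e B rho|%:R * phi rho =
  \sum_(ij : N * N | (ij.1 \in B) && (ij.2 \in B)) phi (gdist R e ij.1 ij.2).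
Proof.
have radii_in i j : i \in B -> j \in B -> gdist R e i j \in radii R e B.
  move=> iB jB; rewrite mem_filter gdist_distances andbT.
  by apply/set0Pn; exists (i, j); rewrite inE /= iB jB eqxx.
transitivity (\sum_(rho <- radii R e B) \sum_(ij : N * N | (ij.1 \in B) && (ij.2 \in B))
    if gdist R e ij.1 ij.2 == rho then phi rho else 0).
  apply: eq_bigr => rho _; rewrite -big_mkcondr /= sumr_const mulr_natl.
  by congr (_ *+ _); apply: eq_card => ij; rewrite !inE andbA.
rewrite exchange_big; apply: eq_bigr => ij /andP[iB jB] /=.
rewrite -big_mkcond /= (big_rem (gdist R e ij.1 ij.2)) /=; last exact: radii_in.
rewrite eqxx big_seq_cond big1 ?addr0 // => rho.
rewrite mem_rem_uniq; last by rewrite filter_uniq // distances_uniq.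
by rewrite !inE eq_sym => /andP[/andP[/negbTE ->]].
Qed.

End Distances.

Section AlphaClass.
Context (R : realType) d (T : measurableType d) (P : probability T R).
Context d' (X : measurableType d') (N : finType) (e : rel N) (Z : N -> {RV P >-> X}).
Context (F : set (X -> R)).
Hypothesis dep : network_dependent e Z.
Hypothesis bF : forall f, F f -> bounded_measurable f.

Lemma bm_RV (f : X -> R) i : bounded_measurable f -> bounded_measurable (f \o Z i).
Proof.
move=> [mf [K fK]]; split; first exact: measurableT_comp.
by exists K => w; exact: fK.
Qed.

Lemma bm_class_sub f : class_sub F f -> bounded_measurable f.
Proof. by case=> f1 F1 [f2 F2 <-]; apply: bmB; exact: bF. Qed.

Implicit Types (B : {set N}) (f : X -> R).

Let alphas B (rho : \bar R) : set R :=
  [set x | exists f i j, [/\ class_sub F f, i \in B, j \in B,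
        (rho <= gdist R e i j)%E & x = alpha P (f \o Z i) (f \o Z j)]].

Let alphas_ub B rho : ubound (alphas B rho) 1.
Proof.
move=> _ [f [i [j [Ff _ _ _ ->]]]].
by apply: alpha_le1; apply: bm_RV; exact: bm_class_sub.
Qed.

(** [network_dependent] enters here, for two singletons. The case stands apart because [alpha_class]
    is 0 at +oo by convention and not as a supremum. *)
Lemma alpha_indep f i j : bounded_measurable f -> gdist R e i j = +oo%E ->
  alpha P (f \o Z i) (f \o Z j) = 0.
Proof.
move=> bf dij; have ij : i != j.
  by apply: contraPN dij => /eqP ->; rewrite gdist_refl.
have sd : set_gdist R e [set i]%SET [set j]%SET = +oo%E.
  apply/ereal_inf_pinfty => _ [x /= + [y /= + <-]].
  by rewrite !inE => /eqP -> /eqP ->.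
have dis : ([set i] :&: [set j])%SET = finset.set0.
  by apply/eqP; rewrite setI_eq0 disjoints1 inE.
have indep := dep dis sd.
have gen k s : sigma_of Z [set k]%SET [set w | s <= f (Z k w)].
  apply: sub_sigma_algebra; exists k; first by rewrite /= inE.
  exists (f @^-1` `[s, +oo[%classic).
    by rewrite -[X in measurable X]setTI; apply: bf.1.
  by rewrite setTI; apply/seteqP; split => w /=; rewrite in_itv /= andbT.
have bi := bm_RV i bf; have bj := bm_RV j bf.
rewrite /alpha (_ : [set _ | _ in _] = [set 0]) ?sup1 ?mulr0 //.
apply/seteqP; split => [_ [st _ <-] /=|_ ->].
  rewrite (indep _ _ (gen i st.2) (gen j st.1)) fineM ?subrr ?normr0 //;
  by apply: fin_num_measure; exact: measurable_up.
exists (0, 0) => //=; rewrite (indep _ _ (gen i 0) (gen j 0)) fineM ?subrr ?normr0 //;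
by apply: fin_num_measure; exact: measurable_up.
Qed.

Lemma alpha_le_class B f i j : class_sub F f -> i \in B -> j \in B ->
  alpha P (f \o Z i) (f \o Z j) <= alpha_class e Z F B (gdist R e i j).
Proof.
move=> Ff iB jB; have bf := bm_class_sub Ff.
rewrite /alpha_class; case: ifPn => [_|_].
  by apply: alpha_le1; exact: bm_RV.
case: ifPn => [/eqP dij|_]; first by rewrite alpha_indep.
apply: ub_le_sup; first by exists 1; exact: alphas_ub.
by exists f, i, j.
Qed.

Lemma alpha_class_itv B f i j : class_sub F f -> i \in B -> j \in B ->
  0 <= alpha_class e Z F B (gdist R e i j) <= 1.
Proof.
move=> Ff iB jB; have bf := bm_class_sub Ff; apply/andP; split.
  by apply: le_trans (alpha_le_class Ff iB jB); apply: alpha_ge0; exact: bm_RV.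
rewrite /alpha_class; case: ifPn => [//|_]; case: ifPn => [//|_].
apply: ge_sup; last exact: alphas_ub.
by eexists; exists f, i, j.
Qed.

Lemma alpha_class_refl B i : alpha_class e Z F B (gdist R e i i) = 1.
Proof. by rewrite gdist_refl /alpha_class eqxx. Qed.

End AlphaClass.

Section BlockVariance.
Context (R : realType) d (T : measurableType d) (P : probability T R).
Context d' (X : measurableType d') (N : finType) (e : rel N) (Z : N -> {RV P >-> X}).
Context (F : set (X -> R)).
Hypothesis dep : network_dependent e Z.
Hypothesis bF : forall f, F f -> bounded_measurable f.

Local Notation E h := (Rintegral P setT h).
Local Notation bm := bounded_measurable.

Lemma Lnorm_moment (h : X -> R) i (q v : R) : 0 < q -> 0 < v -> bm h ->
  ('N[distribution P (Z i)]_(q%:E)[EFin \o h] <= v%:E)%E ->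
  E (fun w => `|h (Z i w)| `^ q) <= v `^ q.
Proof.
move=> q0 v0 bh hv.
have q0' : 0 <= q := ltW q0.
have bhq : bm (fun w => `|h (Z i w)| `^ q).
  by apply: bm_powR => //; apply: bm_norm; exact: (bm_RV Z i bh).
have mq : measurable_fun setT (fun x => (`|h x| `^ q)%:E).
  apply/measurable_EFinP.
  by have [] : bm (fun x => `|h x| `^ q) by apply: bm_powR => //; exact: bm_norm.
rewrite -lee_fin -Ex_fin //.
have -> : (\int[P]_w (`|h (Z i w)| `^ q)%:E)%E =
    ('N[distribution P (Z i)]_(q%:E)[EFin \o h] `^ q)%E.
  rewrite poweR_Lnorm ?gt_eqF //=.
  transitivity (\int[distribution P (Z i)]_x (`|h x| `^ q)%:E)%E; last first.
    by apply: eq_integral => x _.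
  by rewrite ge0_integral_distribution // => x; rewrite lee_fin powR_ge0.
have -> : (v `^ q)%:E = (v%:E `^ q)%E by [].
by apply: gt0_ler_poweR; rewrite ?in_itv /= ?Lnorm_ge0 ?lee_fin ?(ltW v0) ?leey.
Qed.

Lemma Lnorm_ae (h : X -> R) i (v : R) : bm h ->
  ('N[distribution P (Z i)]_(+oo)[EFin \o h] <= v%:E)%E ->
  {ae P, forall w, `|h (Z i w)| <= v}.
Proof.
move=> bh; have p1 : (0 < distribution P (Z i) [set: X])%E.
  by rewrite /distribution /= /pushforward /= preimage_setT probability_setT lte01.
rewrite unlock p1 => /ess_supP.
move=> [A [mA A0 hA]].
exists (Z i @^-1` A); split => //.
- by rewrite -[X in measurable X]setTI; apply: measurable_funP.
- move=> w /= hw; apply: hA => /=; rewrite lee_fin; exact: hw.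
Qed.

Context (h : X -> R) (B : {set N}) (v : R).
Hypotheses (Fh : class_sub F h) (v0 : 0 < v) (B0 : (0 < #|B|)%N).

Let bh : bm h := bm_class_sub bF Fh.
Let Q := [pred ij : N * N | (ij.1 \in B) && (ij.2 \in B)].
Let S : R := \sum_(ij | Q ij) `|covar P (h \o Z ij.1) (h \o Z ij.2)|.
Let al (rho : \bar R) : R := alpha_class e Z F B rho.
Let b : R := #|B|%:R.

Let b0 : 0 < b. Proof. by rewrite ltr0n. Qed.

Let bZ i : bm (h \o Z i) := bm_RV Z i bh.

Lemma sum_pair_freq (phi : \bar R -> R) :
  b * \sum_(rho <- radii R e B) pair_freq e B rho * phi rho =
  \sum_(ij | Q ij) phi (gdist R e ij.1 ij.2).
Proof.
rewrite -sum_radii mulr_sumr; apply: eq_bigr => rho _.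
by rewrite /pair_freq mulrA mulrCA -/b mulfV ?mulr1 // gt_eqF.
Qed.

Lemma sum_le_pair_freq (k : R) (phi : \bar R -> R) :
  (forall i j, i \in B -> j \in B ->
    `|covar P (h \o Z i) (h \o Z j)| <= k * phi (gdist R e i j)) ->
  S <= k * (b * \sum_(rho <- radii R e B) pair_freq e B rho * phi rho).
Proof.
move=> H; rewrite sum_pair_freq mulr_sumr; apply: ler_sum => -[i j] /andP[iB jB].
exact: H.
Qed.

Let al_itv i j : i \in B -> j \in B -> 0 <= al (gdist R e i j) <= 1.
Proof. by move=> iB jB; apply: (alpha_class_itv dep bF Fh iB jB). Qed.

Let al_ub i j : i \in B -> j \in B ->
  alpha P (h \o Z i) (h \o Z j) <= al (gdist R e i j).
Proof. by move=> iB jB; apply: (alpha_le_class dep bF Fh iB jB). Qed.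

Lemma covar_sum_bound (p : \bar R) : (1 <= p)%E ->
  (forall i, 'N[distribution P (Z i)]_(2%:E * p)[EFin \o h] <= v%:E)%E ->
  S <= 14 * b * Gamma_sum e Z F p B ^+ 2 * v ^+ 2.
Proof.
move=> p1 hv; rewrite /Gamma_sum.
have key phi : (forall rho, 0 <= pair_freq e B rho * phi rho) ->
   (forall i j, i \in B -> j \in B ->
    `|covar P (h \o Z i) (h \o Z j)| <= 14 * v ^+ 2 * phi (gdist R e i j)) ->
   S <= 14 * b * Num.sqrt (\sum_(rho <- radii R e B) pair_freq e B rho * phi rho) ^+ 2
     * v ^+ 2.
  move=> phi0 H; apply: le_trans (sum_le_pair_freq H) _.
  rewrite sqr_sqrtr ?sumr_ge0 // le_eqVlt; apply/orP; left; apply/eqP; ring.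
have f0 rho : 0 <= pair_freq e B rho by rewrite divr_ge0.
have v2 : 0 <= v ^+ 2 by rewrite sqr_ge0.
have mom r : p = r%:E -> 0 < r -> forall i, E (fun w => `|(h \o Z i) w| `^ (2 * r)) <= v `^ (2 * r).
  move=> pr r0 i; apply: Lnorm_moment => //; first by rewrite mulr_gt0.
  by rewrite EFinM -pr; exact: hv.
case: ifPn => [/eqP p1'|pn1].
  have -> : \sum_(rho <- radii R e B) pair_freq e B rho =
      \sum_(rho <- radii R e B) pair_freq e B rho * 1.
    by apply: eq_bigr => rho _; rewrite mulr1.
  apply: (key (fun=> 1)) => [rho|i j iB jB]; first by rewrite mulr1.
  have /andP[_ a1] := al_itv iB jB.
  have := @covar_moment _ _ _ P _ _ 1 v 1 (lexx 1) v0 ler01 (bZ i) (bZ j)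
    (mom 1 p1' ltr01 i) (mom 1 p1' ltr01 j) (le_trans (al_ub iB jB) a1).
  by rewrite powR1.
apply: (key (fun rho => al rho `^ _)) => [rho|i j iB jB]; first by rewrite mulr_ge0 ?powR_ge0 ?f0.
have /andP[a0 a1] := al_itv iB jB.
case: p => [r| |] // in p1 hv mom pn1 *.
- have r1 : 1 <= r by rewrite -lee_fin.
  have r0 : 0 < r by exact: lt_le_trans r1.
  rewrite inver gt_eqF //=.
  by apply: covar_moment => //; rewrite ?(mom r) //; exact: al_ub.
- rewrite invey /= subr0 powRr1 //.
  have hv' i0 : {ae P, forall w, `|h (Z i0 w)| <= v}.
    by apply: Lnorm_ae => //; have := hv i0; rewrite gt0_muley ?lte_fin.
  apply: le_trans (covar_bounded (ltW v0) (bZ i) (bZ j) (hv' i) (hv' j) (al_ub iB jB)) _.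
  by rewrite ler_wpM2r // ler_wpM2r // ler_nat.
Qed.

Lemma Gamma_sharp_fin (r : R) : 1 < r -> Gamma_sharp e Z F r%:E B ^+ 2 =
  (\int[lebesgue_measure]_(u in `[0%R, 1%R])
     level_freq Q (fun ij => al (gdist R e ij.1 ij.2)) b u `^ (r / (r - 1))) `^ (1 - r^-1).
Proof.
move=> r1; have rn1 : r != 1 by rewrite gt_eqF.
have r0 : 0 < r by exact: lt_trans r1.
have finv : fine (r%:E^-1)%E = r^-1 by rewrite inver gt_eqF.
rewrite /Gamma_sharp eqe (negbTE rn1) sqr_sqrtr; last exact: powR_ge0.
rewrite finv; apply: (congr1 (fun y => y `^ (1 - r^-1))).
apply: eq_Rintegral => u _; apply: f_equal2.
  rewrite /level_freq; apply: (mulfI (lt0r_neq0 b0)).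
  rewrite (sum_pair_freq (fun rho => (u <= al rho)%R%:R)).
  by rewrite mulrCA mulfV ?mulr1 // gt_eqF.
by rewrite /hoelder_conjugate /= gt_eqF //= -EFinB inver subr_eq0 (negbTE rn1).
Qed.

(** Integrating the indicator of u <= alpha over [0, 1] gives alpha back; at p = +oo the bound by
    [Gamma_sum] therefore covers both versions. *)
Lemma Gamma_sharp_infty : Gamma_sharp e Z F +oo B = Gamma_sum e Z F +oo B.
Proof.
rewrite /Gamma_sharp /Gamma_sum (_ : (+oo == 1 :> \bar R)%E = false) //.
rewrite invey (_ : fine 0%E = 0) // !subr0 powRr1; last first.
  by apply: Rintegral_ge0 => u _; exact: powR_ge0.
congr Num.sqrt; rewrite hoelder_conjugatey (_ : fine 1%E = 1) //.
transitivity (\int[lebesgue_measure]_(u in `[0%R, 1%R])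
    \sum_(rho <- radii R e B) (pair_freq e B rho * (u <= al rho)%R%:R)).
  apply: eq_Rintegral => u _; rewrite powRr1 // sumr_ge0 // => rho _.
  by rewrite mulr_ge0 // divr_ge0.
have al01 rho : rho \in radii R e B -> 0 <= al rho <= 1.
  rewrite mem_filter => /andP[/set0Pn[[i j]] + _].
  by rewrite inE => /and3P[iB jB /eqP <-]; exact: al_itv.
have mI01 : measurable (`[0%R, 1%R]%classic : set R) by exact: measurable_itv.
rewrite (@Rintegral_sum_on _ _ _ lebesgue_measure _ mI01 (@lebesgue_I01_fin R)); last first.
  by move=> rho _; apply: bmZ; exact: bm_step.
rewrite big_seq [RHS]big_seq; apply: eq_bigr => rho rB.
have /andP[a0 a1] := al01 _ rB.
rewrite powRr1 // RintegralZl //; last first.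
  by apply: integrable_I01; exact: bm_step.
by rewrite Rintegral_step // a0.
Qed.

(** Diagonal pairs have mixing coefficient 1. Positivity matters when gamma_2 is +oo: its product
    with [Gamma] must be +oo, not 0. *)
Lemma Gamma_gt0 (p : \bar R) : (1 <= p)%E -> 0 < Gamma e Z F p B.
Proof.
move=> p1; have [i0 iB0] := card_gt0P B0.
have Q0 : Q (i0, i0) by rewrite /= iB0.
have sum_gt0 (phi : \bar R -> R) : phi 0%E = 1 -> (forall rho, 0 <= phi rho) ->
    0 < \sum_(rho <- radii R e B) pair_freq e B rho * phi rho.
  move=> phi1 phi0; rewrite -(@pmulr_rgt0 _ b) // sum_pair_freq (bigD1 (i0, i0)) //=.
  by rewrite gdist_refl phi1 ltr_pwDl // sumr_ge0.
have G1 : 0 < Gamma_sum e Z F p B.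
  rewrite /Gamma_sum; case: ifP => _; rewrite sqrtr_gt0; last first.
    apply: (sum_gt0 (fun rho => al rho `^ _)) => [|rho]; last exact: powR_ge0.
    by rewrite /al /alpha_class eqxx powR1.
  under eq_bigr do rewrite -[pair_freq _ _ _]mulr1.
  exact: (sum_gt0 (fun=> 1)).
rewrite /Gamma lt_min G1 mulr_gt0 ?powR_gt0 //.
case: p => [r| |] // in p1 G1 *; last by rewrite Gamma_sharp_infty.
have [r1|rn1] := eqVneq r 1.
  by move: G1; rewrite /Gamma_sharp /Gamma_sum r1 eqxx.
have r1 : 1 < r by rewrite lt_neqAle eq_sym rn1 -lee_fin.
suff : 0 < Gamma_sharp e Z F r%:E B ^+ 2.
  rewrite exprn_even_gt0 //= lt_neqAle eq_sym => ->.
  by rewrite /Gamma_sharp; case: ifP => _; exact: sqrtr_ge0.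
rewrite Gamma_sharp_fin // powR_gt0 //.
have -> : r / (r - 1) = 1 + (r - 1)^-1 by field; rewrite subr_eq0 gt_eqF.
apply: (level_freq_integral_gt0 b0 _ (j0 := (i0, i0))) => //.
- by rewrite invr_gt0 subr_gt0.
- exact: alpha_class_refl.
Qed.

Lemma covar_sharp_bound (p : \bar R) : (1 <= p)%E ->
  (forall i, 'N[distribution P (Z i)]_(2%:E * p)[EFin \o h] <= v%:E)%E ->
  S <= 14 * b * (Gamma_sharp e Z F p B * b `^ (fine (p^-1)%E / 2)) ^+ 2 * v ^+ 2.
Proof.
move=> p1 hv; have v2 : 0 <= v ^+ 2 by rewrite sqr_ge0.
have b1 : 1 <= b by rewrite ler1n.
case: p => [r| |] // in p1 hv *.
- have r1 : 1 <= r by rewrite -lee_fin.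
  have r0 : 0 < r by exact: lt_le_trans r1.
  have [re1|rn1] := eqVneq r 1.
    apply: le_trans (covar_sum_bound p1 hv) _.
    rewrite ler_wpM2r // ler_wpM2l ?mulr_ge0 ?(ltW b0) //.
    rewrite /Gamma_sharp /Gamma_sum re1 eqxx exprMn ler_peMr ?sqr_ge0 //.
    rewrite exprn_ege1 //= inver oner_eq0 /= invr1.
    by rewrite -[leLHS](powRr0 b) ler_powR // divr_ge0.
  have r1' : 1 < r by rewrite lt_neqAle eq_sym rn1.
  rewrite inver gt_eqF //=.
  (* The 2r-th moment of the maximum over the block is at most a sum of |B| moments, that is V^(2r).
     This is the origin of the factor |B|^(1/(2p)) in [Gamma]. *)
  pose V := b `^ (r^-1 / 2) * v.
  have V0 : 0 < V by rewrite mulr_gt0 // powR_gt0.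
  pose M w := \big[Num.max/0]_(i in B) `|h (Z i w)|.
  have [i0 iB0] := card_gt0P B0.
  have bMi i : bm (fun w => `|h (Z i w)|) by apply: bm_norm; exact: bZ.
  have bM : bm M by apply: bm_bigmax.
  have hM i w : i \in B -> `|h (Z i w)| <= M w.
    by move=> iB; rewrite /M (bigD1 i) //= le_max lexx.
  have EM : E (fun w => M w `^ (2 * r)) <= V `^ (2 * r).
    have q0 : 0 <= 2 * r by rewrite mulr_ge0 // ltW.
    have bp i : bm (fun w => `|h (Z i w)| `^ (2 * r)) by apply: bm_powR.
    apply: le_trans (_ : _ <= E (fun w => \sum_(i in B) `|h (Z i w)| `^ (2 * r))) _.
      apply: Ex_le.
      - apply: bm_powR => // w; exact: le_trans (hM _ w iB0).
      - by apply: bm_sum.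
      - move=> w; rewrite /M; elim/big_ind : _ => [|x y hx hy|i iB].
        + rewrite powR0; first by apply: sumr_ge0 => i _; exact: powR_ge0.
          by rewrite gt_eqF // mulr_gt0.
        + by case: (leP x y).
        + by rewrite (bigD1 i) //= lerDl sumr_ge0 // => j _; rewrite powR_ge0.
    rewrite Ex_sum //; apply: le_trans (_ : _ <= \sum_(i in B) v `^ (2 * r)) _.
      by apply: ler_sum => i _; apply: Lnorm_moment => //; rewrite ?mulr_gt0 // EFinM.
    rewrite sumr_const -[leLHS]mulr_natl -/b powRM ?powR_ge0 ?(ltW v0) // -powRrM.
    by rewrite (_ : r^-1 / 2 * (2 * r) = 1) ?powRr1 ?(ltW b0) //; field; rewrite gt_eqF.
  have H := @covar_sharp _ _ _ P _ Q (fun ij => h \o Z ij.1) (fun ij => h \o Z ij.2) M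
    (fun ij => al (gdist R e ij.1 ij.2)) b V r (i0, i0) r1' b0 V0.
  apply: le_trans (H _ _ _ _ _ _ _ _ _ _) _ => //.
  - by move=> -[i j] w /andP[iB jB]; exact: hM.
  - by move=> -[i j] w /andP[iB jB]; exact: hM.
  - by move=> -[i j] /andP[iB jB]; exact: al_ub.
  - by move=> -[i j] /andP[iB jB]; exact: al_itv.
  - by rewrite /= iB0.
  - exact: alpha_class_refl.
  rewrite -Gamma_sharp_fin // /V.
  set g := Gamma_sharp _ _ _ _ _; set c := b `^ _.
  rewrite [leLHS](_ : _ = 8 * (b * v ^+ 2 * c ^+ 2 * g ^+ 2)); last by ring.
  rewrite [leRHS](_ : _ = 14 * (b * v ^+ 2 * c ^+ 2 * g ^+ 2)); last by ring.
  rewrite ler_wpM2r ?ler_nat //.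
  by rewrite mulr_ge0 ?sqr_ge0 // mulr_ge0 ?sqr_ge0 // mulr_ge0 ?(ltW b0).
- rewrite Gamma_sharp_infty.
  rewrite invey /= mul0r powRr0 mulr1; exact: covar_sum_bound.
Qed.

Lemma block_variance (p : \bar R) : (1 <= p)%E ->
  (forall i, 'N[distribution P (Z i)]_(2%:E * p)[EFin \o h] <= v%:E)%E ->
  E (fun w => (\sum_(i in B) (h (Z i w) - E (h \o Z i))) ^+ 2) <=
    14 * b * Gamma e Z F p B ^+ 2 * v ^+ 2.
Proof.
move=> p1 hv; apply: le_trans (_ : _ <= S) _.
  rewrite (_ : (fun w => _) = (fun w => \sum_(ij | Q ij)
      (h (Z ij.1 w) - E (h \o Z ij.1)) * (h (Z ij.2 w) - E (h \o Z ij.2)))); last first.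
    apply/funext => w; rewrite expr2 mulr_suml.
    under eq_bigr do rewrite mulr_sumr.
    by rewrite pair_big.
  have bc i : bm (fun w => h (Z i w) - E (h \o Z i)).
    by apply: bmB; [exact: bZ|exact: bm_cst].
  rewrite Ex_sum; last by move=> ij _; apply: bmM.
  apply: ler_sum => -[i j] _ /=; apply: le_trans (ler_norm _).
  rewrite le_eqVlt; apply/orP; left; apply/eqP.
  have -> : covar P (h \o Z i) (h \o Z j) =
      covar P (fun w => h (Z i w) - E (h \o Z i)) (fun w => h (Z j w) - E (h \o Z j)).
    rewrite covarDl; [|exact: bZ|exact: bm_cst|exact: bc].
    rewrite covarDr; [|exact: bZ|exact: bZ|exact: bm_cst].
    rewrite covar_cstl; last exact: bc.
    by rewrite [X in _ = _ + X + _]covarC covar_cstl ?addr0 //; exact: bZ.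
  rewrite /covar [X in _ - X * _](_ : _ = 0) ?mul0r ?subr0 //.
  by rewrite ExB ?Ex_cst ?subrr //; [exact: bZ|exact: bm_cst].
rewrite /Gamma; case: (leP (Gamma_sum e Z F p B)) => _.
  exact: covar_sum_bound.
exact: covar_sharp_bound.
Qed.

End BlockVariance.

(** * Conditional expectation, essential supremum and tau *)

Section ConditionalExpectation.
Context d (T : measurableType d) (R : realType) (P : probability T R).

(** g is the Radon-Nikodym derivative, with respect to the law of [iota], of the pushforward under
    [iota] of the signed measure with density X. If [iota] is the identity into T with a smaller
    sigma-field, g is a conditional expectation. *)
Lemma cond_exp_mfun d' (T' : measurableType d') (iota : {mfun T >-> T'}) (X : T -> R) :
  bounded_measurable X ->
  exists g : T' -> R, [/\ measurable_fun setT g,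
    P.-integrable setT (EFin \o (g \o iota)) &
    forall A, measurable A ->
     (\int[P]_(w in iota @^-1` A) (g (iota w))%:E =
      \int[P]_(w in iota @^-1` A) (X w)%:E)%E].
Proof.
move=> bX; have iX := bm_integrable P bX.
pose nu0 : {charge set T -> \bar R} := induced_charge iX.
have mpre A : measurable A -> measurable (iota @^-1` A).
  by move=> mA; rewrite -[X in measurable X]setTI; apply: measurable_funP.
pose nuf (A : set T') : \bar R := nu0 (iota @^-1` A).
have nuf0 : nuf set0 = 0%E by rewrite /nuf preimage_set0 charge0.
have nuf_fin A : measurable A -> nuf A \is a fin_num.
  by move=> mA; apply: fin_num_measure; exact: mpre.
have nuf_sigma : semi_sigma_additive nuf.
  move=> F mF tF mUF; rewrite /nuf preimage_bigcup.
  apply: charge_semi_sigma_additive.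
  - by move=> n; exact: mpre.
  - apply/trivIsetP => /= i j _ _ ij; rewrite -preimage_setI.
    by move/trivIsetP : tF => /(_ _ _ _ _ ij) ->//; rewrite preimage_set0.
  - by rewrite -preimage_bigcup; exact: mpre.
pose nu : {charge set T' -> \bar R} :=
  HB.pack nuf (isCharge.Build _ _ _ nuf nuf0 nuf_fin nuf_sigma).
pose mu : {sigma_finite_measure set T' -> \bar R} := distribution P iota.
have nu_mu : nu `<< mu.
  apply/null_content_dominatesP => A mA muA.
  rewrite /= /nuf /nu0 /induced_charge; apply: null_set_integral => //.
  - exact: mpre.
  - by apply: measurable_funTS; exact: measurable_int iX.
pose f := Radon_Nikodym nu mu.
have fint : mu.-integrable setT f by exact: Radon_Nikodym_integrable.
have ffin x : f x \is a fin_num by exact: Radon_Nikodym_fin_num.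
have mf : measurable_fun setT f by exact: measurable_int fint.
have fE : f = EFin \o (fine \o f) by apply/funext => x /=; rewrite fineK.
have fint' : P.-integrable setT (f \o iota).
  apply/integrableP; split; first exact: measurableT_comp.
  move/integrableP : fint => [_]; rewrite ge0_integral_distribution //.
  by apply: measurableT_comp.
exists (fine \o f); split.
- by apply: measurableT_comp => //; exact: measurable_fine.
- rewrite (_ : EFin \o _ = f \o iota) //.
  by apply/funext => x /=; rewrite fineK.
- move=> A mA; rewrite -[RHS]/(nu A) (Radon_Nikodym_integral nu_mu mA).
  transitivity (\int[P]_(w in iota @^-1` A) (f \o iota) w)%E.
    by apply: eq_integral => w _ /=; rewrite fineK.
  rewrite -integral_pushforward //.
  apply: integrableS fint' => //; exact: mpre.
Qed.

Lemma cond_exp_exists (G : set (set T)) (X : T -> R) :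
  <<s G >> `<=` measurable -> bounded_measurable X ->
  exists Y, is_cond_exp P <<s G >> X Y.
Proof.
move=> GM bX.
have mid : measurable_fun setT (idfun : T -> g_sigma_algebraType G).
  by move=> _ A mA; rewrite setTI; exact: GM.
pose iota : {mfun T >-> g_sigma_algebraType G} :=
  HB.pack (idfun : T -> g_sigma_algebraType G) (isMeasurableFun.Build _ _ _ _ _ mid).
have [g [mg ig gE]] := cond_exp_mfun iota bX.
exists g; split => //.
by move=> U mU; have := mg measurableT U mU; rewrite setTI.
Qed.

End ConditionalExpectation.

(** * Essential suprema as suprema of sequences *)

Section EssentialSupremum.
Context d (T : measurableType d) (R : realType) (P : probability T R).
Implicit Types (h W : T -> \bar R) (u : nat -> T -> \bar R).

Local Notation E h := (Rintegral P setT h).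

Lemma bm_contract W : measurable_fun setT W -> bounded_measurable (@contract R \o W).
Proof.
move=> mW; split; last by exists 1 => w /=; exact: contract_le1.
apply: (measurability _ (RGenOInfty.measurableE R)) => //.
move=> _ [_ [t ->] <-]; rewrite setTI.
have [t1|t1] := leP 1 t.
  rewrite (_ : _ @^-1` _ = set0); first exact: measurable0.
  apply/seteqP; split => // w /=; rewrite in_itv /= andbT => tw.
  have := contract_le1 (W w); rewrite ler_norml => /andP[_].
  by rewrite leNgt (le_lt_trans t1 tw).
have [t2|t2] := ltP t (-1).
  rewrite (_ : _ @^-1` _ = setT); first exact: measurableT.
  apply/seteqP; split => // w _ /=; rewrite in_itv /= andbT.
  have := contract_le1 (W w); rewrite ler_norml => /andP[+ _].
  exact: lt_le_trans.
have tE : contract (expand t) = t.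
  by apply: expandK; rewrite inE ler_norml t2 ltW.
rewrite (_ : _ @^-1` _ = setT `&` W @^-1` `]expand t, +oo[%classic).
  by apply: mW => //; exact: emeasurable_itv.
rewrite setTI; apply/seteqP; split => w /=; rewrite !in_itv /= ?andbT => tw.
  by rewrite -lt_contract tE.
by rewrite -tE lt_contract.
Qed.

Definition seq_sup u : T -> \bar R := fun w => ereal_sup (range (fun k => u k w)).

Lemma measurable_seq_sup u : (forall k, measurable_fun setT (u k)) ->
  measurable_fun setT (seq_sup u).
Proof.
move=> mu; rewrite (_ : seq_sup u = fun w => esups (u ^~ w) 0%N).
  exact: measurable_fun_esups.
by apply/funext => w; rewrite /seq_sup /esups; congr ereal_sup;
  apply/seteqP; split => [_ [k _ <-]|_ [k _ <-]]; exists k.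
Qed.

Lemma le_seq_sup u k w : (u k w <= seq_sup u w)%E.
Proof. by apply: ereal_sup_ubound; exists k. Qed.

Lemma seq_sup_mono u v : (forall k, exists l, v l = u k) ->
  forall w, (seq_sup u w <= seq_sup v w)%E.
Proof.
move=> uv w; apply: ge_ereal_sup => _ [k _ <-].
have [l <-] := uv k; exact: le_seq_sup.
Qed.

(* The supremum of a sequence in H that maximises the mean of a bounded strictly
   increasing transform is an essential supremum of H. *)
Lemma ess_supremum_exists (H : set (T -> \bar R)) h0 : H h0 ->
  (forall h, H h -> measurable_fun setT h) -> exists W, is_ess_supremum P H W.
Proof.
move=> Hh0 mH.
pose A : set R := [set x | exists2 u, forall k, H (u k) & x = E (@contract R \o seq_sup u)].
have mW u : (forall k, H (u k)) -> measurable_fun setT (seq_sup u).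
  by move=> Hu; apply: measurable_seq_sup => k; exact: mH.
have A1 : ubound A 1.
  move=> _ [u Hu ->]; apply: le_trans (ler_norm _) _.
  by apply: Ex_norm_le => [|w]; [exact: bm_contract (mW u Hu)|exact: contract_le1].
have A0 : A !=set0 by exists (E (@contract R \o seq_sup (fun=> h0))); exists (fun=> h0).
have supA : has_sup A by split => //; exists 1.
have [v vP] : {v : nat -> nat -> T -> \bar R & forall n, (forall k, H (v n k)) /\
    sup A - n.+1%:R^-1 < E (@contract R \o seq_sup (v n))}.
  apply: (@choice _ _ (fun n u => (forall k, H (u k)) /\
    sup A - n.+1%:R^-1 < E (@contract R \o seq_sup u))) => n.
  have [|_ [u Hu ->] lt_u] := @sup_adherent _ A n.+1%:R^-1 _ supA; last by exists u.
  by rewrite invr_gt0.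
(* A single sequence enumerating all the sequences [v n] attains the supremum of [A]. *)
pose u m := if @unpickle (nat * nat)%type m is Some nk then v nk.1 nk.2 else h0.
have Hu m : H (u m).
  by rewrite /u; case: unpickle => // -[n k]; have [] := vP n.
have vu n k : exists l, u l = v n k by exists (pickle (n, k)); rewrite /u pickleK.
have Eu : sup A <= E (@contract R \o seq_sup u).
  apply/ler_addgt0Pl => e e0; pose n := Num.truncn e^-1.
  rewrite -lerBlDl; have [Hv /ltW] := vP n.
  move/(le_trans _) => /(_ (sup A - e)) K; apply: le_trans (K _) _.
    rewrite lerD2l lerN2 -[leRHS]invrK lef_pV2 ?posrE ?invr_gt0 //.
    by rewrite ltW // truncnS_gt.
  apply: Ex_le; [exact: bm_contract (mW _ Hv)|exact: bm_contract (mW _ Hu)|].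
  by move=> w; rewrite /= le_contract; apply: seq_sup_mono => k; exact: vu.
exists (seq_sup u); split; first exact: mW.
(* Adding h to the sequence cannot raise the mean above [sup A]; as the transform is strictly
   increasing, the two suprema agree almost everywhere. *)
- move=> h Hh; pose u' m := if m is m'.+1 then u m' else h.
  have Hu' m : H (u' m) by case: m.
  have le_u w : (seq_sup u w <= seq_sup u' w)%E.
    by apply: seq_sup_mono => k; exists k.+1.
  pose phi w := contract (seq_sup u' w) - contract (seq_sup u w).
  have b1 := bm_contract (mW _ Hu'); have b2 := bm_contract (mW _ Hu).
  have bphi : bounded_measurable phi by exact: bmB.
  have phi0 w : 0 <= phi w by rewrite subr_ge0 le_contract.
  have Ephi : E phi <= 0.
    rewrite /phi ExB // subr_le0; apply: le_trans Eu.
    by apply: ub_le_sup; [exists 1|exists u'].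
  have : ae_eq P setT (EFin \o phi) (cst 0%E).
    apply/(ae_eq_integral_abs P measurableT); first by apply/measurable_EFinP; exact: bphi.1.
    under eq_integral => w _ do rewrite /= ger0_norm //.
    rewrite Ex_fin //; congr EFin; apply/eqP; rewrite eq_le Ephi /=.
    exact: Ex_ge0.
  apply: filterS => w /(_ I) [] /eqP; rewrite subr_eq0 => /eqP /contract_inj <-.
  exact: (le_seq_sup u' 0%N).
- move=> W' _ HW'.
  have : {ae P, forall w, forall k, (u k w <= W' w)%E}.
    by apply: ae_foralln => k; exact: HW'.
  by apply: filterS => w uW; apply: ge_ereal_sup => _ [k _ <-].
Qed.

End EssentialSupremum.

(** * Lower bounds for tau *)

Section TauLowerBound.
Context d (T : measurableType d) (R : realType) (P : probability T R).
Context (G : set (set T)) (GM : <<s G>> `<=` measurable).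
Context d' (X : measurableType d') (dX : X -> X -> \bar R) (xi : T -> X).
Hypothesis mxi : measurable_fun setT xi.

Local Notation E h := (Rintegral P setT h).

Let devs := deviations P dX <<s G>> xi.

Lemma bm_comp (g : X -> R) : bounded_measurable g -> bounded_measurable (g \o xi).
Proof.
by move=> [mg [K gK]]; split; [exact: measurableT_comp|exists K => w; exact: gK].
Qed.

Lemma fine_expectation (h : T -> R) : fine 'E_P[h]%E = E h.
Proof. by rewrite unlock. Qed.

Lemma deviations_measurable h : devs h -> measurable_fun setT h.
Proof.
move=> [g [Y [_ _ [iY _ _] ->]]]; apply/measurable_EFinP.
apply: measurableT_comp => //; apply: measurable_funB => //.
by apply/measurable_EFinP; exact: measurable_int iY.
Qed.

Lemma integral_indicM (A : set T) (h : T -> R) : measurable A ->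
  bounded_measurable h -> (E (fun w => \1_A w * h w))%:E = (\int[P]_(w in A) (h w)%:E)%E.
Proof.
move=> mA bh; rewrite -Ex_fin; last by apply: bmM => //; exact: bm_indic.
rewrite [RHS]integral_mkcond; apply: eq_integral => w _.
by rewrite /patch indicE; case: (w \in A); rewrite ?mul1r ?mul0r.
Qed.

(** tau is the mean of one essential supremum W. On [A i] the conditional deviation of [g i] is at
    most W, and disjointness allows a different test function on each event at the cost of a single
    mean of W. *)
Lemma tau_ge (I : finType) (A : I -> set T) (g : I -> X -> R) :
  (forall i, <<s G>> (A i)) -> (forall i j w, A i w -> A j w -> i = j) ->
  (forall i, bounded_measurable (g i)) ->
  (forall i x y, (`|g i x - g i y|%:E <= dX x y)%E) ->
  ((\sum_i E (fun w => \1_(A i) w * (g i (xi w) - E (g i \o xi))))%:E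
    <= tau P dX <<s G>> xi)%E.
Proof.
move=> GA Adisj bg lipg.
case: (pickP (fun _ : I => true)) => [i0 _|I0]; last first.
  rewrite big1 ?Lnorm_ge0 // => i _; by have := I0 i.
have mA i : measurable (A i) by exact: GM.
have bgx i : bounded_measurable (g i \o xi) by exact: bm_comp.
have [Y condY] : {Y : I -> T -> R & forall i, is_cond_exp P <<s G>> (g i \o xi) (Y i)}.
  by apply: (@choice _ _ (fun i Y => is_cond_exp P <<s G>> (g i \o xi) Y)) => i; exact: cond_exp_exists.
pose h i w : \bar R := `|Y i w - E (g i \o xi)|%:E.
have Hh i : devs (h i).
  exists (g i), (Y i); split => //; first exact: (bg i).1.
  by rewrite fine_expectation.
have [W0 W0P] := ess_supremum_exists P (Hh i0) deviations_measurable.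
set W := ess_supremum P devs.
have [mW Wub _] : is_ess_supremum P devs W by exact: (@xgetPex _ (cst 0%E) _ (ex_intro _ _ W0P)).
have -> : tau P dX <<s G>> xi = (\int[P]_w `|W w|)%E by rewrite /tau Lnorm1.
have mabsW : measurable_fun setT (fun w => `|W w|%E) by exact: measurableT_comp.
have step i : ((E (fun w => \1_(A i) w * (g i (xi w) - E (g i \o xi))))%:E
    <= \int[P]_(w in A i) `|W w|)%E.
  have bd : bounded_measurable (fun w => g i (xi w) - E (g i \o xi)).
    by apply: bmB; [exact: bgx|exact: bm_cst].
  have [iY mY YE] := condY i.
  have iYA : P.-integrable (A i) (EFin \o Y i) by exact: integrableS iY.
  have icA : P.-integrable (A i) (EFin \o (fun=> E (g i \o xi))).
    by apply: integrableS (bm_integrable P (bm_cst _ _)).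
  have igA : P.-integrable (A i) (EFin \o (g i \o xi)).
    by apply: integrableS (bm_integrable P (bgx i)).
  rewrite integral_indicM // integralB_EFin //.
  rewrite -(YE _ (GA i)) -integralB_EFin //.
  have mYc : measurable_fun (A i) (fun w => (Y i w)%:E - (E (g i \o xi))%:E)%E.
    by apply: emeasurable_funB; [exact: measurable_int iYA|exact: measurable_int icA].
  apply: le_trans (lee_abs _) _; apply: le_trans (le_abse_integral _ (mA i) mYc) _.
  apply: ae_ge0_le_integral => //.
  - exact: measurableT_comp.
  - exact: measurable_funTS.
  - have := Wub _ (Hh i); apply: filterS => w hW _.
    apply: le_trans (lee_abs _); exact: hW.
apply: le_trans (_ : _ <= \sum_i \int[P]_(w in A i) `|W w|)%E _.
  by rewrite -sumEFin; apply: lee_sum => i _; exact: step.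
under eq_bigr do rewrite integral_mkcond.
rewrite -ge0_integral_sum //; last 2 first.
- by move=> i; apply/(measurable_restrictT _ (mA i)); exact: measurable_funTS.
- by move=> i w _; rewrite /patch; case: ifP.
apply: ge0_le_integral => //.
- move=> w _; apply: sume_ge0 => i _; rewrite /patch; by case: ifP.
- apply: emeasurable_sum => i; apply/(measurable_restrictT _ (mA i)); exact: measurable_funTS.
- move=> w _; case: (pselect (exists i, A i w)) => [[i Aiw]|nA].
    rewrite (bigD1 i) //= big1 ?adde0; first by rewrite /patch mem_set.
    move=> j ji; rewrite /patch; case: ifPn => //; rewrite inE => Ajw.
    by rewrite (Adisj _ _ _ Ajw Aiw) eqxx in ji.
  rewrite big1 // => i _; rewrite /patch; case: ifPn => //.
  by rewrite inE => Aiw; exfalso; apply: nA; exists i.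
Qed.

Lemma tau_ge_scaled (c : R) (I : finType) (A : I -> set T) (g : I -> X -> R) : 0 < c ->
  (forall i, <<s G>> (A i)) -> (forall i j w, A i w -> A j w -> i = j) ->
  (forall i, bounded_measurable (g i)) ->
  (forall i x y, (`|g i x - g i y|%:E <= c%:E * dX x y)%E) ->
  ((\sum_i E (fun w => \1_(A i) w * (g i (xi w) - E (g i \o xi))))%:E
    <= c%:E * tau P dX <<s G>> xi)%E.
Proof.
move=> c0 GA Adisj bg lipg.
have bgx i : bounded_measurable (g i \o xi) by exact: bm_comp.
have bg' i : bounded_measurable (fun x => c^-1 * g i x) by exact: bmZ.
have lipg' i x y : (`|c^-1 * g i x - c^-1 * g i y|%:E <= dX x y)%E.
  rewrite -mulrBr normrM gtr0_norm ?invr_gt0 // EFinM.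
  apply: le_trans (lee_wpmul2l _ (lipg i x y)) _; first by rewrite lee_fin invr_ge0 ltW.
  by rewrite muleA -EFinM mulVf ?mul1e // gt_eqF.
have := tau_ge GA Adisj bg' lipg'.
have c0' : (0 <= c%:E)%E by rewrite lee_fin ltW.
move=> /(lee_wpmul2l c0'); apply: le_trans.
rewrite -EFinM lee_fin mulr_sumr le_eqVlt; apply/orP; left; apply/eqP; apply: eq_bigr => i _.
have mA : measurable (A i) by exact: GM.
have bi w : c^-1 * g i (xi w) - E ((fun x => c^-1 * g i x) \o xi) =
    c^-1 * (g i (xi w) - E (g i \o xi)).
  by rewrite mulrBr /comp ExZ //; exact: bgx.
have bd : bounded_measurable (fun w => \1_(A i) w * (g i (xi w) - E (g i \o xi))).
  by apply: bmM; [exact: bm_indic|apply: bmB; [exact: bgx|exact: bm_cst]].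
rewrite -[LHS]mul1r -(mulfV (lt0r_neq0 c0)) -mulrA -ExZ //; congr (_ * _).
apply: eq_Rintegral => w _; rewrite bi; ring.
Qed.

End TauLowerBound.

(** * Decoupling *)

Section Grid.
Context (R : realType) (T : Type) (I : finType) (h : I -> T -> R) (K delta : R).
Hypotheses (delta0 : 0 < delta) (hK : forall i w, `|h i w| <= K).

Definition grid_size : nat := Num.truncn ((K + K) / delta).

(** Cells live in a finite type so that they can index the events of [tau_ge]. The default of
    [inord] is never reached when K bounds the functions ([grid_cellE]). *)
Definition grid_cell (w : T) : {ffun I -> 'I_grid_size.+1} :=
  [ffun i => inord (Num.truncn ((h i w + K) / delta))].

Let shift_ge0 i w : 0 <= (h i w + K) / delta.
Proof.
apply: divr_ge0; last exact: ltW.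
by have := hK i w; rewrite ler_norml => /andP[+ _]; rewrite -subr_ge0 opprK.
Qed.

Lemma grid_cellE w i : grid_cell w i = Num.truncn ((h i w + K) / delta) :> nat.
Proof.
rewrite ffunE inordK // ltnS; apply: le_truncn.
rewrite ler_pM2r ?invr_gt0 // lerD2r; exact: le_trans (ler_norm _) (hK i w).
Qed.

Lemma grid_cell_close w w' i : grid_cell w = grid_cell w' -> `|h i w - h i w'| <= delta.
Proof.
move=> ww'; have : Num.truncn ((h i w + K) / delta) = Num.truncn ((h i w' + K) / delta).
  by rewrite -!grid_cellE ww'.
have /truncn_itv := shift_ge0 i w; have /truncn_itv := shift_ge0 i w'.
set m := Num.truncn _; set m' := Num.truncn _ => /andP[a b] /andP[a' b'] mm.
rewrite mm -/m in a' b'; move: a b a' b'.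
rewrite !ler_pdivlMr // !ltr_pdivrMr // -natr1 mulrDl mul1r.
move: (m%:R * delta) => x a b a' b'.
by rewrite ler_norml; apply/andP; split; clear -a b a' b'; lra.
Qed.

End Grid.

(** Stated for any measurable structure: with the sigma-field of the past as structure, it makes the
    cells events of the past. *)
Lemma measurable_grid_cell d (T : measurableType d) (R : realType) (I : finType)
    (h : I -> T -> R) (K delta : R) j :
  0 < delta -> (forall i w, `|h i w| <= K) -> (forall i, measurable_fun setT (h i)) ->
  measurable [set w | grid_cell h K delta w = j].
Proof.
move=> delta0 hK mh.
rewrite (_ : [set w | _] = \bigcap_(i in [set: I])
   (h i @^-1` `[(j i)%:R * delta - K, (j i).+1%:R * delta - K[%classic)).
  apply: fin_bigcap_measurable => // i _.
  by rewrite -[X in measurable X]setTI; apply: mh.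
have c0 i w : 0 <= (h i w + K) / delta.
  apply: divr_ge0; last exact: ltW.
  by have := hK i w; rewrite ler_norml => /andP[+ _]; rewrite -subr_ge0 opprK.
apply/seteqP; split => w /= => [wj i _|wj].
  rewrite /= in_itv /= lerBlDr ltrBrDr -ler_pdivlMr // -ltr_pdivrMr // -wj.
  by rewrite grid_cellE //; exact: truncn_itv.
apply/ffunP => i; apply/val_inj => /=; rewrite grid_cellE //.
have := wj i Logic.I; rewrite /= in_itv /= lerBlDr ltrBrDr -ler_pdivlMr // -ltr_pdivrMr //.
exact: truncn_def.
Qed.

Section LipschitzFunctional.
Context (R : realType) (X : Type) (I : finType) (phi : I -> (X -> R)).

Local Notation V := ((X -> R) -> R).

(** Elements of V are processes indexed by functions, seen through finitely many coordinates. As eps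
    may be negative, [I] must be nonempty for any Psi to qualify. *)
Definition lipschitz_on (Psi : V -> R) : Prop := forall (eps : R) (v v' : V),
  (forall i, `|v (phi i) - v' (phi i)| <= eps) -> `|Psi v - Psi v'| <= eps.

Context d (T : measurableType d) (Psi : V -> R) (vv : T -> V).
Hypotheses (lPsi : lipschitz_on Psi)
  (bv : forall i, bounded_measurable (fun w => vv w (phi i))).

Lemma common_bound : exists K, forall i w, `|vv w (phi i)| <= K.
Proof.
have [K KP] : {K : I -> R & forall i w, `|vv w (phi i)| <= K i}.
  by apply: (@choice _ _ (fun i K => forall w, `|vv w (phi i)| <= K)) => i; have [] := bv i.
exists (\sum_i `|K i|) => i w; apply: le_trans (KP i w) _.
by apply: le_trans (ler_norm _) _; rewrite (bigD1 i) //= lerDl sumr_ge0.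
Qed.

(** V carries no sigma-field. Measurability comes from uniform approximation by the values of Psi at
    representatives of ever finer grid cells. *)
Lemma bm_lipschitz : bounded_measurable (Psi \o vv).
Proof.
have [K hK] := common_bound; split; last first.
  exists (`|Psi (vv point)| + (K + K)) => w.
  have -> : (Psi \o vv) w = Psi (vv point) + (Psi (vv w) - Psi (vv point)).
    by rewrite addrC subrK.
  rewrite (le_trans (ler_normD _ _)) // lerD2l; apply: lPsi => i.
  by rewrite (le_trans (ler_normB _ _)) // lerD.
pose delta n : R := n.+1%:R^-1.
have d0 n : 0 < delta n by rewrite invr_gt0.
pose cell n := grid_cell (fun i w => vv w (phi i)) K (delta n).
pose rep n j := xget point [set w | cell n w = j].
have repP n w : cell n (rep n (cell n w)) = cell n w.
  by rewrite /rep; case: xgetP => [x _ ->|/(_ w) []].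
pose q n w := \sum_j Psi (vv (rep n j)) * \1_[set w' | cell n w' = j] w.
have qE n w : q n w = Psi (vv (rep n (cell n w))).
  rewrite /q (bigD1 (cell n w)) //= indicE mem_set // mulr1 big1 ?addr0 // => j jw.
  by rewrite indicE memNset ?mulr0 //= => wj; rewrite wj eqxx in jw.
apply: (measurable_fun_cvg (h := q)) => [n|w _].
  have : bounded_measurable (q n).
    apply: bm_sum => j _; apply: bmZ; apply: bm_indic.
    by apply: measurable_grid_cell => // i; have [] := bv i.
  by case.
apply/cvgrPdist_le => eps eps0; near=> n; rewrite qE.
apply: le_trans (lPsi (eps := delta n) _) _ => [i|].
  apply: (grid_cell_close (h := fun i w => vv w (phi i)) (d0 n) hK).
  by rewrite -/(cell n) repP.
by apply: ltW; near: n; exact: (near_infty_natSinv_lt (PosNum eps0)).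
Unshelve. all: by end_near. Qed.

End LipschitzFunctional.

Section Smoothing.
Context (R : realType) (X : Type) (I : finType) (phi : I -> (X -> R)).
Context d (T : measurableType d) (P : probability T R).
Context (Blk : Type) (Y : Blk -> T -> (X -> R) -> R).

Local Notation V := ((X -> R) -> R).
Local Notation E h := (Rintegral P setT h).
Local Notation lip := (lipschitz_on phi).

Hypothesis bY : forall m i, bounded_measurable (fun w => Y m w (phi i)).

Definition shift (v y : V) : V := fun f => v f + y f.

(* The expectation of [Psi (v + Y_s)] when the increments [Y m], [m <- s], are
   replaced by independent ones with the same laws. *)
Fixpoint decoupled (s : seq Blk) (Psi : V -> R) (v : V) : R :=
  if s is m :: s' then E (fun w => decoupled s' Psi (shift v (Y m w))) else Psi v.

Definition psum (s : seq Blk) (w : T) : V := fun f => \sum_(m <- s) Y m w f.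

Lemma lip_average (y : T -> V) (Psi : V -> R) :
  (forall i, bounded_measurable (fun w => y w (phi i))) -> lip Psi ->
  lip (fun v => E (fun w => Psi (shift v (y w)))).
Proof.
move=> by_ lPsi eps v v' vv'.
have bm_shift u : bounded_measurable (Psi \o (fun w => shift u (y w))).
  by apply: (bm_lipschitz lPsi) => i; apply: bmD => //; exact: bm_cst.
rewrite -ExB; [|exact: bm_shift|exact: bm_shift].
apply: Ex_norm_le => [|w]; first by apply: bmB; exact: bm_shift.
by apply: lPsi => i; rewrite /shift opprD addrACA subrr addr0.
Qed.

Lemma lip_decoupled (s : seq Blk) (Psi : V -> R) : lip Psi -> lip (decoupled s Psi).
Proof.
move=> lPsi; elim: s => [//|m s IH] /=.
by apply: lip_average => // i; exact: bY.
Qed.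

Lemma bm_psum s i : bounded_measurable (fun w => psum s w (phi i)).
Proof. by apply: bm_sum. Qed.

(** Starting at the end turns the averaged tail into one deterministic functional of the past plus
    the current block. It stays Lipschitz by [lip_decoupled], so one hypothesis on a single
    replacement serves every step. *)
Lemma telescope (s : seq Blk) (Psi : V -> R) (t : Blk -> \bar R) : lip Psi ->
  (forall m, 0 <= t m)%E ->
  (forall s1 m s2 (Psi' : V -> R), s = s1 ++ m :: s2 -> lip Psi' ->
    ((E (fun w => Psi' (shift (psum s1 w) (Y m w))))%:E <=
     (E (fun w => E (fun w' => Psi' (shift (psum s1 w) (Y m w')))))%:E + t m)%E) ->
  ((E (fun w => Psi (psum s w)))%:E <=
   (decoupled s Psi (fun=> 0))%:E + \sum_(m <- s) t m)%E.
Proof.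
move=> lPsi t0 step.
have H s2 : forall s1, s = s1 ++ s2 -> ((E (fun w => Psi (psum s w)))%:E <=
   (E (fun w => decoupled s2 Psi (psum s1 w)))%:E + \sum_(m <- s2) t m)%E.
  elim: s2 => [|m s2 IH] s1 ss; first by rewrite big_nil adde0 ss cats0.
  have := IH (rcons s1 m); rewrite cat_rcons => /(_ ss) /le_trans; apply.
  rewrite big_cons addeA leeD2r //.
  rewrite (_ : (fun w => decoupled s2 Psi (psum (rcons s1 m) w)) =
      (fun w => decoupled s2 Psi (shift (psum s1 w) (Y m w)))).
    apply: step ss _; exact: lip_decoupled.
  apply/funext => w; congr decoupled; apply/funext => f.
  by rewrite /psum /shift -cats1 big_cat big_seq1.
have := H s [::] erefl; rewrite (_ : (fun w => decoupled s Psi (psum [::] w)) =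
    fun=> decoupled s Psi (fun=> 0)) ?Ex_cst //.
by apply/funext => w; congr decoupled; apply/funext => f; rewrite /psum big_nil.
Qed.

End Smoothing.

Section DecouplingStep.
Context (R : realType) (X : Type) (I : finType) (phi : I -> (X -> R)).
Context d (T : measurableType d) (P : probability T R).
Context (G : set (set T)) (GM : <<s G>> `<=` measurable).
Context d' (X' : measurableType d') (dX : X' -> X' -> \bar R) (xi : T -> X').
Hypothesis mxi : measurable_fun setT xi.

Local Notation V := ((X -> R) -> R).
Local Notation E h := (Rintegral P setT h).
Local Notation lip := (lipschitz_on phi).

Lemma decoupling_step (Psi : V -> R) (past : T -> V) (y : X' -> V) (c : R) :
  lip Psi -> 0 < c -> (forall x x', 0 <= dX x x')%E ->
  (forall i, bounded_measurable (fun w => past w (phi i))) ->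
  (forall i, measurable_fun setT ((fun w => past w (phi i)) : g_sigma_algebraType G -> R)) ->
  (forall i, bounded_measurable (fun x => y x (phi i))) ->
  (forall i x x', (`|y x (phi i) - y x' (phi i)|%:E <= c%:E * dX x x')%E) ->
  ((E (fun w => Psi (shift (past w) (y (xi w)))))%:E <=
     (E (fun w => E (fun w' => Psi (shift (past w) (y (xi w'))))))%:E
       + c%:E * tau P dX <<s G>> xi)%E.
Proof.
move=> lPsi c0 dX0 bpast Gpast by_ lipy.
have byx i : bounded_measurable (fun w => y (xi w) (phi i)).
  exact: (bm_comp mxi (by_ i)).
have [K hK] := common_bound bpast.
set h := fun i w => past w (phi i).
pose avg v := E (fun w' => Psi (shift v (y (xi w')))).
have lavg : lip avg by exact: lip_average.
have b1 : bounded_measurable (fun w => Psi (shift (past w) (y (xi w)))).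
  by apply: (bm_lipschitz lPsi (vv := fun w => shift (past w) (y (xi w)))) => i; apply: bmD.
have b2 : bounded_measurable (fun w => avg (past w)).
  exact: (bm_lipschitz lavg (vv := past)).
(* Rounding is paid twice, by [Psi] and by its average [avg], which is Lipschitz as well; both
   errors vanish with delta. *)
suff key delta : 0 < delta -> ((E (fun w => Psi (shift (past w) (y (xi w)))))%:E <=
     (E (fun w => avg (past w)))%:E + c%:E * tau P dX <<s G>> xi + (delta + delta)%:E)%E.
  apply/lee_addgt0Pr => e e0; have := key (e / 2); rewrite -splitr; apply.
  by rewrite divr_gt0.
move=> d0.
pose cell := grid_cell h K delta.
pose rep j := xget point [set w | cell w = j].
have repP w : cell (rep (cell w)) = cell w.
  by rewrite /rep; case: xgetP => [x _ ->|/(_ w) []].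
have close w i : `|past w (phi i) - past (rep (cell w)) (phi i)| <= delta.
  by apply: (grid_cell_close (h := h) d0 hK); rewrite -/cell repP.
pose g j x := Psi (shift (past (rep j)) (y x)).
have bg j : bounded_measurable (g j).
  apply: (bm_lipschitz lPsi (vv := fun x => shift (past (rep j)) (y x))) => i.
  by apply: bmD => //; exact: bm_cst.
have lipg j x x' : (`|g j x - g j x'|%:E <= c%:E * dX x x')%E.
  case D : (dX x x') => [r| |]; [|by rewrite gt0_muley ?lte_fin // leey|].
    rewrite -EFinM lee_fin; apply: lPsi => i; rewrite /shift opprD addrACA subrr add0r.
    by rewrite -lee_fin EFinM -D.
  by have := dX0 x x'; rewrite D.
have GA j : <<s G>> [set w | cell w = j].
  exact: (@measurable_grid_cell _ (g_sigma_algebraType G) R I h K delta j d0 hK Gpast).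
have Adisj i j w : [set w | cell w = i] w -> [set w | cell w = j] w -> i = j.
  by move=> /= <- <-.
have T1 := tau_ge_scaled P GM mxi c0 GA Adisj bg lipg.
have mA j : measurable [set w | cell w = j] by exact: GM.
pose k j w := \1_[set w | cell w = j] w * (g j (xi w) - E (g j \o xi)).
have bk j : bounded_measurable (k j).
  apply: bmM; first exact: bm_indic.
  by apply: bmB; [exact: (bm_comp mxi (bg j))|exact: bm_cst].
have pw w : Psi (shift (past w) (y (xi w))) <=
    \sum_j k j w + (avg (past w) + (delta + delta)).
  rewrite (bigD1 (cell w)) //= big1 ?addr0; last first.
    by move=> j jw; rewrite /k indicE memNset ?mul0r //= => wj; rewrite wj eqxx in jw.
  rewrite /k indicE mem_set // mul1r.
  have h1 : `|Psi (shift (past w) (y (xi w))) - g (cell w) (xi w)| <= delta.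
    by apply: lPsi => i; rewrite /shift opprD addrACA subrr addr0.
  have h2 : `|avg (past w) - E (g (cell w) \o xi)| <= delta.
    exact: (lavg _ (past w) (past (rep (cell w)))).
  move: h1 h2; rewrite !ler_norml => /andP[_ h1] /andP[h2 _].
  by clear -h1 h2; lra.
apply: le_trans (_ : _ <= (E (fun w => \sum_j k j w + (avg (past w) + (delta + delta))))%:E)%E _.
  rewrite lee_fin; apply: Ex_le => //.
  by apply: bmD; [exact: bm_sum|apply: bmD => //; exact: bm_cst].
rewrite ExD; [|exact: bm_sum|by apply: bmD => //; exact: bm_cst].
rewrite ExD //; last exact: bm_cst.
rewrite Ex_cst Ex_sum // EFinD EFinD addeA leeD2r // addeC.
exact: leeD2l.
Qed.

End DecouplingStep.

(** * Chaining *)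

Section MomentGeneratingFunction.
Context (R : realType).

(** exp x <= 1 / (1 - x), and (1 - x)(1 + x + 2 x^2) = 1 + x^2 (1 - 2 x) is at least 1 for x <=
    1/2. *)
Lemma expR_le_quadratic (x : R) : x <= 1 / 2 -> expR x <= 1 + x + 2 * x ^+ 2.
Proof.
move=> x2; have x1 : 0 < 1 - x by lra.
have : (expR (- x))^-1 <= (1 - x)^-1.
  by rewrite lef_pV2 ?posrE ?expR_gt0 // expR_ge1Dx.
rewrite expRN invrK => /le_trans; apply.
rewrite -[leLHS]mul1r ler_pdivrMr //.
have : 0 <= x ^+ 2 * (1 - 2 * x) by rewrite mulr_ge0 ?sqr_ge0 //; lra.
by clear x2 x1 => h; nra.
Qed.

Lemma mgf_le d (T : measurableType d) (P : probability T R) (Y : T -> R) (K lam v : R) :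
  bounded_measurable Y -> Rintegral P setT Y = 0 -> (forall w, `|Y w| <= K) ->
  0 <= lam -> lam * K <= 1 / 2 -> Rintegral P setT (fun w => Y w ^+ 2) <= v ->
  Rintegral P setT (fun w => expR (lam * Y w)) <= expR (2 * lam ^+ 2 * v).
Proof.
move=> bY EY YK lam0 lamK EY2; apply: le_trans (expR_ge1Dx _).
have b2 : bounded_measurable (fun w => Y w ^+ 2) by exact: bmM.
apply: le_trans (_ : _ <= Rintegral P setT (fun w =>
    1 + lam * Y w + 2 * lam ^+ 2 * Y w ^+ 2)) _.
  apply: Ex_le.
  - by apply: bm_expR; exact: bmZ.
  - by apply: bmD; [apply: bmD; [exact: bm_cst|exact: bmZ]|exact: bmZ].
  - move=> w; rewrite -mulrA -exprMn; apply: expR_le_quadratic.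
    apply: le_trans lamK; apply: ler_wpM2l => //; exact: le_trans (ler_norm _) (YK w).
rewrite ExD; [|by apply: bmD; [exact: bm_cst|exact: bmZ]|exact: bmZ].
rewrite ExD; [|exact: bm_cst|exact: bmZ].
rewrite !ExZ // Ex_cst EY mulr0 addr0 lerD2l.
by apply: ler_wpM2l => //; rewrite mulr_ge0 // sqr_ge0.
Qed.

End MomentGeneratingFunction.

Section ExponentialDomination.
Context (R : realType) (X : Type) (I : finType) (phi : I -> (X -> R)).
Context d (T : measurableType d) (P : probability T R).
Context (Blk : eqType) (Y : Blk -> T -> (X -> R) -> R) (s : seq Blk).

Local Notation V := ((X -> R) -> R).
Local Notation E h := (Rintegral P setT h).

Context (U : finType) (f f' : U -> (X -> R)) (lam wt : U -> R) (mg : U -> Blk -> R).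
Context (Psi : V -> R) (A B : R).
Hypotheses (bphi : forall m i, bounded_measurable (fun w => Y m w (phi i)))
  (bf : forall m u, bounded_measurable (fun w => Y m w (f u)))
  (bf' : forall m u, bounded_measurable (fun w => Y m w (f' u)))
  (Y0 : forall m w, Y m w (fun=> 0) = 0) (wt0 : forall u, 0 <= wt u) (A0 : 0 <= A)
  (mgP : forall u m, m \in s -> E (fun w => expR (lam u * (Y m w (f u) - Y m w (f' u)))) <= mg u m)
  (lPsi : lipschitz_on phi Psi)
  (dom : forall v, v (fun=> 0) = 0 ->
    Psi v <= A * \sum_u wt u * expR (lam u * (v (f u) - v (f' u))) + B).

Lemma decoupled_dom : decoupled P Y s Psi (fun=> 0) <=
  A * \sum_u wt u * \prod_(m <- s) mg u m + B.
Proof.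
(* The starting point v is general because each averaging shifts it; v(0) = 0 persists because every
   [Y m w] vanishes at the zero function. *)
have gen t : {subset t <= s} -> forall v, v (fun=> 0) = 0 -> decoupled P Y t Psi v <=
  A * \sum_u wt u * (expR (lam u * (v (f u) - v (f' u))) * \prod_(m <- t) mg u m) + B.
  elim: t => [|m t IH] ts v v0 /=.
    apply: le_trans (dom v0) _; under [X in _ <= _ * X + _]eq_bigr do rewrite big_nil mulr1.
    exact: lexx.
  have ms : m \in s by apply: ts; rewrite mem_head.
  have {}IH := IH (fun x xt => ts x (mem_behead (s := m :: t) xt)).
  pose ev u w := expR (lam u * (Y m w (f u) - Y m w (f' u))).
  have bev u : bounded_measurable (ev u).
    by apply: bm_expR; apply: bmZ; apply: bmB.
  pose k u := wt u * (expR (lam u * (v (f u) - v (f' u))) * \prod_(m <- t) mg u m).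
  apply: le_trans (_ : _ <= E (fun w => A * \sum_u k u * ev u w + B)) _.
    apply: Ex_le.
    - have ld := lip_decoupled P bphi t lPsi.
      apply: (bm_lipschitz ld (vv := fun w => shift v (Y m w))) => i.
      by apply: bmD => //; exact: bm_cst.
    - apply: bmD; last exact: bm_cst.
      by apply: bmZ; apply: bm_sum => u _; exact: bmZ.
    - move=> w; apply: le_trans (IH (shift v (Y m w)) _) _; first by rewrite /shift v0 Y0 addr0.
      rewrite lerD2r ler_wpM2l // le_eqVlt; apply/orP; left; apply/eqP.
      apply: eq_bigr => u _; rewrite /k /ev /shift.
      have -> : expR (lam u * (v (f u) + Y m w (f u) - (v (f' u) + Y m w (f' u)))) =
          expR (lam u * (v (f u) - v (f' u))) * expR (lam u * (Y m w (f u) - Y m w (f' u))).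
        by rewrite -expRD; congr expR; ring.
      by ring.
  have bk u : bounded_measurable (fun w => k u * ev u w) by exact: bmZ.
  rewrite ExD; [|by apply: bmZ; apply: bm_sum|exact: bm_cst].
  rewrite Ex_cst ExZ; last by apply: bm_sum.
  rewrite Ex_sum // lerD2r ler_wpM2l //; apply: ler_sum => u _.
  rewrite ExZ // /k big_cons -!mulrA; apply: ler_wpM2l => //.
  apply: ler_wpM2l; first exact: expR_ge0.
  rewrite mulrC; apply: ler_wpM2r; last exact: mgP.
  rewrite big_seq; apply: prodr_ge0 => m' m't.
  apply: le_trans (mgP u (ts _ _)); last by rewrite inE m't orbT.
  by apply: Ex_ge0 => w; exact: expR_ge0.
have := gen s (fun _ => id) (fun=> 0) erefl.
by under eq_bigr do rewrite subrr mulr0 expR0 mul1r.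
Qed.

End ExponentialDomination.

Section PowersOfTwo.
Context (R : realType).

Definition half_pow (l : nat) : R := 2 `^ (l%:R / 2).

Lemma half_pow_gt0 l : 0 < half_pow l. Proof. by rewrite powR_gt0. Qed.

Lemma half_pow_sqr l : half_pow l ^+ 2 = 2 ^+ l.
Proof.
by rewrite -powR_mulrn ?powR_ge0 // -powRrM divfK // powR_mulrn.
Qed.

Lemma half_powS l : half_pow l.+1 <= 3 / 2 * half_pow l.
Proof.
rewrite -(@ler_pXn2r _ 2) ?nnegrE ?mulr_ge0 ?(ltW (half_pow_gt0 _)) //.
rewrite exprMn !half_pow_sqr exprS ler_wpM2r ?exprn_ge0 //.
by rewrite expr2; lra.
Qed.

(** The first factor counts links, and 3 = 4 - 1 is what a weight e^(-4 * 2^l) leaves after a moment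
    generating function e^(2^l). It works because 4 e^-3 <= 1/2. *)
Lemma expR_4pow (l : nat) : (4 ^ (2 ^ l))%:R * expR (- (3 * 2 ^+ l)) <= (1 / 2 : R) ^+ l.
Proof.
have e2 : 2 <= expR 1 :> R by apply: le_trans (expR_ge1Dx 1); lra.
have -> : - (3 * 2 ^+ l) = (2 ^ l)%:R * (- 3) :> R by rewrite natrX; ring.
rewrite expRM_natl natrX -exprMn.
have h : 4%:R * expR (- 3) <= 1 / 2 :> R.
  have -> : expR (- 3) = (expR 1 ^- 3 : R).
    by rewrite expRN -expRM_natl mulr1.
  rewrite ler_pdivrMr ?exprn_gt0 ?expR_gt0 //.
  have : (2 : R) ^+ 3 <= expR 1 ^+ 3 by rewrite ler_pXn2r ?nnegrE ?expR_ge0.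
  rewrite -natrX; lra.
have h0 : 0 <= 4%:R * expR (- 3) :> R by rewrite mulr_ge0 ?expR_ge0.
apply: le_trans (_ : _ <= (1 / 2 : R) ^+ (2 ^ l)) _.
  by rewrite ler_pXn2r ?nnegrE ?expn_gt0 //.
by apply: ler_wiXn2l; [lra|lra|exact: ltnW (ltn_expl _ _)].
Qed.

Lemma sum_half_pow L : \sum_(l < L) (1 / 2 : R) ^+ l.+1 <= 1.
Proof.
suff -> : \sum_(l < L) (1 / 2 : R) ^+ l.+1 = 1 - (1 / 2) ^+ L.
  by rewrite lerBlDr lerDl exprn_ge0.
elim: L => [|L IH]; first by rewrite big_ord0 expr0 subrr.
by rewrite big_ord_recr /= IH exprS; field.
Qed.

End PowersOfTwo.

Lemma max_dist_le (R : realType) (eps p q x y : R) :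
  `|p - q| <= eps -> `|x - y| <= eps -> `|Num.max p x - Num.max q y| <= eps.
Proof.
rewrite !ler_norml => /andP[h1 h2] /andP[h3 h4].
by case: (leP p x); case: (leP q y) => ? ?; apply/andP; split; lra.
Qed.

Section Chaining.
Context (R : realType) (X : Type).
Context d (T : measurableType d) (P : probability T R).
Context (Blk : eqType) (Y : Blk -> T -> (X -> R) -> R) (s : seq Blk).
Context (F : set (X -> R)) (code : nat -> (X -> R) -> nat).

Local Notation V := ((X -> R) -> R).
Local Notation E h := (Rintegral P setT h).

Definition rep (l k : nat) : X -> R := xget (fun=> 0) [set f | F f /\ code l f = k].

(** The chain starts at the zero function, where the processes vanish, so that a value at the end of
    the chain telescopes into links. The default of [rep] is again 0, hence every projection lies in
    [F]. *)
Definition chain_proj (l : nat) (f : X -> R) : X -> R :=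
  if l is 0%N then fun=> 0 else rep l (code l f).

Hypotheses (F0 : F (fun=> 0))
  (code_lt : forall l f, F f -> (code l f < 4 ^ (2 ^ l))%N)
  (code_mono : forall l f g, F f -> F g -> code l.+1 f = code l.+1 g -> code l f = code l g).

Lemma rep_in l k : F (rep l k).
Proof. by rewrite /rep; case: xgetP => [f _ []|]. Qed.

Lemma code_rep l f : F f -> code l (rep l (code l f)) = code l f.
Proof. by move=> Ff; rewrite /rep; case: xgetP => [g _ []|/(_ f)[]]. Qed.

Lemma proj_in l f : F (chain_proj l f).
Proof. by case: l => [|l] //=; exact: rep_in. Qed.

Lemma proj_code l f g : code l f = code l g -> chain_proj l f = chain_proj l g.
Proof. by case: l => [//|l] /= ->. Qed.

Context (D1 D2 : nat -> (X -> R) -> R) (L : nat) (sigma b G1 G2 : R) (var : Blk -> R).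
Hypotheses (sigma0 : 0 <= sigma) (b0 : 0 < b)
  (D1_gt0 : forall l f, F f -> 0 < D1 l f) (D2_gt0 : forall l f, F f -> 0 < D2 l f)
  (D1_code : forall l f g, F f -> F g -> code l f = code l g -> D1 l f = D1 l g)
  (D2_code : forall l f g, F f -> F g -> code l f = code l g -> D2 l f = D2 l g)
  (sumD1 : forall f, F f -> \sum_(l < L) 2 ^+ l * D1 l f <= G1)
  (sumD2 : forall f, F f -> \sum_(l < L) half_pow R l * D2 l f <= G2)
  (Y0 : forall m w, Y m w (fun=> 0) = 0)
  (bY : forall m f, F f -> bounded_measurable (fun w => Y m w f))
  (EY : forall m f, F f -> E (fun w => Y m w f) = 0)
  (link1 : forall m l f w, m \in s -> F f ->
     `|Y m w (chain_proj l.+1 f) - Y m w (chain_proj l f)| <= 2 * b * D1 l f)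
  (link2 : forall m l f, m \in s -> F f ->
     E (fun w => (Y m w (chain_proj l.+1 f) - Y m w (chain_proj l f)) ^+ 2) <= var m * D2 l f ^+ 2)
  (var_le : \sum_(m <- s) var m <= 14 * sigma ^+ 2).

(* The inverse of the exponent lam used for a link out of level l.  The second
   term makes lam times the link at most 1/2, the first one makes the logarithm
   of its moment generating function at most 2 ^ (l + 1). *)
Let scale (l : nat) f : R := 6 * sigma * D2 l f / half_pow R l.+1 + 4 * b * D1 l f.

Let scale_gt0 l f : F f -> 0 < scale l f.
Proof.
move=> Ff; apply: ltr_wpDl; last by rewrite !mulr_gt0 // D1_gt0.
by rewrite divr_ge0 ?(ltW (half_pow_gt0 _ _)) // !mulr_ge0 // ltW // D2_gt0.
Qed.

Let NL := (4 ^ (2 ^ L))%N.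
Definition last_level (i : 'I_NL) : X -> R := chain_proj L (rep L i).

Definition chain_max (v : V) : R := \big[Num.max/0]_(i < NL) v (last_level i).

Lemma chain_max_ge v f : F f -> v (chain_proj L f) <= chain_max v.
Proof.
move=> Ff; pose i : 'I_NL := Ordinal (code_lt L Ff).
have -> : chain_proj L f = last_level i by apply: proj_code; rewrite code_rep.
by rewrite /chain_max (bigD1 i) //= le_max lexx.
Qed.

Lemma lip_chain_max : lipschitz_on last_level chain_max.
Proof.
(* The sign of eps is recovered from one coordinate; [NL] is positive. *)
move=> eps v v' vv'; have eps0 : 0 <= eps.
  have i : 'I_NL by apply: (@Ordinal _ 0%N); rewrite expn_gt0.
  by apply: le_trans (vv' i).
rewrite /chain_max; elim/big_rec2 : _ => [|i x y _ xy]; first by rewrite subrr normr0.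
exact: max_dist_le.
Qed.

Let U := ('I_L * 'I_NL)%type.
Let lk (u : U) : X -> R := rep u.1.+1 u.2.
Let lam (u : U) : R := (scale u.1 (lk u))^-1.
(** [U] is a rectangle with [NL] codes at every level. Codes that are too large to occur at level l
    + 1 get weight 0, so that they do not enter the union bound. *)
Let wt (u : U) : R := if (u.2 < 4 ^ (2 ^ u.1.+1))%N then expR (- (4 * 2 ^+ u.1.+1)) else 0.
Let up (u : U) := chain_proj u.1.+1 (lk u).
Let dn (u : U) := chain_proj u.1 (lk u).

Let wt_ge0 u : 0 <= wt u. Proof. by rewrite /wt; case: ifP => _ //; exact: expR_ge0. Qed.

(** Apply 1 + y <= e^y to y = lam x - 4 * 2^(l + 1), where x is the link: lam x is at most S + 4 *
    2^(l + 1), with the same S for all links. Dividing by lam gives 9 = 6 * 3/2, by [half_powS], and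
    8 = 4 * 2. *)
Lemma link_dom (v : V) l f : F f -> (l < L)%N ->
  v (chain_proj l.+1 f) - v (chain_proj l f) <= (\sum_u wt u * expR (lam u * (v (up u) - v (dn u))) + 4) *
    (9 * sigma * (half_pow R l * D2 l f) + 8 * b * (2 ^+ l * D1 l f)).
Proof.
move=> Ff lL; set S := \sum_u _.
have kL : (code l.+1 f < NL)%N.
  apply: leq_trans (code_lt l.+1 Ff) _; apply: leq_pexp2l => //; exact: leq_pexp2l.
pose u : U := (Ordinal lL, Ordinal kL).
have Fk := rep_in l.+1 (code l.+1 f).
have ck : code l.+1 (lk u) = code l.+1 f by exact: code_rep.
(* Codes at level l + 1 determine those at level l, so a link depends on f only through its upper
   code, and finitely many links occur. *)
have ck' : code l (lk u) = code l f by exact: code_mono.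
have -> : chain_proj l.+1 f = up u by apply/esym/proj_code.
have -> : chain_proj l f = dn u by apply/esym/proj_code.
rewrite -(D1_code (l := l) Fk Ff ck') -(D2_code (l := l) Fk Ff ck') -/(lk u).
set x := v (up u) - v (dn u).
have sc0 : 0 < scale l (lk u) by exact: scale_gt0.
have term : wt u * expR (lam u * x) <= S.
  rewrite /S (bigD1 u) //= lerDl sumr_ge0 // => u' _.
  by rewrite mulr_ge0 // expR_ge0.
have S0 : 0 <= S.
  by rewrite /S sumr_ge0 // => u' _; rewrite mulr_ge0 // expR_ge0.
have xS : lam u * x <= S + 4 * 2 ^+ l.+1.
  have wu : wt u = expR (- (4 * 2 ^+ l.+1)) by rewrite /wt /= code_lt.
  have := expR_ge1Dx (- (4 * 2 ^+ l.+1) + lam u * x).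
  rewrite expRD -wu => /le_trans -/(_ _ term) h.
  by rewrite -lerBlDr; apply: le_trans h; rewrite [leLHS]addrC lerDr.
have p1 : 1 <= 2 ^+ l.+1 :> R by apply: exprn_ege1; rewrite ler1n.
have -> : x = (lam u * x) * scale l (lk u) by rewrite /lam mulrAC mulVf ?mul1r // gt_eqF.
apply: le_trans (ler_wpM2r (ltW sc0) xS) _.
apply: le_trans (_ : _ <= (S + 4) * 2 ^+ l.+1 * scale l (lk u)) _.
  rewrite ler_wpM2r ?(ltW sc0) // (mulrDl S) lerD2r; exact: ler_peMr.
rewrite -mulrA ler_wpM2l ?addr_ge0 // /scale mulrDr.
have d20 := ltW (D2_gt0 l Fk); have d10 := ltW (D1_gt0 l Fk).
have hl := half_pow_gt0 R l.+1.
have -> : 2 ^+ l.+1 * (6 * sigma * D2 l (lk u) / half_pow R l.+1) =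
    6 * sigma * D2 l (lk u) * half_pow R l.+1.
  by rewrite -half_pow_sqr; field; rewrite gt_eqF.
apply: lerD; last by rewrite exprS le_eqVlt; apply/orP; left; apply/eqP; ring.
apply: le_trans (_ : _ <= 6 * sigma * D2 l (lk u) * (3 / 2 * half_pow R l)) _.
  apply: ler_wpM2l; last exact: half_powS.
  by rewrite !mulr_ge0 // ltW.
by rewrite le_eqVlt; apply/orP; left; apply/eqP; field.
Qed.

Lemma G1_ge0 : 0 <= G1.
Proof.
apply: le_trans (sumD1 F0); apply: sumr_ge0 => l _.
by rewrite mulr_ge0 ?exprn_ge0 // ltW // D1_gt0.
Qed.

Lemma G2_ge0 : 0 <= G2.
Proof.
apply: le_trans (sumD2 F0); apply: sumr_ge0 => l _.
by rewrite mulr_ge0 ?(ltW (half_pow_gt0 _ _)) // ltW // D2_gt0.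
Qed.

Let A : R := 9 * sigma * G2 + 8 * b * G1.

Let A_ge0 : 0 <= A.
Proof. by rewrite addr_ge0 // !mulr_ge0 ?G1_ge0 ?G2_ge0 ?(ltW b0). Qed.

Lemma chain_max_dom (v : V) : v (fun=> 0) = 0 ->
  chain_max v <= A * \sum_u wt u * expR (lam u * (v (up u) - v (dn u))) + 4 * A.
Proof.
move=> v0; set S := \sum_u _.
have S0 : 0 <= S.
  by rewrite /S sumr_ge0 // => u' _; rewrite mulr_ge0 // expR_ge0.
have -> : A * S + 4 * A = (S + 4) * A by ring.
rewrite /chain_max; elim/big_ind : _ => [|x y hx hy|i _].
- by rewrite mulr_ge0 // addr_ge0.
- by case: (leP x y).
have Ff := rep_in L i; set f := rep L i in Ff *.
have -> : v (last_level i) = \sum_(l < L) (v (chain_proj l.+1 f) - v (chain_proj l f)).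
  rewrite -(big_mkord xpredT (fun l => v (chain_proj l.+1 f) - v (chain_proj l f))).
  by rewrite telescope_sumr //= v0 subr0.
apply: le_trans (_ : _ <= \sum_(l < L) (S + 4) *
   (9 * sigma * (half_pow R l * D2 l f) + 8 * b * (2 ^+ l * D1 l f))) _.
  by apply: ler_sum => l _; exact: link_dom.
rewrite -mulr_sumr ler_wpM2l ?addr_ge0 // big_split /= -!mulr_sumr.
by apply: lerD; rewrite ler_wpM2l ?sumD1 ?sumD2 // !mulr_ge0 // ?ltW.
Qed.

Lemma decoupled_chain_max : decoupled P Y s chain_max (fun=> 0) <= 45 * sigma * G2 + 40 * b * G1.
Proof.
have Fu u : F (lk u) := rep_in _ _.
pose mg (u : U) (m : Blk) : R := expR (2 * lam u ^+ 2 * (var m * D2 u.1 (lk u) ^+ 2)).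
have lam0 u : 0 <= lam u by rewrite invr_ge0 ltW // scale_gt0.
have mgP u m : m \in s -> E (fun w => expR (lam u * (Y m w (up u) - Y m w (dn u)))) <= mg u m.
  move=> ms; apply: (@mgf_le _ _ _ P _ (2 * b * D1 u.1 (lk u))) => //.
  - by apply: bmB; apply: bY; exact: proj_in.
  - by rewrite ExB ?EY ?subrr //; try (by apply: bY; exact: proj_in); exact: proj_in.
  - by move=> w; exact: link1.
  - rewrite /lam mulrC ler_pdivrMr ?scale_gt0 // /scale.
    have : 0 <= 6 * sigma * D2 u.1 (lk u) / half_pow R u.1.+1.
      by rewrite divr_ge0 ?(ltW (half_pow_gt0 _ _)) // !mulr_ge0 // ltW // D2_gt0.
    move: (_ / half_pow R _) => p p0.
    rewrite [leRHS](_ : _ = 1 / 2 * p + 2 * b * D1 u.1 (lk u)); last by field.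
    by rewrite lerDr mulr_ge0.
  - exact: link2.
apply: le_trans (decoupled_dom (phi := last_level) (f := up) (f' := dn) (lam := lam) (wt := wt)
  (mg := mg) (A := A) (B := 4 * A) _ _ _ _ _ _ mgP lip_chain_max chain_max_dom) _ => //.
- by move=> m i; apply: bY; exact: proj_in.
- by move=> m i; apply: bY; exact: proj_in.
- by move=> m i; apply: bY; exact: proj_in.
(* Since 2 * 14 <= 6^2, the moment generating functions multiply to at most e^(2^(l + 1)). Against
   the weights, the links of a level then contribute at most 2^-(l + 1). *)
have Sle : \sum_u wt u * \prod_(m <- s) mg u m <= 1.
  apply: le_trans (_ : _ <= \sum_(u : U) wt u * expR (2 ^+ u.1.+1)) _.
    apply: ler_sum => u _; apply: ler_wpM2l => //.
    rewrite /mg -expR_sum ler_expR -mulr_sumr -mulr_suml.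
    have d2 := D2_gt0 u.1 (Fu u); have hp := half_pow_gt0 R u.1.+1.
    have sD : 0 <= 6 * sigma * D2 u.1 (lk u) by rewrite !mulr_ge0 // ltW.
    have lamle : lam u * (6 * sigma * D2 u.1 (lk u)) <= half_pow R u.1.+1.
      rewrite /lam mulrC ler_pdivrMr ?scale_gt0 // /scale.
      rewrite [leRHS](_ : _ = 6 * sigma * D2 u.1 (lk u) +
        half_pow R u.1.+1 * (4 * b * D1 u.1 (lk u))); last by field; rewrite gt_eqF.
      by rewrite lerDl !mulr_ge0 ?(ltW hp) ?(ltW b0) // ltW // D1_gt0.
    have lam2 : (lam u * (6 * sigma * D2 u.1 (lk u))) ^+ 2 <= 2 ^+ u.1.+1.
      by rewrite -half_pow_sqr ler_pXn2r ?nnegrE ?(ltW hp) // mulr_ge0.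
    apply: le_trans lam2.
    apply: le_trans (_ : _ <= 2 * lam u ^+ 2 * (14 * sigma ^+ 2 * D2 u.1 (lk u) ^+ 2)) _.
      apply: ler_wpM2l; first by rewrite mulr_ge0 // sqr_ge0.
      by apply: ler_wpM2r => //; exact: sqr_ge0.
    have : 0 <= (lam u * sigma * D2 u.1 (lk u)) ^+ 2 by exact: sqr_ge0.
    rewrite !exprMn; move: (lam u ^+ 2) (sigma ^+ 2) (D2 _ _ ^+ 2) => x y z xyz.
    rewrite [leLHS](_ : _ = 28 * (x * y * z)); last by ring.
    rewrite [leRHS](_ : _ = 36 * (x * y * z)); last by ring.
    by rewrite ler_wpM2r // ler_nat.
  rewrite -(pair_bigA _ (fun (l : 'I_L) (k : 'I_NL) => wt (l, k) * expR (2 ^+ l.+1))) /=.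
  apply: le_trans (sum_half_pow R L); apply: ler_sum => l _.
  apply: le_trans (expR_4pow R l.+1).
  have -> : - (3 * 2 ^+ l.+1) = - (4 * 2 ^+ l.+1) + 2 ^+ l.+1 :> R by ring.
  rewrite expRD mulrA -mulr_suml ler_wpM2r ?expR_ge0 //.
  rewrite /wt /= -big_mkcond /= sumr_const -[leLHS]mulr_natl ler_wpM2r ?expR_ge0 // ler_nat.
  rewrite -[leqRHS](card_ord (4 ^ 2 ^ l.+1)).
  have inj : injective (fun k : {k : 'I_NL | (k < 4 ^ 2 ^ l.+1)%N} => Ordinal (valP k)).
    by move=> k k' [] /ord_inj /val_inj.
  by rewrite -card_sig; exact: leq_card inj.
have -> : 45 * sigma * G2 + 40 * b * G1 = A * 1 + 4 * A by rewrite /A; ring.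
by rewrite lerD2r ler_wpM2l.
Qed.

End Chaining.

(** * Numbering the cells of admissible sequences *)

Section AdmissibleCodes.
Context (R : realType) (X : Type) (F : set (X -> R)).

Lemma cell_eq (T : set (set (X -> R))) (A : set (X -> R)) f :
  partition T id F -> T A -> A f -> cell T f = A.
Proof.
move=> [_ tT _] TA Af; rewrite /cell; apply/seteqP; split => [g [B [TB Bf] Bg]|g Ag].
  by rewrite -(tT B A TB TA) //; exists f.
by exists A.
Qed.

Lemma partition_block (T : set (set (X -> R))) f :
  partition T id F -> F f -> T (cell T f) /\ cell T f f.
Proof.
move=> pT Ff; have [cT _ _] := pT.
have : cover T id f by rewrite cT.
by move=> [A TA Af]; rewrite (cell_eq pT TA Af).
Qed.

(** An order s >= 1 gives at most 2^(2^l) cells at level l, which removes s from all later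
    estimates. Numbering the cells turns refinement into an implication between equalities of
    codes. *)
Lemma admissible_codes (s : R) (T : nat -> set (set (X -> R))) : 1 <= s -> F !=set0 ->
  admissible s F T -> exists code : nat -> (X -> R) -> nat,
  [/\ forall l f, F f -> (code l f < 2 ^ (2 ^ l))%N,
      forall l f g, F f -> F g -> code l f = code l g -> cell (T l) f = cell (T l) g,
      forall l f g, F f -> F g -> code l.+1 f = code l.+1 g -> code l f = code l g
    & forall f g, F f -> F g -> code 0%N f = code 0%N g].
Proof.
move=> s1 Fne [pT refine c0 cl].
have card_le l : exists2 k : nat, (T l #= `I_k)%card & (k <= 2 ^ (2 ^ l))%N /\ (l = 0%N -> k = 1%N).
  case: l => [|l]; first by exists 1%N.
  have [k Tk kle] := cl l.+1 isT; exists k => //; split => //.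
  rewrite -(ler_nat R); apply: le_trans kle _.
  rewrite natrX -powR_mulrn // ler_powR ?ler1n // natrX -powR_mulrn // ler_powR ?ler1n //.
  rewrite ler_pdivrMr ?(lt_le_trans _ s1) // ler_peMr //.
have [k /all_and2[Tk /all_and2[klt k0]]] : {k : nat -> nat & forall l,
    (T l #= `I_(k l))%card /\ (k l <= 2 ^ (2 ^ l))%N /\ (l = 0%N -> k l = 1%N)}.
  apply: (@choice _ _ (fun l k => (T l #= `I_k)%card /\ (k <= 2 ^ (2 ^ l))%N /\ (l = 0%N -> k = 1%N))).
  by move=> l; have [k] := card_le l; exists k.
have [b bP] : {b : nat -> set (X -> R) -> nat & forall l, set_bij (T l) `I_(k l) (b l)}.
  apply: (@choice _ _ (fun l b => set_bij (T l) `I_(k l) b)) => l.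
  by have /card_set_bijP := Tk l.
have blk l f : F f -> T l (cell (T l) f) /\ cell (T l) f f.
  by move=> Ff; exact: partition_block.
pose code l f := b l (cell (T l) f).
have code_lt l f : F f -> (code l f < k l)%N.
  move=> Ff; have [+ _ _] := bP l; move=> H.
  by have [TA _] := blk l f Ff; exact: (H _ TA).
have code_cell l f g : F f -> F g -> code l f = code l g -> cell (T l) f = cell (T l) g.
  move=> Ff Fg; have [_ + _] := bP l; apply; rewrite inE; by [exact: (blk l f Ff).1|exact: (blk l g Fg).1].
exists code; split => //.
- by move=> l f Ff; apply: leq_trans (klt l); exact: code_lt.
- move=> l f g Ff Fg fg; rewrite /code; congr b.
  have [TA Af] := blk l.+1 f Ff; have [A TlA sub] := refine l _ TA.
  rewrite (cell_eq (pT l) TlA (sub _ Af)) (cell_eq (pT l) TlA) //; apply: sub.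
  by rewrite (code_cell _ _ _ Ff Fg fg); have [] := blk l.+1 g Fg.
- move=> f g Ff Fg; have := code_lt 0%N f Ff; have := code_lt 0%N g Fg.
  by rewrite k0 // !ltnS !leqn0 => /eqP -> /eqP ->.
Qed.

(** The pair of codes is read as a two-digit number in base 2^(2^l); this numbers the cells of a
    common refinement. *)
Lemma pair_code_lt (l k1 k2 : nat) : (k1 < 2 ^ (2 ^ l))%N -> (k2 < 2 ^ (2 ^ l))%N ->
  (k1 + 2 ^ (2 ^ l) * k2 < 4 ^ (2 ^ l))%N.
Proof.
move=> h1 h2; rewrite (expnMn 2 2 (2 ^ l)).
apply: leq_trans (_ : _ <= 2 ^ 2 ^ l + 2 ^ 2 ^ l * k2)%N _; first by rewrite ltn_add2r.
by rewrite -mulnS leq_mul2l h2 orbT.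
Qed.

Lemma pair_code_inj (K k1 k2 k1' k2' : nat) : (k1 < K)%N -> (k1' < K)%N ->
  (k1 + K * k2 = k1' + K * k2')%N -> k1 = k1' /\ k2 = k2'.
Proof.
move=> h h' e; have K0 : (0 < K)%N by exact: leq_ltn_trans h.
split.
  by have := congr1 (modn ^~ K) e; rewrite /= ![(_ + K * _)%N]addnC ![(K * _)%N]mulnC !modnMDl !modn_small.
have := congr1 (divn ^~ K) e.
by rewrite /= ![(_ + K * _)%N]addnC ![(K * _)%N]mulnC !divnMDl // !divn_small // !addn0.
Qed.

End AdmissibleCodes.

Section NormMonotonicity.
Context d (T : measurableType d) (R : realType) (mu : {measure set T -> \bar R}).
Import HBNNSimple.

(* Suprema over F are not known to be measurable; the integral of a nonnegative
   function is a supremum over the simple functions below it, hence monotone. *)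
Lemma ge0_le_integral_nonmeas (h g : T -> \bar R) : (forall x, 0 <= h x)%E ->
  (forall x, h x <= g x)%E -> (\int[mu]_x h x <= \int[mu]_x g x)%E.
Proof.
move=> h0 hg; have g0 x : (0 <= g x)%E by exact: le_trans (hg x).
rewrite !ge0_integralTE //; apply: ereal_sup_le => _ [k kh <-]; exists k => // x.
exact: le_trans (kh x) (hg x).
Qed.

Lemma Lnorm_mono (p : \bar R) (h g : T -> \bar R) : (0 < p)%E ->
  (forall x, `|h x| <= `|g x|)%E -> ('N[mu]_p[h] <= 'N[mu]_p[g])%E.
Proof.
move=> p0 hg; rewrite unlock; case: p p0 => [p| |] // p0.
- rewrite lte_fin in p0.
  apply: gt0_ler_poweR; first by rewrite invr_ge0 ltW.
  + by rewrite inE /= subitvE !bnd_simp leey andbT integral_ge0 // => x _; exact: poweR_ge0.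
  + by rewrite inE /= subitvE !bnd_simp leey andbT integral_ge0 // => x _; exact: poweR_ge0.
  apply: ge0_le_integral_nonmeas => x; first exact: poweR_ge0.
  by apply: gt0_ler_poweR => //; rewrite ?inE /= ?subitvE ?bnd_simp ?leey ?abse_ge0 // ltW.
- case: ifPn => // _; apply: le_ess_sup; exact: nearW.
Qed.

End NormMonotonicity.

Section LevelBounds.
Context (R : realType) (X : pointedType) (F : set (X -> R)).
Implicit Types (f g : X -> R) (T : nat -> set (set (X -> R))).

Lemma cell_diam_ge (T : set (set (X -> R))) f f1 f2 z :
  cell T f f1 -> cell T f f2 -> (`|f1 z - f2 z|%:E <= cell_diam T f z)%E.
Proof. by move=> c1 c2; apply: ereal_sup_ubound; exists f1 => //; exists f2. Qed.

Lemma sup_norm_ge (h : X -> \bar R) z : (`|h z| <= sup_norm h)%E.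
Proof. by apply: ereal_sup_ubound; exists z. Qed.

Lemma sup_norm_ge0 (h : X -> \bar R) : (0 <= sup_norm h)%E.
Proof. by apply: le_trans (sup_norm_ge h point). Qed.

(* The slack G - x makes the majorants of the level diameters positive. *)
Lemma level_bounds (q : R) T (dd : (X -> \bar R) -> \bar R) (G : R) (L : nat) : F !=set0 ->
  (forall h, 0 <= dd h)%E ->
  (ereal_sup [set (\sum_(0 <= l <oo) (2%R `^ (l%:R / q))%:E * dd (cell_diam (T l) f))%E | f in F]
    < G%:E)%E ->
  exists D : nat -> (X -> R) -> R,
  [/\ forall l f, F f -> 0 < D l f,
      forall l f, F f -> (dd (cell_diam (T l) f) <= (D l f)%:E)%E,
      forall l f g, cell (T l) f = cell (T l) g -> D l f = D l g
    & forall f, F f -> \sum_(l < L) 2 `^ (l%:R / q) * D l f <= G].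
Proof.
move=> [f0 Ff0] dd0; set x := ereal_sup _ => xG.
pose wt (l : nat) : R := 2 `^ (l%:R / q).
have wt0 l : 0 < wt l by rewrite powR_gt0.
have term0 l f : (0 <= (wt l)%:E * dd (cell_diam (T l) f))%E.
  by rewrite mule_ge0 ?lee_fin ?(ltW (wt0 l)).
have le_x f n : F f -> (\sum_(0 <= l < n) (wt l)%:E * dd (cell_diam (T l) f) <= x)%E.
  move=> Ff; apply: le_trans (_ : _ <= \sum_(0 <= l <oo) (wt l)%:E * dd (cell_diam (T l) f))%E _.
    exact: nneseries_lim_ge.
  by apply: ereal_sup_ubound; exists f.
have x0 : (0 <= x)%E by have := le_x f0 0%N Ff0; rewrite big_nil.
have xfin : x \is a fin_num by rewrite ge0_fin_numE // (lt_trans xG) ?ltry.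
have ddfin l f : F f -> dd (cell_diam (T l) f) \is a fin_num.
  move=> Ff; rewrite ge0_fin_numE //.
  have : ((wt l)%:E * dd (cell_diam (T l) f) < +oo)%E.
    apply: le_lt_trans (_ : _ <= x)%E _; last by rewrite (lt_trans xG) ?ltry.
    apply: le_trans (le_x f l.+1 Ff); rewrite big_nat_recr //= leeDr //.
    by apply: sume_ge0 => *; exact: term0.
  case: (dd _) (dd0 (cell_diam (T l) f)) => [r| |] //; first by move=> *; exact: ltry.
  by rewrite gt0_muley ?lte_fin.
(* The slack is shared equally among the weighted terms; L + 1 in place of L avoids a division by
   0. *)
pose eta := (G - fine x) / L.+1%:R.
have eta0 : 0 < eta by rewrite divr_gt0 // subr_gt0 -lte_fin fineK.
exists (fun l f => fine (dd (cell_diam (T l) f)) + eta / wt l); split.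
- by move=> l f Ff; rewrite ltr_wpDl ?fine_ge0 // divr_gt0.
- move=> l f Ff; rewrite -{1}(fineK (ddfin l f Ff)) lee_fin lerDl divr_ge0 // ltW //.
- by move=> l f g fg; rewrite /cell_diam fg.
- move=> f Ff; rewrite (eq_bigr (fun l : 'I_L => wt l * fine (dd (cell_diam (T l) f)) + eta)); last first.
    by move=> l _; rewrite mulrDr mulrCA mulfV ?mulr1 // gt_eqF.
  rewrite big_split /= sumr_const card_ord.
  apply: le_trans (_ : _ <= fine x + (G - fine x)) _; last by rewrite addrC subrK.
  apply: lerD.
    rewrite -lee_fin fineK //; apply: le_trans (le_x f L Ff); rewrite big_mkord -sumEFin.
    by rewrite le_eqVlt; apply/orP; left; apply/eqP; apply: eq_bigr => l _; rewrite EFinM fineK // ddfin.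
  rewrite -[leLHS]mulr_natr /eta -mulrA ler_piMr ?subr_ge0 //.
    by rewrite -lee_fin fineK // ltW.
  by rewrite mulrC ler_pdivrMr // mul1r ler_nat.
Qed.

End LevelBounds.

(** * Network processes *)

Section Network.
Context (R : realType) d (T : measurableType d) (P : probability T R).
Context d' (X : measurableType d') (N : finType) (Z : N -> {RV P >-> X}).
Context (F : set (X -> R)) (M : nat) (B : 'I_M -> {set N}).
Context (K : nat) (c : 'I_M -> 'I_K) (k : 'I_K).

Local Notation E h := (Rintegral P setT h).
Local Notation bm := bounded_measurable.

Definition block_sum (m : 'I_M) (w : T) (f : X -> R) : R :=
  \sum_(i in B m) (f (Z i w) - E (f \o Z i)).

Definition colour_class : seq 'I_M := [seq m <- enum 'I_M | c m == k].

Definition earlier (m : 'I_M) : {set N} := (\bigcup_(m' < M | (c m' == k) && (m' < m)%N) B m')%SET.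

Definition gens (A : {set N}) : set (set T) :=
  \bigcup_(i in [set` A]) preimage_set_system setT (Z i) measurable.

Lemma gens_measurable (A : {set N}) : <<s gens A >> `<=` measurable.
Proof.
apply: smallest_sub; first exact: sigma_algebra_measurable.
by move=> _ [i _ [U mU <-]]; apply: measurable_funP.
Qed.

Lemma measurable_gens (A : {set N}) i (f : X -> R) : i \in A -> measurable_fun setT f ->
  measurable_fun setT ((fun w => f (Z i w)) : g_sigma_algebraType (gens A) -> R).
Proof.
move=> iA mf _ U mU; rewrite setTI; apply: sub_sigma_algebra.
exists i => //; exists (f @^-1` U); last by rewrite setTI.
by rewrite -[X in measurable X]setTI; exact: mf.
Qed.

(** [enum] is increasing, so the blocks before m in the list are among those generating the
    sigma-field that [tau_bar] attaches to m. *)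
Lemma colour_class_split s1 m s2 : colour_class = s1 ++ m :: s2 ->
  c m = k /\ forall m', m' \in s1 -> c m' = k /\ (m' < m)%N.
Proof.
move=> E0; have inc m' : m' \in colour_class -> c m' = k.
  by rewrite mem_filter => /andP[/eqP].
split; first by apply: inc; rewrite E0 mem_cat mem_head orbT.
move=> m' m's1; split; first by apply: inc; rewrite E0 mem_cat m's1.
have : sorted ltn [seq val i | i <- colour_class].
  apply: (subseq_sorted ltn_trans (s2 := [seq val i | i <- enum 'I_M])).
    by apply: map_subseq; exact: filter_subseq.
  by rewrite val_enum_ord; exact: iota_ltn_sorted.
rewrite (sorted_pairwise ltn_trans) E0 map_cat pairwise_cat => /andP[/allrelP H _].
by apply: (H (val m') (val m)); rewrite ?map_f //= mem_head.
Qed.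

Lemma measurable_restriction (A : {set N}) : measurable_fun setT (restriction Z A).
Proof.
apply/measurable_fun_tnthP => i.
rewrite (_ : _ \o _ = Z (enum_val i)); first exact: measurable_funP.
by apply/funext => w; rewrite /= /restriction tnth_mktuple.
Qed.

Hypotheses (F0 : F (fun=> 0)) (mF : forall f, F f -> measurable_fun setT f).
Context (G1 : R).
Hypotheses (G10 : 0 < G1) (FG1 : forall f x, F f -> `|f x| <= G1).

Lemma bm_class f : F f -> bm f.
Proof. by move=> Ff; split; [exact: mF|exists G1 => x; exact: FG1]. Qed.

Lemma bm_block_sum m f : bm f -> bm (fun w => block_sum m w f).
Proof.
by move=> bf; apply: bm_sum => i _; apply: bmB; [exact: (bm_RV Z i bf)|exact: bm_cst].
Qed.

Lemma block_sum0 m w : block_sum m w (fun=> 0) = 0.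
Proof.
by apply: big1 => i _; rewrite (_ : _ \o _ = fun=> 0) // Ex_cst subrr.
Qed.

Lemma Ex_block_sum m f : bm f -> E (fun w => block_sum m w f) = 0.
Proof.
move=> bf; have bi i := bm_RV Z i bf.
rewrite Ex_sum => [|i _]; last by apply: bmB; [exact: bi|exact: bm_cst].
by apply: big1 => i _; rewrite ExB ?Ex_cst ?subrr //; [exact: bi|exact: bm_cst].
Qed.

Local Notation dX m := (@dclass R X (cone F) #|B m|).

(** Dividing f by G1 puts it into the cone; this is how gamma_1 becomes the factor of tau. *)
Lemma cone_diff_ge f x x' : F f ->
  (`|f x - f x'|%:E <= G1%:E * ereal_sup [set `|g x - g x'|%:E | g in cone F])%E.
Proof.
move=> Ff; pose g z := G1^-1 * f z.
have Cg : cone F g.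
  exists f, G1^-1; split => //; first by rewrite invr_gt0.
  apply: ge_ereal_sup => _ [z _ <-]; rewrite lee_fin /g normrM gtr0_norm ?invr_gt0 //.
  by rewrite ler_pdivrMl // mulr1 FG1.
have -> : `|f x - f x'|%:E = (G1%:E * `|g x - g x'|%:E)%E.
  by rewrite -EFinM /g -mulrBr normrM gtr0_norm ?invr_gt0 // mulrA mulfV ?mul1r // gt_eqF.
by apply: lee_wpmul2l; [rewrite lee_fin ltW|apply: ereal_sup_ubound; exists g].
Qed.

Lemma cone_sup_ge0 x x' : (0 <= ereal_sup [set `|g x - g x'|%:E | g in cone F])%E.
Proof.
apply: le_trans (_ : _ <= `|(fun=> 0) x - (fun=> 0) x' : R|%:E)%E _; first by rewrite lee_fin.
apply: ereal_sup_ubound; exists (fun=> 0) => //.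
exists (fun=> 0), 1; split => //; first by apply/funext => z; rewrite mulr0.
by apply: ge_ereal_sup => _ [z _ <-]; rewrite /= normr0 lee_fin.
Qed.

Definition colour_tau (m : 'I_M) : \bar R :=
  tau P (dX m) (sigma_of Z (earlier m)) (restriction Z (B m)).

Lemma colour_decoupling (I : finType) (phi : I -> X -> R) (Psi : ((X -> R) -> R) -> R) :
  (forall i, F (phi i)) -> lipschitz_on phi Psi ->
  ((E (fun w => Psi (psum block_sum colour_class w)))%:E <=
   (decoupled P block_sum colour_class Psi (fun=> 0))%:E +
     \sum_(m <- colour_class) G1%:E * colour_tau m)%E.
Proof.
move=> Fphi lPsi.
have bY m i : bm (fun w => block_sum m w (phi i)).
  by apply: bm_block_sum; exact: bm_class.
apply: (telescope bY lPsi) => [m|s1 m s2 Psi' split_s lPsi'].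
  by rewrite mule_ge0 ?lee_fin ?(ltW G10) // Lnorm_ge0.
have [cm s1P] := colour_class_split split_s.
(* The block sum as a function of the tuple of block values, the form in which tau sees it; the
   means are constants and cancel in differences. *)
pose y (x : #|B m|.-tuple X) (f : X -> R) : R :=
  \sum_(s < #|B m|) (f (tnth x s) - E (f \o Z (enum_val s))).
have yE w f : y (restriction Z (B m) w) f = block_sum m w f.
  rewrite /y /block_sum [RHS]big_enum_val.
  by apply: eq_bigr => s _; rewrite /restriction tnth_mktuple.
have by_ i : bm (fun x => y x (phi i)).
  apply: bm_sum => s _; apply: bmB; last exact: bm_cst.
  have [mf [L Lf]] := bm_class (Fphi i); split; last by exists L => x; exact: Lf.
  exact: (measurableT_comp mf (measurable_tnth s)).
have step := @decoupling_step R X I phi _ T P (gens (earlier m)) (@gens_measurable _) _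
  (#|B m|.-tuple X)%type (dX m) (restriction Z (B m)) (@measurable_restriction (B m))
  Psi' (psum block_sum s1) y G1 lPsi' G10.
have := step _ _ _ by_ _.
have -> : (fun w => Psi' (shift (psum block_sum s1 w) (y (restriction Z (B m) w)))) =
   (fun w => Psi' (shift (psum block_sum s1 w) (block_sum m w))).
  by apply/funext => w; congr Psi'; apply/funext => f; rewrite /shift yE.
have -> : (fun w => E (fun w' => Psi' (shift (psum block_sum s1 w) (y (restriction Z (B m) w'))))) =
   (fun w => E (fun w' => Psi' (shift (psum block_sum s1 w) (block_sum m w')))).
  apply/funext => w; congr Rintegral; apply/funext => w'.
  by congr Psi'; apply/funext => f; rewrite /shift yE.
apply.
- by move=> x x'; apply: sume_ge0 => s _; exact: cone_sup_ge0.
- by move=> i; exact: bm_psum.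
(* The closure lemmas for [bounded_measurable] are applied on [TG], which is T with the sigma-field
   of the earlier blocks. *)
- move=> i; pose TG := g_sigma_algebraType (gens (earlier m)).
  suff : bounded_measurable ((fun w => psum block_sum s1 w (phi i)) : TG -> R) by case.
  rewrite /psum; under eq_fun do rewrite big_seq.
  apply: bm_sum => m' m's1; apply: bm_sum => x xm'; apply: bmB; last exact: bm_cst.
  split; last by exists G1 => w; exact: FG1.
  apply: measurable_gens; last exact: mF.
  by apply/bigcupP; exists m' => //; have [-> ->] := s1P m' m's1; rewrite eqxx.
- move=> i x x'; rewrite /y -sumrB.
  apply: le_trans (_ : _ <= \sum_(s < #|B m|) `|phi i (tnth x s) - phi i (tnth x' s)|%:E)%E _.
    rewrite sumEFin lee_fin (le_trans (ler_norm_sum _ _ _)) // ler_sum // => s _.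
    by rewrite opprB addrA subrK.
  rewrite /dclass ge0_sume_distrr => [|s _]; last exact: cone_sup_ge0.
  by apply: lee_sum => s _; exact: cone_diff_ge.
Qed.

End Network.

(** * The maximal inequality for one pair of admissible sequences *)

Section Core.
Context (R : realType) (d : measure_display) (T : measurableType d) (P : probability T R).
Context (d' : measure_display) (X : measurableType d') (N : finType) (e : rel N).
Context (Z : N -> {RV P >-> X}) (F : set (X -> R)) (p : \bar R).
Context (M : nat) (B : 'I_M -> {set N}) (K : nat) (c : 'I_M -> 'I_K).
Context (code : nat -> (X -> R) -> nat) (D1 D2 : nat -> (X -> R) -> R) (L : nat) (G1 G2 : R).

Local Notation E h := (Rintegral P setT h).
Local Notation bm := bounded_measurable.
Local Notation pr := (chain_proj F code).
Local Notation Y := (block_sum Z B).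

(* [code l f] is the index of the pair of cells of f at level l in the two
   admissible sequences, D1 l f and D2 l f bound their diameters. *)
Hypotheses (dep : network_dependent e Z) (F0 : F (fun=> 0))
  (mF : forall f, F f -> measurable_fun setT f) (p1 : (1 <= p)%E)
  (Binj : injective B) (Bpart : finset.partition (B @: [set: 'I_M])%SET [set: N]%SET)
  (N0 : (0 < #|N|)%N).
Hypotheses
  (code_lt : forall l f, F f -> (code l f < 4 ^ (2 ^ l))%N)
  (code_mono : forall l f g, F f -> F g -> code l.+1 f = code l.+1 g -> code l f = code l g)
  (D1_gt0 : forall l f, F f -> 0 < D1 l f) (D2_gt0 : forall l f, F f -> 0 < D2 l f)
  (D1_code : forall l f g, F f -> F g -> code l f = code l g -> D1 l f = D1 l g)
  (D2_code : forall l f g, F f -> F g -> code l f = code l g -> D2 l f = D2 l g)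
  (sumD1 : forall f, F f -> \sum_(l < L.+1) 2 ^+ l * D1 l f <= G1)
  (sumD2 : forall f, F f -> \sum_(l < L) half_pow R l * D2 l f <= G2)
  (G10 : 0 < G1) (FG1 : forall f x, F f -> `|f x| <= G1)
  (near1 : forall l f z, F f -> `|pr l.+1 f z - pr l f z| <= D1 l f)
  (near2 : forall l f i, F f ->
     ('N[distribution P (Z i)]_(2%:E * p)[EFin \o (pr l.+1 f \- pr l f)%R] <= (D2 l f)%:E)%E)
  (nearL : forall f z, F f -> `|f z - pr L f z| <= D1 L f)
  (L_large : (2 * #|N| <= 2 ^ L)%N).

Let n : R := #|N|%:R.
Let b : R := (\max_(m < M) #|B m|)%:R.
Let Gam : R := \big[Num.max/0]_(m < M) Gamma e Z F p (B m).

Lemma block_gt0 m : (0 < #|B m|)%N.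
Proof.
have [_ _ B0] := and3P Bpart; rewrite card_gt0; apply: contraNneq B0 => <-.
exact: imset_f.
Qed.

Lemma sum_blocks (phi : N -> R) : \sum_i phi i = \sum_m \sum_(i in B m) phi i.
Proof.
transitivity (\sum_(i in [set: N]%SET) phi i); first by apply: eq_bigl => i; rewrite inE.
rewrite (set_partition_big _ Bpart) big_imset /=; last by move=> ? ? _ _; exact: Binj.
by apply: eq_bigl => m; rewrite inE.
Qed.

Lemma Gamma_ge0 m : 0 <= Gamma e Z F p (B m).
Proof.
rewrite /Gamma le_min; apply/andP; split.
  by rewrite /Gamma_sum; case: ifP => _; exact: sqrtr_ge0.
by rewrite mulr_ge0 ?powR_ge0 // /Gamma_sharp; case: ifP => _; exact: sqrtr_ge0.
Qed.

Lemma Gam_ge m : Gamma e Z F p (B m) <= Gam.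
Proof. by rewrite /Gam (bigD1 m) //= le_max lexx. Qed.

Lemma Gam_ge0 : 0 <= Gam.
Proof. by rewrite /Gam; elim/big_rec : _ => // m x _ x0; rewrite le_max x0 orbT. Qed.

Lemma b_ge m : #|B m|%:R <= b :> R.
Proof. by rewrite ler_nat (leq_bigmax (F := fun m => #|B m|) m). Qed.

Lemma b_ge1 : 1 <= b.
Proof.
have [i _] := card_gt0P N0.
have : i \in finset.cover (B @: [set: 'I_M])%SET by have [/eqP -> _ _] := and3P Bpart; rewrite inE.
case/bigcupP => _ /imsetP[m _ _] _; apply: le_trans (b_ge m).
by rewrite ler1n block_gt0.
Qed.

Let bm_F f (Ff : F f) : bm f := bm_class mF FG1 Ff.

Lemma block_sumB m w f g : bm f -> bm g ->
  Y m w f - Y m w g = \sum_(i in B m) ((f \- g) (Z i w) - E ((f \- g) \o Z i)).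
Proof.
move=> bf bg; rewrite /block_sum -sumrB; apply: eq_bigr => i _.
have -> : E ((f \- g) \o Z i) = E (f \o Z i) - E (g \o Z i).
  by rewrite -ExB //; exact: bm_RV.
rewrite /=; ring.
Qed.

Lemma block_sumB_le m w f g (D : R) : bm f -> bm g ->
  (forall z, `|f z - g z| <= D) -> `|Y m w f - Y m w g| <= 2 * #|B m|%:R * D.
Proof.
move=> bf bg fg; rewrite block_sumB //.
apply: le_trans (ler_norm_sum _ _ _) _.
apply: le_trans (_ : _ <= \sum_(i in B m) (D + D)) _.
  apply: ler_sum => i _; apply: le_trans (ler_normB _ _) _; apply: lerD; first exact: fg.
  apply: Ex_norm_le => [|w']; last exact: fg.
  by apply: (bm_RV Z i); apply: bmB.
rewrite sumr_const -[leLHS]mulr_natl le_eqVlt; apply/orP; left; apply/eqP; ring.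
Qed.

Section Colour.
Context (k : 'I_K).
Let s := colour_class c k.
Let nk : R := \sum_(m <- s) #|B m|%:R.

Lemma colour_bound :
  ((E (fun w => chain_max F code L (psum Y s w)))%:E <=
   (45 * (Gam * Num.sqrt nk) * G2 + 40 * b * G1)%:E +
     \sum_(m <- s) G1%:E * colour_tau Z F B c k m)%E.
Proof.
have pF l f : F (pr l f) := proj_in code F0 l f.
have b0 : 0 < b by rewrite (lt_le_trans ltr01) ?b_ge1.
apply: le_trans (colour_decoupling Z B c k F0 mF G10 FG1 (phi := last_level F code (L := L)) _
  (@lip_chain_max _ _ F code L)) _; first by move=> i; exact: pF.
rewrite leeD2r // lee_fin.
have nk0 : 0 <= nk by rewrite sumr_ge0.
apply: (@decoupled_chain_max _ _ _ _ P _ Y s F code F0 code_lt code_mono D1 D2 L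
  (Gam * Num.sqrt nk) b G1 G2 (fun m => 14 * #|B m|%:R * Gam ^+ 2)) => //.
- by rewrite mulr_ge0 ?sqrtr_ge0 ?Gam_ge0.
(* The chain uses the levels below L; the term of level L serves the part of f beyond the chain, in
   [emp_process_le]. *)
- move=> f Ff; apply: le_trans (sumD1 Ff); rewrite big_ord_recr /= lerDl.
  by rewrite mulr_ge0 ?exprn_ge0 // ltW // D1_gt0.
- by move=> m w; exact: block_sum0.
- by move=> m f Ff; apply: bm_block_sum; exact: bm_F.
- by move=> m f Ff; apply: Ex_block_sum; exact: bm_F.
- move=> m l f w _ Ff; apply: le_trans (_ : _ <= 2 * #|B m|%:R * D1 l f) _.
    apply: block_sumB_le; [exact: bm_F (pF _ _)|exact: bm_F (pF _ _)|].
    by move=> z; exact: near1.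
  by rewrite ler_wpM2r ?(ltW (D1_gt0 _ Ff)) // ler_wpM2l // b_ge.
- move=> m l f _ Ff.
  under eq_Rintegral do rewrite (block_sumB _ _ (bm_F (pF _ _)) (bm_F (pF _ _))).
  have Fh : class_sub F (pr l.+1 f \- pr l f) by exists (pr l.+1 f) => //; exists (pr l f).
  apply: le_trans (block_variance dep bm_F Fh (D2_gt0 l Ff) (block_gt0 m) p1 _) _.
    by move=> i; exact: near2.
  rewrite ler_wpM2r ?sqr_ge0 // ler_wpM2l ?mulr_ge0 //.
  by rewrite ler_pXn2r ?nnegrE ?Gamma_ge0 ?Gam_ge0 ?Gam_ge.
- rewrite -mulr_suml -mulr_sumr -/nk exprMn sqr_sqrtr //.
  by rewrite le_eqVlt; apply/orP; left; apply/eqP; ring.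
Qed.

End Colour.

Let nk (k : 'I_K) : R := \sum_(m <- colour_class c k) #|B m|%:R.

Lemma sum_colour_class (phi : 'I_M -> R) :
  \sum_k \sum_(m <- colour_class c k) phi m = \sum_m phi m.
Proof.
rewrite [RHS](partition_big c xpredT) //=; apply: eq_bigr => k _.
by rewrite /colour_class big_filter big_enum_cond.
Qed.

Lemma sum_sqrt_nk : \sum_k Num.sqrt (nk k) <= Num.sqrt K%:R * Num.sqrt n.
Proof.
have n0 : 0 < n by rewrite ltr0n.
have sumnk : \sum_k nk k = n.
  rewrite sum_colour_class /n -[RHS](_ : \sum_(i : N) 1 = _); last by rewrite sumr_const.
  by rewrite sum_blocks; apply: eq_bigr => m _; rewrite sumr_const.
have nk0 k : 0 <= nk k by rewrite sumr_ge0.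
case: (posnP K) => [K0|K0].
  rewrite big1 ?mulr_ge0 ?sqrtr_ge0 // => k _.
  by have := leq_ltn_trans (leq0n k) (ltn_ord k); rewrite K0.
have k0 : 0 < K%:R :> R by rewrite ltr0n.
set a := Num.sqrt K%:R; set q := Num.sqrt n.
have a0 : 0 < a by rewrite sqrtr_gt0.
have q0 : 0 < q by rewrite sqrtr_gt0.
(* Cauchy-Schwarz through the arithmetic-geometric mean inequality for each colour, with weights
   giving equality when every class has size n / K. *)
apply: le_trans (_ : _ <= \sum_k (nk k * (a / (2 * q)) + q / (2 * a))) _.
  apply: ler_sum => k _; set x := Num.sqrt (nk k).
  have -> : nk k = x ^+ 2 by rewrite sqr_sqrtr.
  have : 0 <= (x * a - q) ^+ 2 / (2 * a * q).
    by rewrite divr_ge0 ?sqr_ge0 // !mulr_ge0 // ltW.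
  have -> : (x * a - q) ^+ 2 / (2 * a * q) = x ^+ 2 * (a / (2 * q)) + q / (2 * a) - x.
    by field; rewrite !gt_eqF.
  by rewrite subr_ge0.
rewrite big_split /= -mulr_suml sumnk sumr_const card_ord -[X in _ + X]mulr_natl.
have nE : n = q ^+ 2 by rewrite sqr_sqrtr // ltW.
have KE : K%:R = a ^+ 2 by rewrite sqr_sqrtr // ltW.
rewrite nE KE le_eqVlt; apply/orP; left; apply/eqP; field.
by rewrite !gt_eqF.
Qed.

(** The part of f beyond the chain moves the block sums by at most 2 n [D1 L f] in total, and
    [L_large] bounds this by the last term of [sumD1]. *)
Lemma emp_process_le f w : F f ->
  emp_process Z f w <= (Num.sqrt n)^-1 *
    (\sum_k chain_max F code L (psum Y (colour_class c k) w) + G1).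
Proof.
move=> Ff; have pF l g : F (pr l g) := proj_in code F0 l g.
rewrite /emp_process ler_wpM2l ?invr_ge0 ?sqrtr_ge0 //.
have -> : \sum_(i : N) (f (Z i w) - fine 'E_P[f \o Z i]%E) = \sum_m Y m w f.
  by rewrite sum_blocks; apply: eq_bigr => m _; apply: eq_bigr => i _; rewrite fine_expectation.
have -> : \sum_m Y m w f = \sum_m Y m w (pr L f) + \sum_m (Y m w f - Y m w (pr L f)).
  by rewrite -big_split /=; apply: eq_bigr => m _; rewrite addrC subrK.
apply: lerD.
  rewrite -sum_colour_class; apply: ler_sum => k _.
  exact: (chain_max_ge code_lt L (psum Y (colour_class c k) w) Ff).
apply: le_trans (_ : _ <= \sum_m (2 * #|B m|%:R * D1 L f)) _.
  apply: ler_sum => m _; apply: le_trans (ler_norm _) _.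
  apply: block_sumB_le; [exact: bm_F|exact: bm_F (pF _ _)|].
  by move=> z; exact: nearL.
rewrite -mulr_suml -mulr_sumr.
have -> : \sum_m #|B m|%:R = n.
  rewrite /n -[RHS](_ : \sum_(i : N) 1 = _); last by rewrite sumr_const.
  by rewrite sum_blocks; apply: eq_bigr => m _; rewrite sumr_const.
apply: le_trans (sumD1 Ff); rewrite big_ord_recr /= ler_wpDl ?sumr_ge0 //.
  by move=> l _; rewrite mulr_ge0 ?exprn_ge0 // ltW // D1_gt0.
rewrite ler_wpM2r ?(ltW (D1_gt0 _ Ff)) // /n -natrM -natrX ler_nat //.
Qed.

Lemma core_bound :
  ('N[P]_1[(fun w => ereal_sup [set (emp_process Z f w)%:E | f in F])] <=
   45%:E * ((Num.sqrt K%:R * Gam)%:E * G2%:E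
     + ((K%:R * b / Num.sqrt n)%:E + (Num.sqrt n)%:E * tau_bar Z (cone F) B c) * G1%:E))%E.
Proof.
have n0 : 0 < n by rewrite ltr0n.
have q0 : 0 < Num.sqrt n by rewrite sqrtr_gt0.
have pF l g : F (pr l g) := proj_in code F0 l g.
pose cm k w := chain_max F code L (psum Y (colour_class c k) w).
have bcm k : bm (cm k).
  apply: (bm_lipschitz (@lip_chain_max _ _ F code L) (vv := psum Y (colour_class c k))) => i.
  by apply: bm_psum => m j; apply: bm_block_sum; exact: bm_F (pF _ _).
pose TT : \bar R := (\sum_(k < K) \sum_(m <- colour_class c k) colour_tau Z F B c k m)%E.
have TT0 : (0 <= TT)%E.
  by apply: sume_ge0 => k _; apply: sume_ge0 => m _; exact: Lnorm_ge0.
have -> : tau_bar Z (cone F) B c = ((n^-1)%:E * TT)%E.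
  rewrite /tau_bar; congr (_ * _)%E; apply: eq_bigr => k _.
  by rewrite /colour_class big_filter big_enum_cond.
have LHS : ('N[P]_1[(fun w => ereal_sup [set (emp_process Z f w)%:E | f in F])] <=
   ((Num.sqrt n)^-1 * (\sum_k E (cm k) + G1))%:E)%E.
  rewrite Lnorm1.
  have bmR : bm (fun w => (Num.sqrt n)^-1 * (\sum_k cm k w + G1)).
    by apply: bmZ; apply: bmD; [exact: bm_sum|exact: bm_cst].
  have -> : (Num.sqrt n)^-1 * (\sum_k E (cm k) + G1) =
      E (fun w => (Num.sqrt n)^-1 * (\sum_k cm k w + G1)).
    rewrite ExZ; last by apply: bmD; [exact: bm_sum|exact: bm_cst].
    by rewrite ExD; [rewrite Ex_cst Ex_sum|exact: bm_sum|exact: bm_cst].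
  (* The supremum over [F] need not be measurable; its majorant, built from finite maxima, is, and
     monotonicity of the integral suffices. *)
  rewrite -Ex_fin //; apply: ge0_le_integral_nonmeas => w; first exact: abse_ge0.
  have sup0 : (0 <= ereal_sup [set (emp_process Z f w)%:E | f in F])%E.
    apply: ereal_sup_ubound; exists (fun=> 0) => //; congr EFin.
    rewrite /emp_process big1 ?mulr0 // => i _.
    by rewrite fine_expectation (_ : _ \o _ = fun=> 0) // Ex_cst subrr.
  rewrite gee0_abs //; apply: ge_ereal_sup => _ [f Ff <-].
  by rewrite lee_fin; exact: emp_process_le.
apply: le_trans LHS _.
have H : ((\sum_k E (cm k))%:E <=
   (45 * (Gam * (Num.sqrt K%:R * Num.sqrt n)) * G2 + 40 * (K%:R * b) * G1)%:E + G1%:E * TT)%E.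
  rewrite -sumEFin.
  apply: le_trans (_ : _ <= \sum_k ((45 * (Gam * Num.sqrt (nk k)) * G2 + 40 * b * G1)%:E +
     \sum_(m <- colour_class c k) G1%:E * colour_tau Z F B c k m))%E _.
    by apply: lee_sum => k _; exact: colour_bound.
  rewrite big_split /= sumEFin; apply: leeD.
    rewrite lee_fin big_split /= sumr_const card_ord -!mulr_suml -!mulr_sumr.
    apply: lerD; last by rewrite -[leLHS]mulr_natl le_eqVlt; apply/orP; left; apply/eqP; ring.
    apply: ler_wpM2r.
      by apply: le_trans (sumD2 F0); apply: sumr_ge0 => l _;
    rewrite mulr_ge0 ?(ltW (half_pow_gt0 _ _)) // ltW // D2_gt0.
    by rewrite !ler_wpM2l ?Gam_ge0 // sum_sqrt_nk.
  rewrite /TT ge0_sume_distrr => [|k _]; last by apply: sume_ge0 => m _; exact: Lnorm_ge0.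
  by apply: lee_sum => k _; rewrite ge0_sume_distrr // => m _; exact: Lnorm_ge0.
have b1 := b_ge1.
have K1 : 1 <= K%:R :> R.
  have [i _] := card_gt0P N0.
  have : i \in finset.cover (B @: [set: 'I_M])%SET by have [/eqP -> _ _] := and3P Bpart; rewrite inE.
  case/bigcupP => _ /imsetP[m _ _] _; rewrite ler1n.
  by apply: leq_ltn_trans (ltn_ord (c m)).
have G20 : 0 <= G2.
  by apply: le_trans (sumD2 F0); apply: sumr_ge0 => l _;
    rewrite mulr_ge0 ?(ltW (half_pow_gt0 _ _)) // ltW // D2_gt0.
(* An infinite tau makes the right-hand side +oo, since its coefficients are positive. *)
move: TT TT0 H => -[t| |] // t0 H; last first.
  rewrite gt0_muley ?lte_fin ?invr_gt0 // gt0_muley ?lte_fin // addey // gt0_mulye ?lte_fin //.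
  by rewrite addey // gt0_muley ?lte_fin // leey.
rewrite -EFinM -EFinD lee_fin in H.
have nI : n^-1 = Num.sqrt n ^- 2 by rewrite sqr_sqrtr // ltW.
rewrite [leRHS](_ : _ = (45 * (Num.sqrt K%:R * Gam * G2 +
  (K%:R * b / Num.sqrt n + Num.sqrt n * (n^-1 * t)) * G1))%:E) // lee_fin.
(* The residual G1 is absorbed by K b G1, as K and b are at least 1; 40 becomes 41, still below
   45. *)
apply: le_trans (_ : _ <= (Num.sqrt n)^-1 * ((45 * (Gam * (Num.sqrt K%:R * Num.sqrt n)) * G2
   + 40 * (K%:R * b) * G1 + G1 * t) + (K%:R * b) * G1)) _.
  rewrite ler_wpM2l ?invr_ge0 ?(ltW q0) // lerD // -[leLHS]mul1r ler_wpM2r ?(ltW G10) //.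
  by rewrite -[leLHS]mul1r ler_pM.
rewrite nI.
rewrite [leLHS](_ : _ = 45 * (Num.sqrt K%:R * Gam * G2) + 41 * (K%:R * b / Num.sqrt n * G1) +
  1 * (Num.sqrt n * (Num.sqrt n ^- 2 * t) * G1)); last by field; rewrite gt_eqF.
rewrite [leRHS](_ : _ = 45 * (Num.sqrt K%:R * Gam * G2) + 45 * (K%:R * b / Num.sqrt n * G1) +
  45 * (Num.sqrt n * (Num.sqrt n ^- 2 * t) * G1)); last by field; rewrite gt_eqF.
have G1' := ltW G10; have q0' := ltW q0; have b0' : 0 <= b := le_trans ler01 b1.
apply: lerD; first (apply: lerD => //); apply: ler_wpM2r; rewrite ?ler_nat ?ler1n //.
  by rewrite mulr_ge0 // divr_ge0 // mulr_ge0.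
by rewrite mulr_ge0 // mulr_ge0 // mulr_ge0 // invr_ge0 exprn_ge0.
Qed.

End Core.

(** * Infima over admissible sequences and degenerate cases *)

Section Assembly.
Context (R : realType) (d : measure_display) (T : measurableType d) (P : probability T R).
Context (d' : measure_display) (X : measurableType d') (N : finType) (e : rel N).
Context (Z : N -> {RV P >-> X}) (F : set (X -> R)) (p : \bar R).
Context (M : nat) (B : 'I_M -> {set N}) (K : nat) (c : 'I_M -> 'I_K).

Hypotheses (dep : network_dependent e Z) (F0 : F (fun=> 0))
  (mF : forall f, F f -> measurable_fun setT f) (p1 : (1 <= p)%E)
  (Binj : injective B) (Bpart : finset.partition (B @: [set: 'I_M])%SET [set: N]%SET)
  (N0 : (0 < #|N|)%N).

Let F_ne : F !=set0. Proof. by exists (fun=> 0). Qed.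

Lemma max_Lnorm_ge0 q (h : X -> \bar R) : (0 <= max_Lnorm Z q h)%E.
Proof. by rewrite /max_Lnorm; elim/big_rec : _ => // i x _ x0; rewrite le_max x0 orbT. Qed.

Definition chain_value (q : R) (dd : (X -> \bar R) -> \bar R)
    (t : nat -> set (set (X -> R))) : \bar R :=
  ereal_sup [set (\sum_(0 <= l <oo) (2%R `^ (l%:R / q))%:E * dd (cell_diam (t l) f))%E | f in F].

Let root_cell (s : R) (t : nat -> set (set (X -> R))) (code : nat -> (X -> R) -> nat) f :
  admissible s F t ->
  (forall l f g, F f -> F g -> code l f = code l g -> cell (t l) f = cell (t l) g) ->
  (forall f g, F f -> F g -> code 0%N f = code 0%N g) ->
  F f -> cell (t 0%N) f (fun=> 0).
Proof.
move=> [pT _ _ _] ccell c0 Ff; rewrite (ccell _ _ _ Ff F0 (c0 _ _ Ff F0)).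
by have [] := partition_block (pT 0%N) F0.
Qed.

(** The partition of level 0 has a single cell, containing both f and 0, so the first term of the
    series already bounds f. *)
Lemma class_bounded (b : R) (t1 : nat -> set (set (X -> R))) (G1 : R) :
  1 <= b -> admissible b F t1 -> (chain_value 1 (@sup_norm _ _) t1 < G1%:E)%E ->
  forall f x, F f -> `|f x| <= G1.
Proof.
move=> b1 adm lt1 f x Ff.
have [code [_ ccell _ c0]] := admissible_codes b1 F_ne adm.
have [D [D0 Dge _ sumD]] := level_bounds 1%N F_ne (@sup_norm_ge0 R X) lt1.
have := sumD f Ff; rewrite big_ord1 mul0r powRr0 mul1r; apply: le_trans.
rewrite -lee_fin; apply: le_trans (Dge 0%N f Ff).
have self : cell (t1 0%N) f f by have [pT _ _ _] := adm; have [] := partition_block (pT 0%N) Ff.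
have := cell_diam_ge x self (root_cell adm ccell c0 Ff).
rewrite subr0 => /le_trans; apply; apply: le_trans (sup_norm_ge _ x).
exact: lee_abs.
Qed.

Lemma admissible_bound (a b G1 G2 : R) (t1 t2 : nat -> set (set (X -> R))) :
  1 <= a -> 1 <= b -> admissible a F t2 -> admissible b F t1 ->
  (chain_value 1 (@sup_norm _ _) t1 < G1%:E)%E ->
  (chain_value 2 (max_Lnorm Z (2%:E * p)) t2 < G2%:E)%E ->
  ('N[P]_1[(fun w => ereal_sup [set (emp_process Z f w)%:E | f in F])] <=
   45%:E * ((Num.sqrt K%:R * \big[Num.max/0]_(m < M) Gamma e Z F p (B m))%:E * G2%:E
     + ((K%:R * (\max_(m < M) #|B m|)%:R / Num.sqrt #|N|%:R)%:E
        + (Num.sqrt #|N|%:R)%:E * tau_bar Z (cone F) B c) * G1%:E))%E.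
Proof.
move=> a1 b1 adm2 adm1 lt1 lt2.
(* Enough for 2|N| <= 2^L, because |N| <= 2^|N|. *)
pose L := #|N|.+1.
have [code1 [lt_c1 cell1 mono1 root1]] := admissible_codes b1 F_ne adm1.
have [code2 [lt_c2 cell2 mono2 root2]] := admissible_codes a1 F_ne adm2.
have [D1 [D10 D1ge D1c sumD1]] := level_bounds L.+1 F_ne (@sup_norm_ge0 R X) lt1.
have [D2 [D20 D2ge D2c sumD2]] := level_bounds L F_ne (max_Lnorm_ge0 (2%:E * p)) lt2.
have FG1 := class_bounded b1 adm1 lt1.
have [pT1 _ _ _] := adm1; have [pT2 _ _ _] := adm2.
pose code l f := (code1 l f + 2 ^ (2 ^ l) * code2 l f)%N.
have code_inj l f g : F f -> F g -> code l f = code l g ->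
    code1 l f = code1 l g /\ code2 l f = code2 l g.
  by move=> Ff Fg; apply: pair_code_inj; exact: lt_c1.
have pF l f : F (chain_proj F code l f) := proj_in code F0 l f.
have code_pr l f : F f -> code l.+1 (chain_proj F code l.+1 f) = code l.+1 f.
  by move=> Ff; rewrite /= code_rep.
have mono l f g : F f -> F g -> code l.+1 f = code l.+1 g -> code l f = code l g.
  move=> Ff Fg /(code_inj _ _ _ Ff Fg)[h1 h2].
  by rewrite /code (mono1 _ _ _ Ff Fg h1) (mono2 _ _ _ Ff Fg h2).
have same1 l f g : F f -> F g -> code l f = code l g -> cell (t1 l) f g.
  move=> Ff Fg /(code_inj _ _ _ Ff Fg)[h1 _]; rewrite (cell1 _ _ _ Ff Fg h1).
  by have [] := partition_block (pT1 l) Fg.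
have same2 l f g : F f -> F g -> code l f = code l g -> cell (t2 l) f g.
  move=> Ff Fg /(code_inj _ _ _ Ff Fg)[_ h2]; rewrite (cell2 _ _ _ Ff Fg h2).
  by have [] := partition_block (pT2 l) Fg.
have in1 l f : F f -> cell (t1 l) f (chain_proj F code l f).
  move=> Ff; case: l => [|l]; first exact: (root_cell adm1 cell1 root1 Ff).
  by apply: same1 => //; rewrite code_pr.
have in2 l f : F f -> cell (t2 l) f (chain_proj F code l f).
  move=> Ff; case: l => [|l]; first exact: (root_cell adm2 cell2 root2 Ff).
  by apply: same2 => //; rewrite code_pr.
(* The next chain point still lies in the level-l cell of f, since codes refine. Both ends of a link
   are thus in one cell, whose diameter bounds the link. *)
have nx1 l f : F f -> cell (t1 l) f (chain_proj F code l.+1 f).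
  by move=> Ff; apply: same1 => //; apply: mono => //; rewrite code_pr.
have nx2 l f : F f -> cell (t2 l) f (chain_proj F code l.+1 f).
  by move=> Ff; apply: same2 => //; apply: mono => //; rewrite code_pr.
have near l f g h z : F f -> cell (t1 l) f g -> cell (t1 l) f h -> `|g z - h z| <= D1 l f.
  move=> Ff cg ch; rewrite -lee_fin; apply: le_trans (D1ge l f Ff).
  apply: le_trans (cell_diam_ge z cg ch) _.
  by apply: le_trans (sup_norm_ge _ z); exact: lee_abs.
have G10 : 0 < G1.
  have := sumD1 _ F0; apply: lt_le_trans; rewrite (bigD1 ord0) //=.
  rewrite ltr_pwDl ?mulr_gt0 ?powR_gt0 ?D10 // sumr_ge0 // => l _.
  by rewrite mulr_ge0 ?powR_ge0 // ltW // D10.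
have pow1 l : 2 `^ (l%:R / 1) = 2 ^+ l :> R by rewrite divr1 powR_mulrn.
apply: (@core_bound R d T P d' X N e Z F p M B K c code D1 D2 L G1 G2) => //.
- by move=> l f Ff; apply: pair_code_lt; [exact: lt_c1|exact: lt_c2].
- move=> l f g Ff Fg /(code_inj _ _ _ Ff Fg)[h1 _]; apply: D1c; exact: cell1.
- move=> l f g Ff Fg /(code_inj _ _ _ Ff Fg)[_ h2]; apply: D2c; exact: cell2.
- by move=> f Ff; have := sumD1 f Ff; under eq_bigr do rewrite pow1.
- by move=> l f z Ff; apply: near => //; [exact: nx1|exact: in1].
- move=> l f i Ff; apply: le_trans (D2ge l f Ff).
  have p0 : (0 < 2%:E * p)%E by rewrite mule_gt0 ?lte_fin // (lt_le_trans _ p1) ?lte_fin.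
  apply: le_trans (_ : _ <= 'N[distribution P (Z i)]_(2%:E * p)[cell_diam (t2 l) f])%E _.
    apply: Lnorm_mono => // x; apply: le_trans (cell_diam_ge x (nx2 l f Ff) (in2 l f Ff)) _.
    exact: lee_abs.
  by rewrite /max_Lnorm (bigD1 i) //= le_max lexx.
- move=> f z Ff; apply: near => //; last exact: in1.
  by have [] := partition_block (pT1 L) Ff.
- rewrite /L expnS leq_mul2l /=; apply: ltnW; exact: ltn_expl.
Qed.

Lemma gamma_ge0 (q s : R) (dd : (X -> \bar R) -> \bar R) : (forall h, 0 <= dd h)%E ->
  (0 <= gamma q s F dd)%E.
Proof.
move=> dd0; apply: le_ereal_inf_tmp => _ [t _ <-].
pose f0 : X -> R := fun=> 0.
have H0 : (0 <= \sum_(0 <= l <oo) (2%R `^ (l%:R / q))%:E * dd (cell_diam (t l) f0))%E.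
  by apply: nneseries_ge0 => l _ _; rewrite mule_ge0 ?lee_fin ?powR_ge0.
by apply: le_trans H0 _; apply: ereal_sup_ubound; exists f0.
Qed.

Lemma gamma_lt (q s x : R) (dd : (X -> \bar R) -> \bar R) : (gamma q s F dd < x%:E)%E ->
  exists2 t, admissible s F t & (chain_value q dd t < x%:E)%E.
Proof. by move=> /ereal_inf_lt[_ [t adm <-] tx]; exists t. Qed.

Lemma network_maximal_inequality (a b : R) : 1 <= a -> 1 <= b ->
  ('N[P]_1[(fun w => ereal_sup [set (emp_process Z f w)%:E | f in F])] <=
   45%:E * ((Num.sqrt K%:R * \big[Num.max/0]_(m < M) Gamma e Z F p (B m))%:E
              * gamma 2 a F (max_Lnorm Z (2%:E * p))
     + ((K%:R * (\max_(m < M) #|B m|)%:R / Num.sqrt #|N|%:R)%:E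
        + (Num.sqrt #|N|%:R)%:E * tau_bar Z (cone F) B c) * gamma 1 b F (@sup_norm R _)))%E.
Proof.
move=> a1 b1; set g2 := gamma 2 a F _; set g1 := gamma 1 b F _.
set k2 := Num.sqrt K%:R * _; set k1 := K%:R * _ / _; set tb := tau_bar Z _ B c.
have g20 : (0 <= g2)%E by apply: gamma_ge0 => h; exact: max_Lnorm_ge0.
have g10 : (0 <= g1)%E by apply: gamma_ge0 => h; exact: sup_norm_ge0.
have n0 : 0 < #|N|%:R :> R by rewrite ltr0n.
have q0 : 0 < Num.sqrt #|N|%:R :> R by rewrite sqrtr_gt0.
have tb0 : (0 <= tb)%E.
  rewrite mule_ge0 ?lee_fin ?invr_ge0 ?(ltW n0) //; apply: sume_ge0 => k _.
  by apply: sume_ge0 => m _; exact: Lnorm_ge0.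
have [i _] := card_gt0P N0.
have : i \in finset.cover (B @: [set: 'I_M])%SET by have [/eqP -> _ _] := and3P Bpart; rewrite inE.
case/finset.bigcupP => _ /imsetP[m _ _] _.
have K0 : 0 < K%:R :> R by rewrite ltr0n; exact: leq_ltn_trans (ltn_ord (c m)).
have k2_ge0 : 0 <= k2 by rewrite mulr_ge0 ?sqrtr_ge0 // Gam_ge0.
have k10 : 0 < k1.
  rewrite divr_gt0 // mulr_gt0 // ltr0n (leq_trans (block_gt0 Bpart m)) //.
  exact: (leq_bigmax (F := fun m => #|B m|) m).
have qtb0 : (0 <= (Num.sqrt #|N|%:R)%:E * tb)%E by rewrite mule_ge0 ?lee_fin ?(ltW q0).
have k1tb0 : (0 < k1%:E + (Num.sqrt #|N|%:R)%:E * tb)%E.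
  by rewrite (lt_le_trans (_ : 0 < k1%:E)%E) ?lte_fin // leeDl.
(* As 0 * +oo = 0, an infinite complexity settles the claim only through the positivity of its
   coefficient: [k1tb0] here, [k20] for gamma_2. *)
have [g1y|g1y] := eqVneq g1 +oo%E.
  rewrite g1y gt0_muley // addey ?gt0_muley ?lte_fin ?leey //.
  by rewrite gt_eqF // (lt_le_trans ltNy0) // mule_ge0 ?lee_fin // ltW.
have g1fin : g1 \is a fin_num by rewrite ge0_fin_numE // ltey.
have gap1 eps : 0 < eps -> exists2 t, admissible b F t &
    (chain_value 1 (@sup_norm R X) t < (fine g1 + eps)%:E)%E.
  by move=> eps0; apply: gamma_lt; rewrite [ltRHS]EFinD fineK // lteDl // lte_fin.
have bF f : F f -> bounded_measurable f.
  have [t1 adm1 lt1] := gap1 1 ltr01.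
  by move=> Ff; split; [exact: mF|exists (fine g1 + 1) => x; exact: (class_bounded b1 adm1 lt1)].
have F00 : class_sub F ((fun=> 0) \- (fun=> 0)) by exists (fun=> 0) => //; exists (fun=> 0).
have k20 : 0 < k2.
  rewrite mulr_gt0 ?sqrtr_gt0 // (lt_le_trans (Gamma_gt0 dep bF F00 (block_gt0 Bpart m) p1)) //.
  by rewrite (bigD1 m) //= le_max lexx.
have [g2y|g2y] := eqVneq g2 +oo%E.
  rewrite g2y gt0_muley ?lte_fin // addye ?gt0_muley ?lte_fin ?leey //.
  by rewrite gt_eqF // (lt_le_trans ltNy0) // mule_ge0 // ltW.
have g2fin : g2 \is a fin_num by rewrite ge0_fin_numE // ltey.
have gap2 eps : 0 < eps -> exists2 t, admissible a F t &
    (chain_value 2 (max_Lnorm Z (2%:E * p)) t < (fine g2 + eps)%:E)%E.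
  by move=> eps0; apply: gamma_lt; rewrite [ltRHS]EFinD fineK // lteDl // lte_fin.
have key eps : 0 < eps ->
  ('N[P]_1[(fun w => ereal_sup [set (emp_process Z f w)%:E | f in F])] <=
   45%:E * (k2%:E * (fine g2 + eps)%:E
     + (k1%:E + (Num.sqrt #|N|%:R)%:E * tb) * (fine g1 + eps)%:E))%E.
  move=> eps0; have [t2 adm2 lt2] := gap2 _ eps0; have [t1 adm1 lt1] := gap1 _ eps0.
  exact: (admissible_bound a1 b1 adm2 adm1 lt1 lt2).
(* If gamma_1 = 0 and tau = +oo, their product is 0, whereas any perturbation of gamma_1 makes it
   +oo. But gamma_1 = 0 reduces [F] to the zero function. *)
case: (eqVneq g1 0%E) => [g1z|g1z].
  have Fz f x : F f -> f x = 0.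
    move=> Ff; apply/eqP; rewrite -normr_le0; apply/ler_addgt0Pl => eps eps0.
    have [t1 adm1 lt1] := gap1 _ eps0.
    by have := class_bounded b1 adm1 lt1 x Ff; rewrite g1z /= add0r addr0.
  rewrite (_ : (fun w => ereal_sup _) = cst 0%E) ?Lnorm0 //.
    rewrite g1z mule0 adde0 mule_ge0 ?lee_fin // mule_ge0 ?lee_fin // ltW //.
  apply/funext => w.
  have emp0 f : F f -> emp_process Z f w = 0.
    move=> Ff; rewrite /emp_process big1 ?mulr0 // => j _.
    rewrite fine_expectation (_ : _ \o _ = fun=> 0) ?Ex_cst ?Fz ?subrr //.
    by apply/funext => w' /=; rewrite Fz.
  apply/eqP; rewrite eq_le; apply/andP; split.
    by apply: ge_ereal_sup => _ [f Ff <-]; rewrite emp0.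
  by apply: ereal_sup_ubound; exists (fun=> 0); rewrite ?emp0.
have g1p : (0 < g1)%E by rewrite lt0e g1z.
case: (tb) tb0 key k1tb0 => [t| |] // t0 key k1tb0'; last first.
  rewrite gt0_muley ?lte_fin // addey // gt0_mulye // addey ?gt0_muley ?lte_fin ?leey //.
  by rewrite gt_eqF // (lt_le_trans ltNy0) // mule_ge0 ?lee_fin // ltW.
set kap := k1 + Num.sqrt #|N|%:R * t.
have kap0 : 0 < kap by rewrite -lte_fin.
rewrite -(fineK g2fin) -(fineK g1fin).
apply/lee_addgt0Pr => eps eps0.
have kk0 : 0 < 45 * (k2 + kap) by rewrite mulr_gt0 // addr_gt0.
(* Perturbing both complexities by x adds 45 (k2 + kap) x in total, hence the division. *)
have := key (eps / (45 * (k2 + kap))); rewrite divr_gt0 // => /(_ isT) /le_trans; apply.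
rewrite [leLHS](_ : _ = (45 * (k2 * (fine g2 + eps / (45 * (k2 + kap))) +
   kap * (fine g1 + eps / (45 * (k2 + kap)))))%:E) //.
rewrite [leRHS](_ : _ = (45 * (k2 * fine g2 + kap * fine g1) + eps)%:E) //.
rewrite lee_fin le_eqVlt; apply/orP; left; apply/eqP; field.
by rewrite gt_eqF // addr_gt0.
Qed.

End Assembly.

Theorem theorem2 (R : realType) :
  exists2 C : R, 0 < C &
  forall (n : nat) (N : finType) (e : rel N)
    (d : measure_display) (T : measurableType d) (P : probability T R)
    (X : completePseudoMetricType R)
    (Z : N -> {RV P >-> g_sigma_algebraType (@open X)})
    (F : set (g_sigma_algebraType (@open X) -> R)),
  (0 < n)%N -> #|N| = n -> symmetric e ->
  polish_space X ->
  network_dependent e Z ->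
  F (fun=> 0) ->
  (forall f, F f -> measurable_fun setT f) ->
  forall (a b : R) (p : \bar R) (r M : nat) (B : 'I_M -> {set N})
    (c : 'I_M -> 'I_(min_colors R e B r)),
  1 <= a -> 1 <= b -> (1 <= p)%E ->
  injective B -> finset.partition (B @: [set: 'I_M])%SET [set: N]%SET ->
  proper_coloring R e B r c ->
  ('N[P]_1[(fun w => ereal_sup [set (emp_process Z f w)%:E | f in F])]
   <= C%:E *
      ((Num.sqrt (min_colors R e B r)%:R
          * \big[Num.max/0]_(m < M) Gamma e Z F p (B m))%:E
         * gamma 2 a F (max_Lnorm Z (2%:E * p))
       + (((min_colors R e B r)%:R * (\max_(m < M) #|B m|)%:R / Num.sqrt n%:R)%:E
          + (Num.sqrt n%:R)%:E * tau_bar Z (cone F) B c)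
         * gamma 1 b F (@sup_norm R _)))%E.
Proof.
exists 45%R => // n N e d T P X Z F n0 Nn _ _ dep F0 mF a b p r M B c a1 b1 p1 Binj Bpart _.
by subst n; apply: (network_maximal_inequality c dep F0 mF p1 Binj Bpart n0 a1 b1).
Qed.
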